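(* Let $c=0$ (i.e. $\alpha=\pi/2$) and $0<\kappa\le1$. Then for every $g\in SO(3)$ there is an optimal decomposition of $g$ (so the infimum of Problem 1 is attained) which is a subword of one of the following patterns or of a pattern obtained from one of them by a symmetry in the group $(X,Y)\mapsto\{\pm X,\pm Y\}$: (I) $R(t_XX)\,R(t_YY)\,R(-t_XX)\,R(-t_YY)$, where $0<t_X,t_Y\le\pi$ and $\tan(t_X/2)=\kappa\tan(t_Y/2)$; (II) $R(\pi X)\,R(tW_+)\,R(\pi X)$ with $t\ge0$; (III) $R(\pi X)\,R(tW_+)\,R(-\pi Y)$ with $t\ge 0$.
   Context: Fix unit vectors $X,Y\in\mathbb R^3$ with angle $\alpha\in(0,\pi/2]$, $c=\cos\alpha\in[0,1)$, and $\kappa\in[0,1]$. For a unit vector $v$, $R(tv)\in SO(3)$ is rotation by angle $t$ about $v$ (counterclockwise viewed from the tip): $R(tv)=\cos t\,I+\sin t\,[v]_\times+(1-\cos t)vv^T$, $[v]_\times w=v\times w$; for nonzero non-unit $v$, $R(tv):=R((t|v|)\,v/|v|)$. For nonzero $C=aX+bY$, $\mathrm{cost}(C)=|a|+\kappa|b|$. A decomposition of $g\in SO(3)$ is a finite product $g=R(\tau_1C_1)\cdots R(\tau_nC_n)$ with $\tau_j\ge0$, $C_j$ nonzero in $\mathrm{span}\{X,Y\}$ (a factor $R(-\tau C)$, $\tau\ge0$, means $R(\tau(-C))$), with cost $\sum\tau_j\mathrm{cost}(C_j)$. Problem 1: minimize the cost over all decompositions of $g$; a decomposition is optimal if its cost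 equals the infimum. Set $W_+=(1+\kappa c)X-(\kappa+c)Y$, $W_-=(1-\kappa c)X+(\kappa-c)Y$. Subword: for a word $R(\tau_1C_1)\cdots R(\tau_nC_n)$ ($\tau_j\ge0$), a subword is $R(\tau_k'C_k)R(\tau_{k+1}C_{k+1})\cdots R(\tau_{m-1}C_{m-1})R(\tau_m'C_m)$ with $1\le k\le m\le n$, $0\le\tau_k'\le\tau_k$, $0\le\tau_m'\le\tau_m$ (for $k=m$ a single factor $R(\tau'C_k)$, $0\le\tau'\le\tau_k$). Symmetries of patterns: labels are $\pm X,\pm Y,\pm W_+,\pm W_-$; define label maps, each extended by $\sigma(-C)=-\sigma(C)$: $\nu:C\mapsto -C$; $\rho: X\mapsto X,\ Y\mapsto -Y,\ W_+\mapsto W_-,\ W_-\mapsto W_+$; $\varsigma: X\mapsto Y,\ Y\mapsto X,\ W_+\mapsto -W_+,\ W_-\mapsto W_-$. Applying $\nu$ or $\rho$ to a pattern replaces each label by its image and keeps the times. Applying $\varsigma$ replaces each label by its image and additionally interchanges $t_X\leftrightarrow t_Y$ (and $\hat t_X\leftrightarrow\hat t_Y$ where present), times $\pi$ and free parameters $t$ unchanged, so that factors labelled $\pm X$ carry the $X$-time and factors labelled $\pm Y$ carry the $Y$-time; stated relations and ranges (e.g. $\tan(t_X/2)=\kappa\tan(t_Y/2)$, $0<t_X,t_Y\le\pi$) are kept verbatim. ''Symmetric under $(X,Y)\mapsto\{\pm X,\pm Y\}$'' means images under the 8-element group generated by $\nu,\rho,\varsigma$. *)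

(* Defs.v *)
From Stdlib Require Import Reals List.
Import ListNotations.
Open Scope R_scope.

Record vec := mkv { vx : R; vy : R; vz : R }.
Definition vadd (v w : vec) : vec := mkv (vx v + vx w) (vy v + vy w) (vz v + vz w).
Definition vscale (a : R) (v : vec) : vec := mkv (a * vx v) (a * vy v) (a * vz v).
Definition vzero : vec := mkv 0 0 0.
Definition dot (v w : vec) : R := vx v * vx w + vy v * vy w + vz v * vz w.
Definition vnorm (v : vec) : R := sqrt (dot v v).

Record mat := mkm { m11 : R; m12 : R; m13 : R;
                    m21 : R; m22 : R; m23 : R;
                    m31 : R; m32 : R; m33 : R }.
Definition mid3 : mat := mkm 1 0 0 0 1 0 0 0 1.
Definition mmul (A B : mat) : mat :=
  mkm (m11 A * m11 B + m12 A * m21 B + m13 A * m31 B)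
      (m11 A * m12 B + m12 A * m22 B + m13 A * m32 B)
      (m11 A * m13 B + m12 A * m23 B + m13 A * m33 B)
      (m21 A * m11 B + m22 A * m21 B + m23 A * m31 B)
      (m21 A * m12 B + m22 A * m22 B + m23 A * m32 B)
      (m21 A * m13 B + m22 A * m23 B + m23 A * m33 B)
      (m31 A * m11 B + m32 A * m21 B + m33 A * m31 B)
      (m31 A * m12 B + m32 A * m22 B + m33 A * m32 B)
      (m31 A * m13 B + m32 A * m23 B + m33 A * m33 B).
Definition mtrans (A : mat) : mat :=
  mkm (m11 A) (m21 A) (m31 A) (m12 A) (m22 A) (m32 A) (m13 A) (m23 A) (m33 A).
Definition mdet (A : mat) : R :=
  m11 A * (m22 A * m33 A - m23 A * m32 A)
  - m12 A * (m21 A * m33 A - m23 A * m31 A)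
  + m13 A * (m21 A * m32 A - m22 A * m31 A).

Definition inSO3 (g : mat) : Prop := mmul (mtrans g) g = mid3 /\ mdet g = 1.

(* R(t u) for a unit vector u:  cos t I + sin t [u]_x + (1 - cos t) u u^T *)
Definition rot_unit (t : R) (u : vec) : mat :=
  let c := cos t in let s := sin t in let k := 1 - c in
  let a := vx u in let b := vy u in let d := vz u in
  mkm (c + k * a * a)       (- s * d + k * a * b)  (s * b + k * a * d)
      (s * d + k * b * a)   (c + k * b * b)        (- s * a + k * b * d)
      (- s * b + k * d * a) (s * a + k * d * b)    (c + k * d * d).

Definition rot (t : R) (v : vec) : mat :=
  rot_unit (t * vnorm v) (vscale (/ vnorm v) v).

(* A factor (tau, (a, b)) stands for R(tau C) with C = a X + b Y. *)
Definition factor := (R * (R * R))%type.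
Definition word := list factor.

Definition fvec (X Y : vec) (ab : R * R) : vec :=
  vadd (vscale (fst ab) X) (vscale (snd ab) Y).

Definition word_prod (X Y : vec) (w : word) : mat :=
  fold_right (fun f acc => mmul (rot (fst f) (fvec X Y (snd f))) acc) mid3 w.

Definition is_decomp (X Y : vec) (g : mat) (w : word) : Prop :=
  Forall (fun f => 0 <= fst f /\ fvec X Y (snd f) <> vzero) w /\
  word_prod X Y w = g.

Definition cost (kappa : R) (w : word) : R :=
  fold_right (fun f acc => fst f * (Rabs (fst (snd f)) + kappa * Rabs (snd (snd f))) + acc) 0 w.

Definition optimal (kappa : R) (X Y : vec) (g : mat) (w : word) : Prop :=
  is_decomp X Y g w /\
  forall w', is_decomp X Y g w' -> cost kappa w <= cost kappa w'.

Definition dfac : factor := (0, (0, 0)).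
Definition subword (w' w : word) : Prop :=
  exists pre blk post,
    w = pre ++ blk ++ post /\ (1 <= length blk)%nat /\ length w' = length blk /\
    forall i, (i < length blk)%nat ->
      snd (nth i w' dfac) = snd (nth i blk dfac) /\
      (if (Nat.eqb i 0 || Nat.eqb i (length blk - 1))%bool
       then 0 <= fst (nth i w' dfac) <= fst (nth i blk dfac)
       else fst (nth i w' dfac) = fst (nth i blk dfac)).

Inductive blabel := LX | LY | LWp | LWm.
(* signed label: (true, l) means -l *)
Definition label := (bool * blabel)%type.

(* coefficients (a,b) of a base label, with c = cos alpha *)
Definition bcoef (kappa c : R) (l : blabel) : R * R :=
  match l with
  | LX => (1, 0)
  | LY => (0, 1)
  | LWp => (1 + kappa * c, - (kappa + c))
  | LWm => (1 - kappa * c, kappa - c)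
  end.
Definition lcoef (kappa c : R) (l : label) : R * R :=
  let ab := bcoef kappa c (snd l) in
  if fst l then (- fst ab, - snd ab) else ab.

Inductive tsym := TX | TY | TPi | TT.
Definition pattern := list (tsym * label).

Inductive gen := Gnu | Grho | Gvs.

Definition bact (g : gen) (l : blabel) : label :=
  match g, l with
  | Gnu, l => (true, l)
  | Grho, LX => (false, LX)
  | Grho, LY => (true, LY)
  | Grho, LWp => (false, LWm)
  | Grho, LWm => (false, LWp)
  | Gvs, LX => (false, LY)
  | Gvs, LY => (false, LX)
  | Gvs, LWp => (true, LWp)
  | Gvs, LWm => (false, LWm)
  end.
Definition lact (g : gen) (l : label) : label :=
  let r := bact g (snd l) in (xorb (fst l) (fst r), snd r).
Definition tact (g : gen) (s : tsym) : tsym :=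
  match g, s with
  | Gvs, TX => TY
  | Gvs, TY => TX
  | _, s => s
  end.
Definition pact (g : gen) (p : pattern) : pattern :=
  map (fun f => (tact g (fst f), lact g (snd f))) p.
(* image of a pattern under a composite of generators (all elements of the
   8-element group arise this way) *)
Definition pact_list (gs : list gen) (p : pattern) : pattern :=
  fold_right pact p gs.

Definition pX : label := (false, LX).
Definition mX : label := (true, LX).
Definition pY : label := (false, LY).
Definition mY : label := (true, LY).
Definition pWp : label := (false, LWp).

Definition patI : pattern := [(TX, pX); (TY, pY); (TX, mX); (TY, mY)].
Definition patII : pattern := [(TPi, pX); (TT, pWp); (TPi, pX)].
Definition patIII : pattern := [(TPi, pX); (TT, pWp); (TPi, mY)].

Definition tval (tX tY t : R) (s : tsym) : R :=
  match s with TX => tX | TY => tY | TPi => PI | TT => t end.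

Definition instantiate (kappa c tX tY t : R) (p : pattern) : word :=
  map (fun f => (tval tX tY t (fst f), lcoef kappa c (snd f))) p.

Definition pattern_family (kappa c : R) (w : word) : Prop :=
  exists gs : list gen,
    (exists tX tY, 0 < tX <= PI /\ 0 < tY <= PI /\
        tan (tX / 2) = kappa * tan (tY / 2) /\
        w = instantiate kappa c tX tY 0 (pact_list gs patI)) \/
    (exists t, 0 <= t /\ w = instantiate kappa c 0 0 t (pact_list gs patII)) \/
    (exists t, 0 <= t /\ w = instantiate kappa c 0 0 t (pact_list gs patIII)).

(* Main.v *)
Require Import Defs.
From Stdlib Require Import Reals List Lra Lia ClassicalEpsilon.
From Coquelicot Require Import Coquelicot.
Import ListNotations.
Open Scope R_scope.

(** Instead of fixing the endpoint, minimize [c + <A, M>] over all words, where [M] is the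
    product of the word, [c] its cost and [A] an arbitrary matrix.

    A compact class of words with few factors contains minimizers.  The differential of
    [<A, .>] gives a covector along such a word; the first-order conditions in the times and
    axes pin it down at every switch, and a five-factor word [X Y -X -Y X] is never minimal,
    because its two equal [Y]-times can be made different at a strictly smaller cost.  As a
    result the covector at the end of a minimizer lies in the polar of the unit ball of the
    cost.  This is a Hamilton-Jacobi inequality: appending a short factor to a word never
    gains more than second order, hence, subdividing, minimizers over the class are minimal
    among all words.  Then the covector condition holds all along the word, and only the
    subwords of the patterns survive.

    Finally take [A = - k g] and let [k] tend to infinity; the patterns depend on finitely
    many bounded parameters, so that in the limit one of them reaches [g] exactly, at a cost
    not exceeding the infimum. *)


(** With a free endpoint every perturbed word is a competitor, so the first-order conditions hold
    with the explicit covector of [A] and without multipliers. The price is a condition at the end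
    of a minimizer, derived by appending a short factor, and the lengthened word must again lie in
    the class. This shapes the class: [X Y -X] is tested with a fourth letter and [X Y -X -Y] with a
    fifth, and the chain would go on if five-letter words could be minimal with all times inside
    their ranges. Stationarity in the times forces the two [Y]-times of such a word to be equal; the
    exclusion then rests on an exact deformation, read off quaternions. The bounds at the start of a
    word wait until minimality among all words is known, because the perturbations that prove them
    are not confined to the class. The limit needs no convergent sequence. For rotations
    [3 - <g, M>] is half the squared distance, so the optimum for [A = - k g] misses [g] by at most
    [m / k] in this measure, [m] being the infimum. One continuous function on compact parameter
    boxes measures every failure at once; its minimum is at most [m / k] for each [k], hence
    zero. *)

Definition madd (A B : mat) : mat :=
  mkm (m11 A + m11 B) (m12 A + m12 B) (m13 A + m13 B)
      (m21 A + m21 B) (m22 A + m22 B) (m23 A + m23 B)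
      (m31 A + m31 B) (m32 A + m32 B) (m33 A + m33 B).
Definition mscale (a : R) (A : mat) : mat :=
  mkm (a * m11 A) (a * m12 A) (a * m13 A)
      (a * m21 A) (a * m22 A) (a * m23 A)
      (a * m31 A) (a * m32 A) (a * m33 A).
Definition ip (A B : mat) : R :=
  m11 A * m11 B + m12 A * m12 B + m13 A * m13 B +
  m21 A * m21 B + m22 A * m22 B + m23 A * m23 B +
  m31 A * m31 B + m32 A * m32 B + m33 A * m33 B.

Declare Scope mat_scope.
Delimit Scope mat_scope with M.
Infix "*" := mmul : mat_scope.
Infix "+" := madd : mat_scope.
Infix "*:" := mscale (at level 40) : mat_scope.
Bind Scope mat_scope with mat.

Lemma mat_ext (A B : mat) :
  m11 A = m11 B -> m12 A = m12 B -> m13 A = m13 B ->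
  m21 A = m21 B -> m22 A = m22 B -> m23 A = m23 B ->
  m31 A = m31 B -> m32 A = m32 B -> m33 A = m33 B -> A = B.
Proof. destruct A, B; simpl; intros; subst; reflexivity. Qed.

Ltac mring := apply mat_ext; simpl; ring.

Lemma mmul_assoc (A B C : mat) : (A * B * C)%M = (A * (B * C))%M.
Proof. mring. Qed.
Lemma mmul_1_l (A : mat) : (mid3 * A)%M = A.
Proof. mring. Qed.
Lemma mmul_1_r (A : mat) : (A * mid3)%M = A.
Proof. mring. Qed.
Lemma mmul_add_l (A B C : mat) : ((A + B) * C)%M = (A * C + B * C)%M.
Proof. mring. Qed.
Lemma mmul_add_r (A B C : mat) : (A * (B + C))%M = (A * B + A * C)%M.
Proof. mring. Qed.
Lemma mmul_scale_l a (A B : mat) : ((a *: A) * B)%M = (a *: (A * B))%M.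
Proof. mring. Qed.
Lemma mmul_scale_r a (A B : mat) : (A * (a *: B))%M = (a *: (A * B))%M.
Proof. mring. Qed.
Lemma mtrans_mul (A B : mat) : mtrans (A * B)%M = (mtrans B * mtrans A)%M.
Proof. mring. Qed.
Lemma mtransK (A : mat) : mtrans (mtrans A) = A.
Proof. mring. Qed.
Lemma ip_add_r (A B C : mat) : ip A (B + C)%M = ip A B + ip A C.
Proof. unfold ip; simpl; ring. Qed.
Lemma ip_scale_r a (A B : mat) : ip A (a *: B)%M = a * ip A B.
Proof. unfold ip; simpl; ring. Qed.
Lemma ip_scale_l a (A B : mat) : ip (a *: A)%M B = a * ip A B.
Proof. unfold ip; simpl; ring. Qed.
Lemma ip_mul_l (A B C : mat) : ip A (B * C)%M = ip (mtrans B * A)%M C.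
Proof. unfold ip; simpl; ring. Qed.
Lemma ip_mul_r (A B C : mat) : ip A (B * C)%M = ip (A * mtrans C)%M B.
Proof. unfold ip; simpl; ring. Qed.

(** * Rotations about the coordinate axes and about axes in their first plane *)

Definition Rx (t : R) : mat :=
  mkm 1 0 0 0 (cos t) (- sin t) 0 (sin t) (cos t).
Definition Ry (t : R) : mat :=
  mkm (cos t) 0 (sin t) 0 1 0 (- sin t) 0 (cos t).
Definition Rz (t : R) : mat :=
  mkm (cos t) (- sin t) 0 (sin t) (cos t) 0 0 0 1.
Definition KX : mat := mkm 0 0 0 0 0 (-1) 0 1 0.
Definition KY : mat := mkm 0 0 1 0 0 0 (-1) 0 0.
Definition KZ : mat := mkm 0 (-1) 0 1 0 0 0 0 0.
(** The rotation by [th] about the axis [(cos ph, sin ph, 0)]. As a conjugate of [Rx th] it inherits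
    transport rules and derivatives from [Rx] and [Rz]. *)
Definition Exy (th ph : R) : mat := (Rz ph * (Rx th * Rz (- ph)))%M.

Lemma Rx_add s t : (Rx s * Rx t)%M = Rx (s + t).
Proof. apply mat_ext; simpl; rewrite ?cos_plus, ?sin_plus; ring. Qed.
Lemma Ry_add s t : (Ry s * Ry t)%M = Ry (s + t).
Proof. apply mat_ext; simpl; rewrite ?cos_plus, ?sin_plus; ring. Qed.
Lemma Rz_add s t : (Rz s * Rz t)%M = Rz (s + t).
Proof. apply mat_ext; simpl; rewrite ?cos_plus, ?sin_plus; ring. Qed.
Lemma Rx_0 : Rx 0 = mid3.
Proof. apply mat_ext; simpl; rewrite ?cos_0, ?sin_0; ring. Qed.
Lemma Ry_0 : Ry 0 = mid3.
Proof. apply mat_ext; simpl; rewrite ?cos_0, ?sin_0; ring. Qed.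
Lemma Rz_0 : Rz 0 = mid3.
Proof. apply mat_ext; simpl; rewrite ?cos_0, ?sin_0; ring. Qed.
Lemma cos_2PI_sub t : cos (t - 2 * PI) = cos t.
Proof. rewrite cos_minus, cos_2PI, sin_2PI; ring. Qed.
Lemma sin_2PI_sub t : sin (t - 2 * PI) = sin t.
Proof. rewrite sin_minus, cos_2PI, sin_2PI; ring. Qed.
Lemma Rx_2PI t : Rx (t - 2 * PI) = Rx t.
Proof. unfold Rx. now rewrite cos_2PI_sub, sin_2PI_sub. Qed.
Lemma Ry_2PI t : Ry (t - 2 * PI) = Ry t.
Proof. unfold Ry. now rewrite cos_2PI_sub, sin_2PI_sub. Qed.
Lemma Rx_PI_Ry t : (Rx PI * Ry t)%M = (Ry (- t) * Rx PI)%M.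
Proof. apply mat_ext; simpl; rewrite ?cos_neg, ?sin_neg, ?cos_PI, ?sin_PI; ring. Qed.
Lemma Ry_PI_Rx t : (Ry PI * Rx t)%M = (Rx (- t) * Ry PI)%M.
Proof. apply mat_ext; simpl; rewrite ?cos_neg, ?sin_neg, ?cos_PI, ?sin_PI; ring. Qed.

Lemma Exy_0 th : Exy th 0 = Rx th.
Proof. apply mat_ext; simpl; rewrite ?cos_neg, ?sin_neg, ?cos_0, ?sin_0; ring. Qed.
Lemma Exy_PI2 th : Exy th (PI / 2) = Ry th.
Proof. apply mat_ext; simpl; rewrite ?cos_neg, ?sin_neg, ?cos_PI2, ?sin_PI2; ring. Qed.
Lemma Exy_PI th : Exy th PI = Rx (- th).
Proof. apply mat_ext; simpl; rewrite ?cos_neg, ?sin_neg, ?cos_PI, ?sin_PI; ring. Qed.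
Lemma Exy_mPI2 th : Exy th (- (PI / 2)) = Ry (- th).
Proof.
  apply mat_ext; simpl; rewrite ?Ropp_involutive, ?cos_neg, ?sin_neg, ?cos_PI2, ?sin_PI2; ring.
Qed.
Lemma Exy_add s t ph : (Exy s ph * Exy t ph)%M = Exy (s + t) ph.
Proof.
  unfold Exy. rewrite !mmul_assoc, <- (mmul_assoc (Rz (- ph)) (Rz ph)), Rz_add.
  replace (- ph + ph) with 0 by ring. rewrite Rz_0, mmul_1_l.
  now rewrite <- (mmul_assoc (Rx s)), Rx_add.
Qed.
Lemma Exy_0_l ph : Exy 0 ph = mid3.
Proof.
  unfold Exy. rewrite Rx_0, mmul_1_l, Rz_add. replace (ph + - ph) with 0 by ring. apply Rz_0.
Qed.
Lemma Exy_2PI ph : Exy (2 * PI) ph = mid3.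
Proof.
  unfold Exy. rewrite <- (Rx_2PI (2 * PI)). rewrite Rminus_diag. apply Exy_0_l.
Qed.

(** * The covector of a linear functional along a product *)

(* [covec A K u v] is the component along the infinitesimal rotation [K] of minus the
   differential of [ip A] when a factor is inserted between [u] and [v]. *)
Definition covec (A K u v : mat) : R := - ip A (u * (K * v))%M.

(** Moving [r] across the insertion point transports the covector by the adjoint action of [r];
    along a letter it therefore rotates about the axis of that letter. *)
Lemma covec_transport_gen A (K1 K2 K3 u v r : mat) a b :
  (r * K1 = (a *: K2 + b *: K3) * r)%M ->
  covec A K1 (u * r)%M v = a * covec A K2 u (r * v)%M + b * covec A K3 u (r * v)%M.
Proof.
  intros H. unfold covec.
  rewrite mmul_assoc, <- (mmul_assoc r K1 v), H, mmul_assoc, mmul_add_l, mmul_add_r,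
    !mmul_scale_l, !mmul_scale_r, ip_add_r, !ip_scale_r. ring.
Qed.

Ltac trig := rewrite ?cos_neg, ?sin_neg.
Lemma covec_Rx_X A u v t : covec A KX (u * Rx t)%M v = covec A KX u (Rx t * v)%M.
Proof.
  rewrite (covec_transport_gen A KX KX KX u v (Rx t) 1 0); [ring|]. mring.
Qed.
Lemma covec_Rx_Y A u v t : covec A KY (u * Rx t)%M v
  = cos t * covec A KY u (Rx t * v)%M + sin t * covec A KZ u (Rx t * v)%M.
Proof. apply covec_transport_gen.
 apply mat_ext; simpl; try ring; pose proof (sin2_cos2 t); unfold Rsqr in *; nra. Qed.
Lemma covec_Rx_Z A u v t : covec A KZ (u * Rx t)%M v
  = cos t * covec A KZ u (Rx t * v)%M + - sin t * covec A KY u (Rx t * v)%M.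
Proof. apply covec_transport_gen.
 apply mat_ext; simpl; try ring; pose proof (sin2_cos2 t); unfold Rsqr in *; nra. Qed.
Lemma covec_Ry_Y A u v t : covec A KY (u * Ry t)%M v = covec A KY u (Ry t * v)%M.
Proof.
  rewrite (covec_transport_gen A KY KY KY u v (Ry t) 1 0); [ring|]. mring.
Qed.
Lemma covec_Ry_X A u v t : covec A KX (u * Ry t)%M v
  = cos t * covec A KX u (Ry t * v)%M + - sin t * covec A KZ u (Ry t * v)%M.
Proof. apply covec_transport_gen.
 apply mat_ext; simpl; try ring; pose proof (sin2_cos2 t); unfold Rsqr in *; nra. Qed.
Lemma covec_Ry_Z A u v t : covec A KZ (u * Ry t)%M v
  = cos t * covec A KZ u (Ry t * v)%M + sin t * covec A KX u (Ry t * v)%M.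
Proof. apply covec_transport_gen.
 apply mat_ext; simpl; try ring; pose proof (sin2_cos2 t); unfold Rsqr in *; nra. Qed.
Lemma covec_Rz_X A u v t : covec A KX (u * Rz t)%M v
  = cos t * covec A KX u (Rz t * v)%M + sin t * covec A KY u (Rz t * v)%M.
Proof. apply covec_transport_gen.
 apply mat_ext; simpl; try ring; pose proof (sin2_cos2 t); unfold Rsqr in *; nra. Qed.
Lemma covec_Rz_Y A u v t : covec A KY (u * Rz t)%M v
  = cos t * covec A KY u (Rz t * v)%M + - sin t * covec A KX u (Rz t * v)%M.
Proof. apply covec_transport_gen.
 apply mat_ext; simpl; try ring; pose proof (sin2_cos2 t); unfold Rsqr in *; nra. Qed.
Lemma covec_Rz_Z A u v t : covec A KZ (u * Rz t)%M v = covec A KZ u (Rz t * v)%M.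
Proof.
  rewrite (covec_transport_gen A KZ KZ KZ u v (Rz t) 1 0); [ring|]. mring.
Qed.

(** * First-order conditions *)

Definition mderive (F : R -> mat) (x : R) (F' : mat) : Prop :=
  is_derive (fun t => m11 (F t)) x (m11 F') /\ is_derive (fun t => m12 (F t)) x (m12 F') /\
  is_derive (fun t => m13 (F t)) x (m13 F') /\ is_derive (fun t => m21 (F t)) x (m21 F') /\
  is_derive (fun t => m22 (F t)) x (m22 F') /\ is_derive (fun t => m23 (F t)) x (m23 F') /\
  is_derive (fun t => m31 (F t)) x (m31 F') /\ is_derive (fun t => m32 (F t)) x (m32 F') /\
  is_derive (fun t => m33 (F t)) x (m33 F').

Ltac msplit := unfold mderive; refine (conj _ (conj _ (conj _ (conj _ (conj _ (conj _ (conj _ (conj _ _)))))))).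

Lemma is_derive_ext_val (f : R -> R) x l l' : is_derive f x l -> l = l' -> is_derive f x l'.
Proof. intros H <-; exact H. Qed.

Lemma is_derive_dot3 (f1 f2 f3 g1 g2 g3 : R -> R) x a1 a2 a3 b1 b2 b3 :
  is_derive f1 x a1 -> is_derive f2 x a2 -> is_derive f3 x a3 ->
  is_derive g1 x b1 -> is_derive g2 x b2 -> is_derive g3 x b3 ->
  is_derive (fun t => f1 t * g1 t + f2 t * g2 t + f3 t * g3 t) x
    ((a1 * g1 x + a2 * g2 x + a3 * g3 x) + (f1 x * b1 + f2 x * b2 + f3 x * b3)).
Proof.
  intros. eapply is_derive_ext_val.
  - apply (is_derive_plus (fun t => f1 t * g1 t + f2 t * g2 t) (fun t => f3 t * g3 t)).
    + apply (is_derive_plus (fun t => f1 t * g1 t) (fun t => f2 t * g2 t)).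
      * apply (is_derive_mult f1 g1); [eassumption..|intros; apply Rmult_comm].
      * apply (is_derive_mult f2 g2); [eassumption..|intros; apply Rmult_comm].
    + apply (is_derive_mult f3 g3); [eassumption..|intros; apply Rmult_comm].
  - unfold plus, mult; simpl. ring.
Qed.

Lemma mderive_mul F G x F' G' :
  mderive F x F' -> mderive G x G' ->
  mderive (fun t => F t * G t)%M x (F' * G x + F x * G')%M.
Proof.
  intros (?&?&?&?&?&?&?&?&?) (?&?&?&?&?&?&?&?&?).
  msplit; simpl; apply is_derive_dot3; assumption.
Qed.

Lemma mderive_const M x : mderive (fun _ => M) x (mscale 0 M).
Proof. msplit; simpl; rewrite Rmult_0_l; apply @is_derive_const. Qed.

Lemma mderive_Rx x : mderive Rx x (Rx x * KX)%M.
Proof. msplit; simpl; auto_derive; trivial; ring. Qed.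
Lemma mderive_Ry x : mderive Ry x (Ry x * KY)%M.
Proof. msplit; simpl; auto_derive; trivial; ring. Qed.
Lemma mderive_Rz x : mderive Rz x (Rz x * KZ)%M.
Proof. msplit; simpl; auto_derive; trivial; ring. Qed.
Lemma mderive_Rz_opp x : mderive (fun t => Rz (- t)) x (mscale (-1) (KZ * Rz (- x)))%M.
Proof. msplit; simpl; auto_derive; trivial; ring. Qed.

Lemma mderive_ip A F x F' : mderive F x F' -> is_derive (fun t => ip A (F t)) x (ip A F').
Proof.
  intros (?&?&?&?&?&?&?&?&?). unfold ip.
  repeat (refine (is_derive_plus (V:=R_NormedModule) _ _ _ _ _ _ _)); apply is_derive_scal; assumption.
Qed.

Lemma is_derive_right_min (f : R -> R) x l eta :
  is_derive f x l -> 0 < eta -> (forall e, 0 < e < eta -> f x <= f (x + e)) -> 0 <= l.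
Proof.
  intros Hd Heta Hmin. apply is_derive_Reals in Hd.
  destruct (Rle_or_lt 0 l) as [|Hl]; [assumption|exfalso].
  destruct (Hd (- l / 2)) as [d Hd']; [lra|].
  set (e := Rmin (d / 2) (eta / 2)).
  assert (He : 0 < e) by (apply Rmin_pos; [pose proof (cond_pos d)|]; lra).
  assert (He1 : e <= d / 2) by apply Rmin_l.
  assert (He2 : e <= eta / 2) by apply Rmin_r.
  pose proof (cond_pos d).
  specialize (Hd' e ltac:(lra) ltac:(rewrite Rabs_pos_eq; lra)).
  apply Rabs_lt_between in Hd'.
  specialize (Hmin e ltac:(lra)).
  assert (0 <= (f (x + e) - f x) / e) by (apply Rmult_le_pos; [lra | left; apply Rinv_0_lt_compat; lra]).
  lra.
Qed.

Lemma is_derive_left_min (f : R -> R) x l eta :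
  is_derive f x l -> 0 < eta -> (forall e, 0 < e < eta -> f x <= f (x - e)) -> l <= 0.
Proof.
  intros Hd Heta Hmin.
  enough (0 <= - l) by lra.
  apply (is_derive_right_min (fun t => f (- t)) (- x) _ eta); [|assumption|].
  - apply is_derive_ext_val with (scal (-1) l); [|unfold scal; simpl; unfold mult; simpl; ring].
    apply (is_derive_comp f (fun t => - t)).
    + now rewrite Ropp_involutive.
    + auto_derive; trivial; ring.
  - intros e He. replace (- (- x + e)) with (x - e) by ring.
    rewrite Ropp_involutive. auto.
Qed.

Definition lower_bound (S : mat -> R -> Prop) (A M : mat) (c : R) : Prop :=
  forall M' c', S M' c' -> c + ip A M <= c' + ip A M'.
Definition minimizer (S : mat -> R -> Prop) (A M : mat) (c : R) : Prop :=
  S M c /\ lower_bound S A M c.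

(** Along the curve only an upper bound [f] for the cost is required, exact at [x]. Thus [f] can be
    smooth although the cost contains absolute values. *)
Lemma lower_bound_derive (S : mat -> R -> Prop) A M c F F' x (f : R -> R) f' eta :
  lower_bound S A M c -> mderive F x F' -> is_derive f x f' -> F x = M -> f x = c -> 0 < eta ->
  (forall e, 0 < e < eta -> exists c', S (F (x + e)) c' /\ c' <= f (x + e)) ->
  0 <= f' + ip A F'.
Proof.
  intros Hm HF Hf <- <- Heta HS.
  apply (is_derive_right_min (fun t => f t + ip A (F t)) x _ eta); trivial.
  - apply @is_derive_plus; [assumption|]. now apply mderive_ip.
  - intros e He. destruct (HS e He) as (c' & H1 & H2). specialize (Hm _ _ H1). lra.
Qed.

Lemma lower_bound_derive_left (S : mat -> R -> Prop) A M c F F' x (f : R -> R) f' eta :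
  lower_bound S A M c -> mderive F x F' -> is_derive f x f' -> F x = M -> f x = c -> 0 < eta ->
  (forall e, 0 < e < eta -> exists c', S (F (x - e)) c' /\ c' <= f (x - e)) ->
  f' + ip A F' <= 0.
Proof.
  intros Hm HF Hf <- <- Heta HS.
  apply (is_derive_left_min (fun t => f t + ip A (F t)) x _ eta); trivial.
  - apply @is_derive_plus; [assumption|]. now apply mderive_ip.
  - intros e He. destruct (HS e He) as (c' & H1 & H2). specialize (Hm _ _ H1). lra.
Qed.

Lemma mderive_mul_const_l u F x F' : mderive F x F' -> mderive (fun t => u * F t)%M x (u * F')%M.
Proof.
  intros H. replace (u * F')%M with (mscale 0 u * F x + u * F')%M by mring.
  apply mderive_mul; [apply mderive_const|exact H].
Qed.
Lemma mderive_mul_const_r v F x F' : mderive F x F' -> mderive (fun t => F t * v)%M x (F' * v)%M.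
Proof.
  intros H. replace (F' * v)%M with (F' * v + F x * mscale 0 v)%M by mring.
  apply (mderive_mul F (fun _ => v)); [exact H|apply mderive_const].
Qed.

Lemma mderive_insert (r : R -> mat) K u v x :
  mderive r x (r x * K)%M ->
  exists F', mderive (fun t => u * (r t * v))%M x F' /\
    forall A, ip A F' = ip A (u * (r x * (K * v)))%M.
Proof.
  intros Hr. eexists; split.
  - apply mderive_mul_const_l, mderive_mul_const_r, Hr.
  - intros A. now rewrite mmul_assoc.
Qed.

Section Insert.
Variables (S : mat -> R -> Prop) (A M : mat) (c : R).
Hypothesis HS : lower_bound S A M c.

(** To first order a factor of angle [e] inserted between [u] and [v] lowers [ip A] by
    [e * covec A K u v], and it costs at most [k * e]. *)
Lemma insert_pos (r : R -> mat) K u v k eta :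
  mderive r 0 (r 0 * K)%M -> r 0 = mid3 -> (u * v)%M = M -> 0 < eta ->
  (forall e, 0 < e < eta -> exists c', S (u * (r e * v))%M c' /\ c' <= c + k * e) ->
  covec A K u v <= k.
Proof.
  intros Hr Hr0 Huv Heta H.
  destruct (mderive_insert r K u v 0 Hr) as (F' & HF & HFip).
  enough (0 <= k + ip A F').
  { rewrite HFip, Hr0, mmul_1_l in H0. unfold covec. lra. }
  apply (lower_bound_derive S A M c (fun t => u * (r t * v))%M F' 0 (fun t => c + k * t) k eta);
    trivial.
  - auto_derive; trivial; ring.
  - now rewrite Hr0, mmul_1_l.
  - ring.
  - intros e He. rewrite Rplus_0_l. auto.
Qed.

Lemma insert_neg (r : R -> mat) K u v k eta :
  mderive r 0 (r 0 * K)%M -> r 0 = mid3 -> (u * v)%M = M -> 0 < eta ->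
  (forall e, 0 < e < eta -> exists c', S (u * (r (- e) * v))%M c' /\ c' <= c + k * e) ->
  - k <= covec A K u v.
Proof.
  intros Hr Hr0 Huv Heta H.
  destruct (mderive_insert r K u v 0 Hr) as (F' & HF & HFip).
  enough (- k + ip A F' <= 0).
  { rewrite HFip, Hr0, mmul_1_l in H0. unfold covec. lra. }
  apply (lower_bound_derive_left S A M c (fun t => u * (r t * v))%M F' 0 (fun t => c - k * t) (- k) eta);
    trivial.
  - auto_derive; trivial; ring.
  - now rewrite Hr0, mmul_1_l.
  - ring.
  - intros e He. rewrite Rminus_0_l. destruct (H e He) as (c' & H1 & H2).
    exists c'; split; [assumption|]. lra.
Qed.

Lemma insert_Rx u v k eta : (u * v)%M = M -> 0 < eta ->
  (forall e, 0 < e < eta -> exists c', S (u * (Rx e * v))%M c' /\ c' <= c + k * e) ->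
  covec A KX u v <= k.
Proof. apply insert_pos; [apply mderive_Rx | apply Rx_0]. Qed.
Lemma insert_Rx_opp u v k eta : (u * v)%M = M -> 0 < eta ->
  (forall e, 0 < e < eta -> exists c', S (u * (Rx (- e) * v))%M c' /\ c' <= c + k * e) ->
  - k <= covec A KX u v.
Proof. apply insert_neg; [apply mderive_Rx | apply Rx_0]. Qed.
Lemma insert_Ry u v k eta : (u * v)%M = M -> 0 < eta ->
  (forall e, 0 < e < eta -> exists c', S (u * (Ry e * v))%M c' /\ c' <= c + k * e) ->
  covec A KY u v <= k.
Proof. apply insert_pos; [apply mderive_Ry | apply Ry_0]. Qed.
Lemma insert_Ry_opp u v k eta : (u * v)%M = M -> 0 < eta ->
  (forall e, 0 < e < eta -> exists c', S (u * (Ry (- e) * v))%M c' /\ c' <= c + k * e) ->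
  - k <= covec A KY u v.
Proof. apply insert_neg; [apply mderive_Ry | apply Ry_0]. Qed.
End Insert.

(** Turning the axis conjugates the letter by a rotation about the third axis, so the derivative is
    a commutator with [KZ]: one term on each side of the letter. *)
Lemma mderive_Exy_axis th u v ph :
  exists F', mderive (fun x => u * (Exy th x * v))%M ph F' /\
    forall A, ip A F' = covec A KZ (u * Exy th ph)%M v - covec A KZ u (Exy th ph * v)%M.
Proof.
  eexists; split.
  - unfold Exy. apply mderive_mul_const_l, mderive_mul_const_r.
    apply mderive_mul; [apply mderive_Rz|].
    apply mderive_mul_const_l, mderive_Rz_opp.
  - intros A. unfold covec, Exy.
    assert (E : (Rz ph * KZ = KZ * Rz ph)%M) by mring.
    assert (E' : (KZ * Rz (- ph) = Rz (- ph) * KZ)%M) by mring.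
    rewrite E, E', mmul_add_l, mmul_add_r, !mmul_scale_r, mmul_scale_l, mmul_scale_r,
      ip_add_r, ip_scale_r, !mmul_assoc. ring.
Qed.

(** * Symmetries *)

Definition sym := (bool * (bool * bool))%type.
Definition sgn (b : bool) : R := if b then -1 else 1.
(* [(w, (s1, s2))]: exchange the two axes if [w], then flip the first axis if [s1]
   and the second one if [s2]; the third axis follows so that the determinant is [1]. *)
Definition symmx (g : sym) : mat :=
  let '(w, (s1, s2)) := g in
  if w then mkm 0 (sgn s1) 0 (sgn s2) 0 0 0 0 (- (sgn s1 * sgn s2))
  else mkm (sgn s1) 0 0 0 (sgn s2) 0 0 0 (sgn s1 * sgn s2).
Definition conjg (g : sym) (M : mat) : mat := (symmx g * (M * mtrans (symmx g)))%M.
Definition fstc (g : sym) (p q : R) : R := if fst g then q else p.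
Definition sndc (g : sym) (p q : R) : R := if fst g then p else q.
Definition symmul (g g' : sym) : sym :=
  let '(w, (s1, s2)) := g in let '(w', (s1', s2')) := g' in
  (xorb w w', if w then (xorb s1 s2', xorb s2 s1') else (xorb s1 s1', xorb s2 s2')).
Definition syminv (g : sym) : sym :=
  let '(w, (s1, s2)) := g in (w, if w then (s2, s1) else (s1, s2)).

Ltac dsym g := destruct g as [[|] [[|] [|]]].

Lemma symmx_orth g : (mtrans (symmx g) * symmx g)%M = mid3.
Proof. dsym g; apply mat_ext; simpl; ring. Qed.
Lemma symmx_mul g g' : (symmx g * symmx g')%M = symmx (symmul g g').
Proof. dsym g; dsym g'; apply mat_ext; simpl; ring. Qed.
Lemma symmx_inv g : symmx (syminv g) = mtrans (symmx g).
Proof. dsym g; apply mat_ext; simpl; ring. Qed.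
Lemma conj_conj g g' M : conjg g (conjg g' M) = conjg (symmul g g') M.
Proof.
  unfold conjg. rewrite <- symmx_mul, mtrans_mul, !mmul_assoc. reflexivity.
Qed.
Lemma conjK g M : conjg (syminv g) (conjg g M) = M.
Proof.
  unfold conjg. rewrite symmx_inv, mtransK, !mmul_assoc, symmx_orth, mmul_1_r,
    <- mmul_assoc, symmx_orth, mmul_1_l. reflexivity.
Qed.
Lemma syminvK g : syminv (syminv g) = g.
Proof. dsym g; reflexivity. Qed.
Lemma conjVK g M : conjg g (conjg (syminv g) M) = M.
Proof. rewrite <- (syminvK g) at 1. apply conjK. Qed.
Lemma conj_mul g M N : conjg g (M * N)%M = (conjg g M * conjg g N)%M.
Proof.
  unfold conjg. rewrite !mmul_assoc, <- (mmul_assoc (mtrans (symmx g)) (symmx g)), symmx_orth, mmul_1_l.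
  reflexivity.
Qed.
Lemma conj_1 g : conjg g mid3 = mid3.
Proof. dsym g; apply mat_ext; simpl; ring. Qed.
Lemma ip_conj A g M : ip A (conjg g M) = ip (conjg (syminv g) A) M.
Proof.
  unfold conjg. rewrite symmx_inv, mtransK, ip_mul_l, ip_mul_r, mtransK, mmul_assoc. reflexivity.
Qed.
Lemma fstc_mul g g' p q : fstc g' (fstc g p q) (sndc g p q) = fstc (symmul g g') p q.
Proof. dsym g; dsym g'; reflexivity. Qed.
Lemma sndc_mul g g' p q : sndc g' (fstc g p q) (sndc g p q) = sndc (symmul g g') p q.
Proof. dsym g; dsym g'; reflexivity. Qed.
Lemma fstc_inv g p q : fstc (syminv g) (fstc g p q) (sndc g p q) = p.
Proof. dsym g; reflexivity. Qed.
Lemma sndc_inv g p q : sndc (syminv g) (fstc g p q) (sndc g p q) = q.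
Proof. dsym g; reflexivity. Qed.
Lemma fstc_pos g p q : 0 < p -> 0 < q -> 0 < fstc g p q.
Proof. dsym g; auto. Qed.
Lemma sndc_pos g p q : 0 < p -> 0 < q -> 0 < sndc g p q.
Proof. dsym g; auto. Qed.

(** Conjugation by [g] may exchange the two axes; exchanging their weights as well leaves the cost
    [c] unchanged. *)
Definition symclosure (C : R -> R -> mat -> R -> Prop) (p q : R) (M : mat) (c : R) : Prop :=
  exists g M0, C (fstc g p q) (sndc g p q) M0 c /\ M = conjg g M0.

Definition symmetric (C : R -> R -> mat -> R -> Prop) : Prop :=
  forall g p q M c, C (fstc g p q) (sndc g p q) M c -> C p q (conjg g M) c.

Lemma symclosure_sym C : symmetric (symclosure C).
Proof.
  intros g p q M c (g' & M0 & H & ->).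
  exists (symmul g g'), M0. rewrite <- fstc_mul, <- sndc_mul, conj_conj. auto.
Qed.

Lemma symclosure_1 (C : R -> R -> mat -> R -> Prop) p q M c : C p q M c -> symclosure C p q M c.
Proof. intros H. exists (false, (false, false)), M. split; [exact H|]. mring. Qed.

Lemma symmetric_inv C : symmetric C -> forall g p q M c,
  C p q M c -> C (fstc g p q) (sndc g p q) (conjg (syminv g) M) c.
Proof.
  intros HC g p q M c H. apply HC. now rewrite fstc_inv, sndc_inv.
Qed.

Lemma lower_bound_conj C : symmetric C -> forall g p q A M c,
  lower_bound (C p q) A (conjg g M) c ->
  lower_bound (C (fstc g p q) (sndc g p q)) (conjg (syminv g) A) M c.
Proof.
  intros HC g p q A M c H M' c' H'.
  rewrite <- !ip_conj. apply H. now apply HC.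
Qed.

Lemma lower_bound_conj_inv C : symmetric C -> forall g p q A M c,
  lower_bound (C (fstc g p q) (sndc g p q)) (conjg (syminv g) A) M c ->
  lower_bound (C p q) A (conjg g M) c.
Proof.
  intros HC g p q A M c H M' c' H'.
  rewrite ip_conj. rewrite <- (conjVK g M'), ip_conj. apply H. now apply symmetric_inv.
Qed.

Lemma minimizer_conj C : symmetric C -> forall g p q A M c,
  minimizer (C p q) A (conjg g M) c ->
  minimizer (C (fstc g p q) (sndc g p q)) (conjg (syminv g) A) M c.
Proof.
  intros HC g p q A M c [H1 H2]. split.
  - rewrite <- (conjK g M). now apply symmetric_inv.
  - now apply lower_bound_conj.
Qed.

Lemma minimizer_conj_inv C : symmetric C -> forall g p q A M c,
  minimizer (C (fstc g p q) (sndc g p q)) (conjg (syminv g) A) M c ->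
  minimizer (C p q) A (conjg g M) c.
Proof.
  intros HC g p q A M c [H1 H2]. split.
  - now apply HC.
  - now apply lower_bound_conj_inv.
Qed.

Lemma minimizer_le S A M c c' : minimizer S A M c -> S M c' -> c' <= c -> minimizer S A M c'.
Proof. intros [H1 H2] H3 Hle. split; [assumption|]. intros M' c'' H. specialize (H2 _ _ H). lra. Qed.

(** The polar of the ball [p |a| + q |b| <= 1] is the box with half-sides [p] and [q]. *)
Definition end_ok (A : mat) (p q : R) (M : mat) : Prop :=
  Rabs (covec A KX M mid3) <= p /\ Rabs (covec A KY M mid3) <= q.

Lemma end_ok_conj g A p q M :
  end_ok (conjg (syminv g) A) (fstc g p q) (sndc g p q) M -> end_ok A p q (conjg g M).
Proof.
  unfold end_ok, covec. rewrite !mmul_1_r.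
  assert (E : forall K, ip A (conjg g M * K)%M = ip (conjg (syminv g) A) (M * conjg (syminv g) K)%M).
  { intros K. rewrite <- (conjVK g K) at 1. rewrite <- conj_mul, ip_conj. reflexivity. }
  rewrite !E.
  assert (EX : exists s, Rabs s = 1 /\ conjg (syminv g) KX = mscale s (if fst g then KY else KX)).
  { dsym g; simpl; first [exists 1; split; [apply Rabs_R1|mring] | exists (-1); split; [rewrite Rabs_left; lra|mring]]. }
  assert (EY : exists s, Rabs s = 1 /\ conjg (syminv g) KY = mscale s (if fst g then KX else KY)).
  { dsym g; simpl; first [exists 1; split; [apply Rabs_R1|mring] | exists (-1); split; [rewrite Rabs_left; lra|mring]]. }
  destruct EX as (s & Hs & ->), EY as (s' & Hs' & ->).
  rewrite !mmul_scale_r, !ip_scale_r, !Rabs_Ropp, !Rabs_mult, Hs, Hs', !Rmult_1_l.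
  unfold fstc, sndc. destruct (fst g); tauto.
Qed.

(** * Arbitrary words and their costs *)

(** Words grow at the right end, where [ip_mul_r] can absorb the last factor into the functional. *)
Inductive reach (p q : R) : mat -> R -> Prop :=
| reach_nil : reach p q mid3 0
| reach_snoc M c th ph : reach p q M c -> 0 <= th ->
    reach p q (M * Exy th ph)%M (c + th * (p * Rabs (cos ph) + q * Rabs (sin ph))).

Lemma reach_eq p q M c M' c' : reach p q M c -> M = M' -> c = c' -> reach p q M' c'.
Proof. intros; subst; assumption. Qed.

Lemma reach_app p q M c M' c' : reach p q M c -> reach p q M' c' -> reach p q (M * M')%M (c + c').
Proof.
  intros H H'. induction H'.
  - now rewrite mmul_1_r, Rplus_0_r.
  - eapply reach_eq; [apply (reach_snoc p q _ _ th ph IHH' H0)|now rewrite mmul_assoc|ring].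
Qed.

Lemma reach_Exy p q th ph : 0 <= th -> reach p q (Exy th ph) (th * (p * Rabs (cos ph) + q * Rabs (sin ph))).
Proof.
  intros Hth. eapply reach_eq; [apply (reach_snoc p q _ _ th ph (reach_nil p q) Hth)|apply mmul_1_l|ring].
Qed.

Lemma reach_Rx p q t : reach p q (Rx t) (p * Rabs t).
Proof.
  destruct (Rle_or_lt 0 t).
  - eapply reach_eq; [apply (reach_Exy p q t 0 H)|apply Exy_0|].
    rewrite cos_0, sin_0, Rabs_R0, Rabs_R1, (Rabs_pos_eq t); lra.
  - eapply reach_eq; [apply (reach_Exy p q (- t) PI); lra|rewrite Exy_PI; f_equal; ring|].
    rewrite cos_PI, sin_PI, Rabs_R0, (Rabs_left t), Rabs_left by lra. ring.
Qed.

Lemma reach_Ry p q t : reach p q (Ry t) (q * Rabs t).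
Proof.
  destruct (Rle_or_lt 0 t).
  - eapply reach_eq; [apply (reach_Exy p q t (PI / 2) H)|apply Exy_PI2|].
    rewrite cos_PI2, sin_PI2, Rabs_R0, Rabs_R1, (Rabs_pos_eq t); lra.
  - eapply reach_eq; [apply (reach_Exy p q (- t) (- (PI / 2))); lra|rewrite Exy_mPI2; f_equal; ring|].
    rewrite cos_neg, sin_neg, cos_PI2, sin_PI2, Rabs_R0, (Rabs_left t), Rabs_left by lra. ring.
Qed.

Lemma reach_ge0 p q M c : 0 <= p -> 0 <= q -> reach p q M c -> 0 <= c.
Proof.
  intros Hp Hq H. induction H; [lra|].
  pose proof (Rabs_pos (cos ph)). pose proof (Rabs_pos (sin ph)).
  assert (0 <= th * (p * Rabs (cos ph) + q * Rabs (sin ph))); [|lra].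
  repeat apply Rmult_le_pos || apply Rplus_le_le_0_compat; assumption.
Qed.

Lemma conj_Exy g ph : exists ph', (forall th, conjg g (Exy th ph) = Exy th ph') /\
  forall p q, fstc g p q * Rabs (cos ph) + sndc g p q * Rabs (sin ph)
            = p * Rabs (cos ph') + q * Rabs (sin ph').
Proof.
  set (ph1 := if fst g then PI / 2 - ph else ph).
  set (ph2 := if fst (snd g) then PI - ph1 else ph1).
  set (ph3 := if snd (snd g) then - ph2 else ph2).
  exists ph3. subst ph1 ph2 ph3.
  assert (EP : forall x, cos (PI - x) = - cos x) by (intros; rewrite cos_minus, cos_PI, sin_PI; ring).
  assert (SP : forall x, sin (PI - x) = sin x) by (intros; rewrite sin_minus, cos_PI, sin_PI; ring).
  split.
  - intros th. dsym g; apply mat_ext; simpl;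
    rewrite ?Ropp_involutive, ?cos_neg, ?sin_neg, ?EP, ?SP, ?cos_shift, ?sin_shift; ring.
  - intros p q. dsym g; unfold fstc, sndc; simpl;
    rewrite ?cos_neg, ?sin_neg, ?EP, ?SP, ?cos_shift, ?sin_shift, ?Rabs_Ropp; ring.
Qed.

Lemma reach_sym : symmetric reach.
Proof.
  intros g p q M c H. induction H.
  - rewrite conj_1. apply reach_nil.
  - destruct (conj_Exy g ph) as (ph' & E1 & E2).
    rewrite conj_mul, E1, E2. now apply reach_snoc.
Qed.

(** * The class of competitors *)

(** Finitely many bounded families, for compactness. In [base3] the times may exceed [PI], the bound
    reached by [wrap], so that a letter can still be lengthened. [base5] contains what arises when a
    letter is appended to [X Y -X] or [X Y -X -Y]; its first time runs up to [2 * PI] because a last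
    letter of time [PI] will be moved to the front. The oblique families contain the tilted
    competitors of [X Y X]. *)
Inductive base (p q : R) : mat -> R -> Prop :=
| base3 a b c : Rabs a <= 2 * PI -> Rabs b <= 2 * PI -> Rabs c <= 2 * PI ->
    base p q (Rx a * (Ry b * Rx c))%M (p * Rabs a + q * Rabs b + p * Rabs c)
| base5 a b c d e : 0 <= a <= 2 * PI -> 0 <= b <= PI -> 0 <= c <= PI -> 0 <= d <= PI -> 0 <= e <= PI ->
    base p q (Rx a * (Ry b * (Rx (- c) * (Ry (- d) * Rx e))))%M (p * a + q * b + p * c + q * d + p * e)
| baseXX a th ph b : 0 <= a <= 2 * PI -> 0 <= th <= 2 * PI -> 0 <= ph <= PI / 2 -> 0 <= b <= 2 * PI ->
    base p q (Rx a * (Exy th ph * Rx b))%M (p * a + th * (p * cos ph + q * sin ph) + p * b)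
| baseXY a th ph b : 0 <= a <= 2 * PI -> 0 <= th <= 2 * PI -> 0 <= ph <= PI / 2 -> 0 <= b <= 2 * PI ->
    base p q (Rx a * (Exy th ph * Ry b))%M (p * a + th * (p * cos ph + q * sin ph) + q * b).

Definition cls := symclosure base.

Lemma cls_sym : symmetric cls.
Proof. apply symclosure_sym. Qed.

Lemma cls_eq p q M c M' c' : cls p q M c -> M = M' -> c = c' -> cls p q M' c'.
Proof. intros; subst; assumption. Qed.

Definition swp : sym := (true, (false, false)).
Definition flipy : sym := (false, (false, true)).

Lemma conj_swp_Rx t : conjg swp (Rx t) = Ry t.
Proof. mring. Qed.
Lemma conj_swp_Ry t : conjg swp (Ry t) = Rx t.
Proof. mring. Qed.
Lemma conj_flipy_Rx t : conjg flipy (Rx t) = Rx t.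
Proof. mring. Qed.
Lemma conj_flipy_Ry t : conjg flipy (Ry t) = Ry (- t).
Proof. apply mat_ext; simpl; trig; ring. Qed.
Lemma conj_swp_Exy th ph : conjg swp (Exy th (PI / 2 - ph)) = Exy th ph.
Proof. apply mat_ext; simpl; trig; rewrite ?cos_shift, ?sin_shift; ring. Qed.

Lemma wrap_aux n : forall t, Rabs t <= PI + 2 * PI * INR n ->
  exists t', Rabs t' <= PI /\ Rabs t' <= Rabs t /\ Rx t' = Rx t /\ Ry t' = Ry t.
Proof.
  pose proof PI_RGT_0.
  induction n as [|n IH]; intros t Ht.
  - exists t. simpl in Ht. split; [|split; [|split]]; try reflexivity; lra.
  - rewrite S_INR in Ht. pose proof (Rmult_le_pos PI (INR n) ltac:(lra) (pos_INR n)).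
    destruct (Rle_or_lt (Rabs t) PI) as [Hs|Hs]; [exists t; split; [|split; [|split]]; try reflexivity; lra|].
    destruct (Rle_or_lt 0 t) as [Ht0|Ht0].
    + rewrite Rabs_pos_eq in * by assumption.
      destruct (IH (t - 2 * PI)) as (t' & H1 & H2 & H3 & H4).
      { unfold Rabs; destruct Rcase_abs; lra. }
      exists t'. rewrite H3, H4, Rx_2PI, Ry_2PI. split; [|split; [|split]]; trivial; try lra.
    + rewrite Rabs_left in * by assumption.
      destruct (IH (t + 2 * PI)) as (t' & H1 & H2 & H3 & H4).
      { unfold Rabs; destruct Rcase_abs; lra. }
      exists t'. rewrite H3, H4, <- (Rx_2PI (t + _)), <- (Ry_2PI (t + _)).
      replace (t + 2 * PI - 2 * PI) with t by ring.
      split; [|split; [|split]]; trivial; try lra.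
Qed.

Lemma wrap t : exists t', Rabs t' <= PI /\ Rabs t' <= Rabs t /\ Rx t' = Rx t /\ Ry t' = Ry t.
Proof.
  destruct (INR_unbounded (Rabs t)) as [n Hn].
  apply (wrap_aux n). pose proof PI2_1. pose proof (pos_INR n). nra.
Qed.

Section Members.
Variables p q : R.

Lemma cls_XYX a b c : Rabs a <= 2 * PI -> Rabs b <= 2 * PI -> Rabs c <= 2 * PI ->
  cls p q (Rx a * (Ry b * Rx c))%M (p * Rabs a + q * Rabs b + p * Rabs c).
Proof. intros. apply symclosure_1. now constructor. Qed.

Lemma cls_YXY a b c : Rabs a <= 2 * PI -> Rabs b <= 2 * PI -> Rabs c <= 2 * PI ->
  cls p q (Ry a * (Rx b * Ry c))%M (q * Rabs a + p * Rabs b + q * Rabs c).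
Proof.
  intros. eapply cls_eq; [apply (cls_sym swp); apply symclosure_1; apply (base3 q p a b c); assumption| |reflexivity].
  now rewrite !conj_mul, !conj_swp_Rx, conj_swp_Ry.
Qed.

Lemma cls_XYXYX a b c d e : 0 <= a <= 2 * PI -> 0 <= b <= PI -> 0 <= c <= PI -> 0 <= d <= PI -> 0 <= e <= PI ->
  cls p q (Rx a * (Ry b * (Rx (- c) * (Ry (- d) * Rx e))))%M (p * a + q * b + p * c + q * d + p * e).
Proof. intros. apply symclosure_1. now constructor. Qed.

Lemma cls_XYXYX' a b c d e : 0 <= a <= 2 * PI -> 0 <= b <= PI -> 0 <= c <= PI -> 0 <= d <= PI -> 0 <= e <= PI ->
  cls p q (Rx a * (Ry (- b) * (Rx (- c) * (Ry d * Rx e))))%M (p * a + q * b + p * c + q * d + p * e).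
Proof.
  intros. eapply cls_eq; [apply (cls_sym flipy); apply (symclosure_1 base); apply (base5 p q a b c d e); assumption| |reflexivity].
  now rewrite !conj_mul, !conj_flipy_Rx, !conj_flipy_Ry, Ropp_involutive.
Qed.

Lemma cls_XEX a th ph b : 0 <= a <= 2 * PI -> 0 <= th <= 2 * PI -> 0 <= ph <= PI / 2 -> 0 <= b <= 2 * PI ->
  cls p q (Rx a * (Exy th ph * Rx b))%M (p * a + th * (p * cos ph + q * sin ph) + p * b).
Proof. intros. apply symclosure_1. now constructor. Qed.
Lemma cls_XEY a th ph b : 0 <= a <= 2 * PI -> 0 <= th <= 2 * PI -> 0 <= ph <= PI / 2 -> 0 <= b <= 2 * PI ->
  cls p q (Rx a * (Exy th ph * Ry b))%M (p * a + th * (p * cos ph + q * sin ph) + q * b).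
Proof. intros. apply symclosure_1. now constructor. Qed.
Lemma cls_YEX a th ph b : 0 <= a <= 2 * PI -> 0 <= th <= 2 * PI -> 0 <= ph <= PI / 2 -> 0 <= b <= 2 * PI ->
  cls p q (Ry a * (Exy th ph * Rx b))%M (q * a + th * (p * cos ph + q * sin ph) + p * b).
Proof.
  intros. eapply cls_eq; [apply (cls_sym swp); apply (symclosure_1 base);
    apply (baseXY q p a th (PI / 2 - ph) b); lra| |].
  - now rewrite !conj_mul, !conj_swp_Rx, !conj_swp_Ry, conj_swp_Exy.
  - rewrite cos_shift, sin_shift. ring.
Qed.
Lemma cls_YEY a th ph b : 0 <= a <= 2 * PI -> 0 <= th <= 2 * PI -> 0 <= ph <= PI / 2 -> 0 <= b <= 2 * PI ->
  cls p q (Ry a * (Exy th ph * Ry b))%M (q * a + th * (p * cos ph + q * sin ph) + q * b).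
Proof.
  intros. eapply cls_eq; [apply (cls_sym swp); apply (symclosure_1 base);
    apply (baseXX q p a th (PI / 2 - ph) b); lra| |].
  - now rewrite !conj_mul, !conj_swp_Rx, conj_swp_Exy.
  - rewrite cos_shift, sin_shift. ring.
Qed.

Lemma base_reach M c : base p q M c -> reach p q M c.
Proof.
  assert (Rx_ge : forall t, 0 <= t -> reach p q (Rx t) (p * t)).
  { intros t Ht. rewrite <- (Rabs_pos_eq t) at 2 by assumption. apply reach_Rx. }
  assert (Ry_ge : forall t, 0 <= t -> reach p q (Ry t) (q * t)).
  { intros t Ht. rewrite <- (Rabs_pos_eq t) at 2 by assumption. apply reach_Ry. }
  assert (Rx_le : forall t, 0 <= t -> reach p q (Rx (- t)) (p * t)).
  { intros t Ht. eapply reach_eq; [apply reach_Rx|reflexivity|now rewrite Rabs_Ropp, Rabs_pos_eq]. }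
  assert (Ry_le : forall t, 0 <= t -> reach p q (Ry (- t)) (q * t)).
  { intros t Ht. eapply reach_eq; [apply reach_Ry|reflexivity|now rewrite Rabs_Ropp, Rabs_pos_eq]. }
  assert (HE : forall th ph, 0 <= th -> 0 <= ph <= PI / 2 ->
    reach p q (Exy th ph) (th * (p * cos ph + q * sin ph))).
  { intros th ph H1 H2. pose proof PI_RGT_0. eapply reach_eq; [apply (reach_Exy p q th ph H1)|reflexivity|].
    rewrite (Rabs_pos_eq (cos ph)), (Rabs_pos_eq (sin ph)); [reflexivity| apply sin_ge_0; lra|apply cos_ge_0; lra]. }
  intros H. destruct H; rewrite ?Rplus_assoc;
  repeat first [apply reach_app | apply reach_Rx | apply reach_Ry | apply Rx_le | apply Ry_le
   | apply Rx_ge | apply Ry_ge | apply HE]; lra.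
Qed.
End Members.

Lemma cls_reach p q M c : cls p q M c -> reach p q M c.
Proof.
  intros (g & M0 & H & ->). apply reach_sym. now apply base_reach.
Qed.

(** * Normalization of products and half-angle inequalities *)

Lemma Rx_addA s t M : (Rx s * (Rx t * M))%M = (Rx (s + t) * M)%M.
Proof. now rewrite <- mmul_assoc, Rx_add. Qed.
Lemma Ry_addA s t M : (Ry s * (Ry t * M))%M = (Ry (s + t) * M)%M.
Proof. now rewrite <- mmul_assoc, Ry_add. Qed.
Lemma Exy_addA s t ph M : (Exy s ph * (Exy t ph * M))%M = (Exy (s + t) ph * M)%M.
Proof. now rewrite <- mmul_assoc, Exy_add. Qed.

Ltac wnorm := rewrite ?mmul_assoc;
  repeat first [rewrite Rx_addA | rewrite Ry_addA | rewrite Exy_addA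
               | rewrite Rx_add | rewrite Ry_add | rewrite Exy_add
               | rewrite Rx_0 | rewrite Ry_0 | rewrite mmul_1_l | rewrite mmul_1_r].
Ltac weq := wnorm;
  repeat first [reflexivity | apply (f_equal2 mmul) | apply (f_equal Rx); ring | apply (f_equal Ry); ring
               | apply (f_equal2 Exy); ring].

(** This is [x < tan x] cleared of its denominator, so it also covers angles beyond [PI / 2]. It
    rejects [X Y X] with equal signs and fixes the axis of an oblique letter. *)
Lemma x_cos_lt_sin x : 0 < x < PI -> x * cos x < sin x.
Proof.
  intros Hx.
  destruct (MVT_cor2 (fun t => sin t - t * cos t) (fun t => t * sin t) 0 x) as (y & Hy & Hy'); [lra| |].
  - intros t _. apply is_derive_Reals. auto_derive; trivial; ring.
  - rewrite sin_0, Rmult_0_l in Hy.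
    assert (0 < sin y) by (apply sin_gt_0; lra).
    assert (0 < y * sin y * (x - 0)) by (apply Rmult_lt_0_compat; [apply Rmult_lt_0_compat|]; lra).
    lra.
Qed.

Lemma sin_half t : sin t = 2 * sin (t / 2) * cos (t / 2).
Proof. replace t with (2 * (t / 2)) at 1 by field. apply sin_2a. Qed.
Lemma cos_half t : cos t = 2 * cos (t / 2) * cos (t / 2) - 1.
Proof. replace t with (2 * (t / 2)) at 1 by field. apply cos_2a_cos. Qed.
Lemma cos_half' t : cos t = 1 - 2 * sin (t / 2) * sin (t / 2).
Proof. replace t with (2 * (t / 2)) at 1 by field. apply cos_2a_sin. Qed.

Lemma half_angle_eq z q t : 0 < t < PI -> z * sin t = q * (1 + cos t) ->
  z * sin (t / 2) = q * cos (t / 2).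
Proof.
  intros Ht. rewrite (sin_half t), (cos_half t).
  assert (0 < cos (t / 2)) by (apply cos_gt_0; lra). intros H'.
  apply Rmult_eq_reg_l with (2 * cos (t / 2)); lra.
Qed.

(** In half angles the two conditions read [tan (T / 2) = q / z] and [tan (t / 2) <= q / z]. *)
Lemma half_angle_le z q t T : 0 < z -> 0 < q -> 0 < t < PI -> 0 < T < PI ->
  z * sin (T / 2) = q * cos (T / 2) -> z * sin t <= q * (1 + cos t) -> t <= T.
Proof.
  intros Hz Hq Ht HT HT' H.
  rewrite (sin_half t), (cos_half t) in H.
  assert (Hc : 0 < cos (t / 2)) by (apply cos_gt_0; lra).
  assert (HC : 0 < cos (T / 2)) by (apply cos_gt_0; lra).
  assert (H1 : z * sin (t / 2) <= q * cos (t / 2)).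
  { apply Rmult_le_reg_l with (2 * cos (t / 2)); lra. }
  destruct (Rle_or_lt t T) as [|Hlt]; [assumption|exfalso].
  assert (0 < sin (t / 2 - T / 2)) by (apply sin_gt_0; lra).
  rewrite sin_minus in H0.
  assert (z * (sin (t / 2) * cos (T / 2) - cos (t / 2) * sin (T / 2)) <= 0) by nra.
  nra.
Qed.

(** * Pattern subwords *)

(* [baseq3] and [baseq4] are subwords of pattern (I), where [b] is the time of the second
   axis; [baseq2] is a subword of pattern (I) with both times equal to [PI]; the last two are
   subwords of patterns (II) and (III). *)
Inductive baseq (p q : R) : mat -> R -> Prop :=
| baseq2 a b : 0 <= a <= PI -> 0 <= b <= PI -> baseq p q (Rx a * Ry b)%M (p * a + q * b)
| baseq3 a b c t : 0 <= a <= t -> 0 <= c <= t -> t <= PI -> 0 <= b <= PI ->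
    p * sin (t / 2) * cos (b / 2) = q * cos (t / 2) * sin (b / 2) ->
    baseq p q (Rx a * (Ry b * Rx (- c)))%M (p * a + q * b + p * c)
| baseq4 a b c d : 0 <= a <= c -> 0 <= d <= b -> c <= PI -> b <= PI ->
    p * sin (c / 2) * cos (b / 2) = q * cos (c / 2) * sin (b / 2) ->
    baseq p q (Rx a * (Ry b * (Rx (- c) * Ry (- d))))%M (p * a + q * b + p * c + q * d)
| baseqXX a th ph b : 0 <= a <= PI -> 0 <= th <= 2 * PI -> 0 <= ph <= PI / 2 -> 0 <= b <= PI ->
    p * sin ph = q * cos ph ->
    baseq p q (Rx a * (Exy th ph * Rx b))%M (p * a + th * (p * cos ph + q * sin ph) + p * b)
| baseqXY a th ph b : 0 <= a <= PI -> 0 <= th <= 2 * PI -> 0 <= ph <= PI / 2 -> 0 <= b <= PI ->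
    p * sin ph = q * cos ph ->
    baseq p q (Rx a * (Exy th ph * Ry b))%M (p * a + th * (p * cos ph + q * sin ph) + q * b).

Definition clsq := symclosure baseq.

(** The two parts are used at different stages. The first, known for all [A], yields the
    Hamilton-Jacobi inequality; only that inequality supplies the premise of the second. *)
Definition good (A : mat) (p q : R) (M : mat) (c : R) : Prop :=
  end_ok A p q M /\ (lower_bound (reach p q) A M c -> clsq p q M c).

(** One good minimizer for each [A] is enough, since the inequality concerns only the minimal value.
    Degenerate words may therefore be rewritten at no greater cost. *)
Definition good_ex (A : mat) (p q : R) : Prop :=
  exists M c, minimizer (cls p q) A M c /\ good A p q M c.

Lemma good_ex_conj g A p q :
  good_ex (conjg (syminv g) A) (fstc g p q) (sndc g p q) -> good_ex A p q.
Proof.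
  intros (M & c & H1 & H2 & H3). exists (conjg g M), c. split; [|split].
  - now apply (minimizer_conj_inv _ cls_sym).
  - now apply end_ok_conj.
  - intros H. apply symclosure_sym, H3. now apply (lower_bound_conj _ reach_sym).
Qed.

(** * Two-letter minimizers *)

Section Cases.
Variables (A : mat) (p q : R).
Hypotheses (Hp : 0 < p) (Hq : 0 < q).

Lemma low_XYX M c0 a b c : lower_bound (cls p q) A M c0 -> M = (Rx a * (Ry b * Rx c))%M ->
  c0 <= p * Rabs a + q * Rabs b + p * Rabs c.
Proof.
  intros H ->. pose proof PI_RGT_0.
  destruct (wrap a) as (a' & Ha1 & Ha2 & Ha3 & _).
  destruct (wrap b) as (b' & Hb1 & Hb2 & _ & Hb3).
  destruct (wrap c) as (c' & Hc1 & Hc2 & Hc3 & _).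
  rewrite <- Ha3, <- Hb3, <- Hc3 in H.
  specialize (H _ _ (cls_XYX p q a' b' c' ltac:(lra) ltac:(lra) ltac:(lra))).
  assert (p * Rabs a' <= p * Rabs a) by (apply Rmult_le_compat_l; lra).
  assert (q * Rabs b' <= q * Rabs b) by (apply Rmult_le_compat_l; lra).
  assert (p * Rabs c' <= p * Rabs c) by (apply Rmult_le_compat_l; lra).
  lra.
Qed.

Lemma low_YXY M c0 a b c : lower_bound (cls p q) A M c0 -> M = (Ry a * (Rx b * Ry c))%M ->
  c0 <= q * Rabs a + p * Rabs b + q * Rabs c.
Proof.
  intros H ->. pose proof PI_RGT_0.
  destruct (wrap a) as (a' & Ha1 & Ha2 & _ & Ha3).
  destruct (wrap b) as (b' & Hb1 & Hb2 & Hb3 & _).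
  destruct (wrap c) as (c' & Hc1 & Hc2 & _ & Hc3).
  rewrite <- Ha3, <- Hb3, <- Hc3 in H.
  specialize (H _ _ (cls_YXY p q a' b' c' ltac:(lra) ltac:(lra) ltac:(lra))).
  assert (q * Rabs a' <= q * Rabs a) by (apply Rmult_le_compat_l; lra).
  assert (p * Rabs b' <= p * Rabs b) by (apply Rmult_le_compat_l; lra).
  assert (q * Rabs c' <= q * Rabs c) by (apply Rmult_le_compat_l; lra).
  lra.
Qed.

(** Each axis can be appended in both directions within the three-letter family, which gives all
    four bounds of [end_ok]. *)
Lemma two_letters_good a b : Rabs a <= PI -> Rabs b <= PI ->
  minimizer (cls p q) A (Rx a * Ry b)%M (p * Rabs a + q * Rabs b) ->
  good A p q (Rx a * Ry b)%M (p * Rabs a + q * Rabs b).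
Proof.
  intros Ha Hb [HM Hmin]. pose proof PI_RGT_0 as HPI. split.
  - assert (HX : forall e, Rabs e < PI -> exists c', cls p q (Rx a * Ry b * (Rx e * mid3))%M c' /\
      c' <= p * Rabs a + q * Rabs b + p * Rabs e).
    { intros e He. eexists; split.
      - eapply cls_eq; [apply (cls_XYX p q a b e); lra|weq|reflexivity].
      - lra. }
    assert (HY : forall e, Rabs e < PI -> exists c', cls p q (Rx a * Ry b * (Ry e * mid3))%M c' /\
      c' <= p * Rabs a + q * Rabs b + q * Rabs e).
    { intros e He. pose proof (Rabs_triang b e). eexists; split.
      - eapply cls_eq; [apply (cls_XYX p q a (b + e) 0); rewrite ?Rabs_R0; lra|weq|reflexivity].
      - rewrite Rabs_R0.
        assert (q * Rabs (b + e) <= q * (Rabs b + Rabs e)) by (apply Rmult_le_compat_l; lra). lra. }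
    split; apply Rabs_le; split.
    + apply (insert_Rx_opp _ _ _ _ Hmin _ _ p PI); [weq|lra|].
      intros e He. assert (Ee : Rabs (- e) = e) by (rewrite Rabs_Ropp; apply Rabs_pos_eq; lra).
      destruct (HX (- e)) as (c' & H1 & H2); [lra|]. exists c'; split; [assumption|]. rewrite Ee in H2; lra.
    + apply (insert_Rx _ _ _ _ Hmin _ _ p PI); [weq|lra|].
      intros e He. assert (Ee : Rabs e = e) by (apply Rabs_pos_eq; lra).
      destruct (HX e) as (c' & H1 & H2); [lra|]. exists c'; split; [assumption|]. rewrite Ee in H2; lra.
    + apply (insert_Ry_opp _ _ _ _ Hmin _ _ q PI); [weq|lra|].
      intros e He. assert (Ee : Rabs (- e) = e) by (rewrite Rabs_Ropp; apply Rabs_pos_eq; lra).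
      destruct (HY (- e)) as (c' & H1 & H2); [lra|]. exists c'; split; [assumption|]. rewrite Ee in H2; lra.
    + apply (insert_Ry _ _ _ _ Hmin _ _ q PI); [weq|lra|].
      intros e He. assert (Ee : Rabs e = e) by (apply Rabs_pos_eq; lra).
      destruct (HY e) as (c' & H1 & H2); [lra|]. exists c'; split; [assumption|]. rewrite Ee in H2; lra.
  - intros _.
    set (sg := fun t : R => if Rle_dec 0 t then false else true).
    exists (false, (sg a, sg b)), (Rx (Rabs a) * Ry (Rabs b))%M. split.
    + unfold fstc, sndc; simpl. apply baseq2; pose proof (Rabs_pos a); pose proof (Rabs_pos b); lra.
    + rewrite conj_mul. f_equal.
      * unfold sg, Rabs. destruct (Rle_dec 0 a), (Rcase_abs a), (Rle_dec 0 b); try lra;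
        apply mat_ext; simpl; trig; ring.
      * unfold sg, Rabs. destruct (Rle_dec 0 b), (Rcase_abs b), (Rle_dec 0 a); try lra;
        apply mat_ext; simpl; trig; ring.
Qed.

Lemma two_letters a b c0 : minimizer (cls p q) A (Rx a * Ry b)%M c0 ->
  p * Rabs a + q * Rabs b <= c0 -> good_ex A p q.
Proof.
  intros H Hc. pose proof PI_RGT_0.
  destruct (wrap a) as (a' & Ha1 & Ha2 & Ha3 & _).
  destruct (wrap b) as (b' & Hb1 & Hb2 & _ & Hb3).
  rewrite <- Ha3, <- Hb3 in H.
  assert (H' : minimizer (cls p q) A (Rx a' * Ry b')%M (p * Rabs a' + q * Rabs b')).
  { apply (minimizer_le _ _ _ c0); [assumption| |].
    - eapply cls_eq; [apply (cls_XYX p q a' b' 0); rewrite ?Rabs_R0; lra|weq|rewrite Rabs_R0; ring].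
    - assert (p * Rabs a' <= p * Rabs a) by (apply Rmult_le_compat_l; lra).
      assert (q * Rabs b' <= q * Rabs b) by (apply Rmult_le_compat_l; lra). lra. }
  eexists _, _; split; [exact H'|]. now apply two_letters_good.
Qed.
End Cases.

(** * Three-letter minimizers *)

Definition congr (s t : R) : Prop := s = t \/ s = t - 2 * PI \/ s = t + 2 * PI.

Lemma Rx_congr s t : congr s t -> Rx s = Rx t.
Proof.
  intros [->|[->| ->]]; [reflexivity|apply Rx_2PI|].
  rewrite <- (Rx_2PI (t + 2 * PI)). f_equal; ring.
Qed.
Lemma Ry_congr s t : congr s t -> Ry s = Ry t.
Proof.
  intros [->|[->| ->]]; [reflexivity|apply Ry_2PI|].
  rewrite <- (Ry_2PI (t + 2 * PI)). f_equal; ring.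
Qed.

(* A time equal to [PI] is excluded since the cost has a concave kink there: the rotation
   angle can be increased while the cost decreases. *)
Lemma interior_letter S A M c (r : R -> mat) K u v k t :
  lower_bound S A M c -> mderive r 0 (r 0 * K)%M -> r 0 = mid3 -> (u * v)%M = M ->
  0 < k -> 0 < Rabs t <= PI ->
  (forall e s, Rabs s <= 2 * PI -> congr s (t + e) ->
     exists c', S (u * (r e * v))%M c' /\ c' <= c - k * Rabs t + k * Rabs s) ->
  Rabs t < PI /\ (0 < t -> covec A K u v = k) /\ (t < 0 -> covec A K u v = - k).
Proof.
  intros Hmin Hr Hr0 Huv Hk Ht HS. pose proof PI_RGT_0 as HPI.
  assert (HSe : forall e s d, congr s (t + e) -> Rabs s = Rabs t + d -> Rabs t + d <= 2 * PI ->
     exists c', S (u * (r e * v))%M c' /\ c' <= c + k * d).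
  { intros e s d H1 H2 H3. destruct (HS e s) as (c' & H4 & H5); [lra|assumption|].
    exists c'; split; [assumption|]. rewrite H2 in H5. lra. }
  destruct (Rle_or_lt 0 t) as [H0|H0].
  - assert (Ea : Rabs t = t) by (apply Rabs_pos_eq; lra). rewrite Ea in *.
    assert (H1 : covec A K u v <= k).
    { apply (insert_pos S A M c Hmin r K u v k PI); trivial.
      intros e He. apply (HSe e (t + e) e); [now left|rewrite Rabs_pos_eq; lra|lra]. }
    assert (H2 : k <= covec A K u v).
    { rewrite <- (Ropp_involutive k) at 1.
      apply (insert_neg S A M c Hmin r K u v (- k) t); trivial; [lra|].
      intros e He. replace (- k * e) with (k * - e) by ring.
      apply (HSe (- e) (t + - e) (- e)); [now left|rewrite Rabs_pos_eq; lra|lra]. }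
    split; [|split; intros; lra].
    destruct (Rlt_or_le t PI) as [|HtPI]; [assumption|exfalso].
    assert (t = PI) by lra. subst t.
    enough (covec A K u v <= - k) by lra.
    apply (insert_pos S A M c Hmin r K u v (- k) PI); trivial.
    intros e He. replace (- k * e) with (k * - e) by ring.
    apply (HSe e (PI + e - 2 * PI) (- e)); [right; now left| rewrite Rabs_left; lra|lra].
  - assert (Ea : Rabs t = - t) by (apply Rabs_left; lra). rewrite Ea in *.
    assert (H1 : - k <= covec A K u v).
    { apply (insert_neg S A M c Hmin r K u v k PI); trivial.
      intros e He. apply (HSe (- e) (t + - e) e); [now left|rewrite Rabs_left; lra|lra]. }
    assert (H2 : covec A K u v <= - k).
    { apply (insert_pos S A M c Hmin r K u v (- k) (- t)); trivial; [lra|].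
      intros e He. replace (- k * e) with (k * - e) by ring.
      apply (HSe e (t + e) (- e)); [now left|rewrite Rabs_left; lra|lra]. }
    split; [|split; intros; lra].
    destruct (Rlt_or_le (- t) PI) as [|HtPI]; [assumption|exfalso].
    assert (t = - PI) by lra. subst t.
    enough (k <= covec A K u v) by lra.
    rewrite <- (Ropp_involutive k) at 1.
    apply (insert_neg S A M c Hmin r K u v (- k) PI); trivial.
    intros e He. replace (- k * e) with (k * - e) by ring.
    apply (HSe (- e) (- PI + - e + 2 * PI) (- e)); [right; now right| rewrite Rabs_pos_eq; lra|lra].
Qed.

Lemma and3_12 (P Q S : Prop) : P /\ Q /\ S -> P /\ Q.
Proof. tauto. Qed.

Lemma ex_cost (S : mat -> R -> Prop) M c1 c2 : S M c1 -> c1 <= c2 -> exists c', S M c' /\ c' <= c2.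
Proof. eauto. Qed.

Definition interior_Rx S A M c u v k t H := interior_letter S A M c Rx KX u v k t H (mderive_Rx 0) Rx_0.
Definition interior_Ry S A M c u v k t H := interior_letter S A M c Ry KY u v k t H (mderive_Ry 0) Ry_0.

Section Three.
Variables (A : mat) (p q : R).
Hypotheses (Hp : 0 < p) (Hq : 0 < q).

Lemma three_interior a b c (M := (Rx a * (Ry b * Rx c))%M) :
  0 < Rabs a <= PI -> 0 < Rabs b <= PI -> 0 < Rabs c <= PI ->
  lower_bound (cls p q) A M (p * Rabs a + q * Rabs b + p * Rabs c) ->
  (Rabs a < PI /\ (0 < a -> covec A KX (Rx a) (Ry b * Rx c)%M = p)) /\
  (Rabs b < PI /\ (0 < b -> covec A KY (Rx a) (Ry b * Rx c)%M = q)) /\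
  (Rabs c < PI /\ (0 < c -> covec A KX (Rx a * Ry b)%M (Rx c) = p) /\
                  (c < 0 -> covec A KX (Rx a * Ry b)%M (Rx c) = - p)).
Proof.
  intros Ha Hb Hc Hmin. pose proof PI_RGT_0.
  split; [|split].
  - eapply and3_12.
    apply (interior_Rx _ _ _ _ _ _ _ _ Hmin); [reflexivity|lra|lra|].
    intros e s Hs He. apply ex_cost with (p * Rabs s + q * Rabs b + p * Rabs c); [|lra].
    eapply cls_eq; [apply (cls_XYX p q s b c); lra| |reflexivity].
    rewrite (Rx_congr _ _ He). weq.
  - eapply and3_12.
    apply (interior_Ry _ _ _ _ _ _ _ _ Hmin); [reflexivity|lra|lra|].
    intros e s Hs He. apply ex_cost with (p * Rabs a + q * Rabs s + p * Rabs c); [|lra].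
    eapply cls_eq; [apply (cls_XYX p q a s c); lra| |reflexivity].
    rewrite (Ry_congr _ _ He). weq.
  - apply (interior_Rx _ _ _ _ _ _ _ _ Hmin); [weq|lra|lra|].
    intros e s Hs He. apply ex_cost with (p * Rabs a + q * Rabs b + p * Rabs s); [|lra].
    eapply cls_eq; [apply (cls_XYX p q a b s); lra| |reflexivity].
    rewrite (Rx_congr _ _ He). weq.
Qed.

(** Tilting the axis of the middle letter towards [X] does better. With covector [(p, q, z)] at the
    first switch, the condition in the last time gives [z = - p tan (b / 2)], and the condition in
    the tilt becomes [2 tan (b / 2) <= b], which is false. *)
Lemma three_same_sign a b c : 0 < a <= PI -> 0 < b <= PI -> 0 < c <= PI ->
  ~ lower_bound (cls p q) A (Rx a * (Ry b * Rx c))%M (p * a + q * b + p * c).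
Proof.
  intros Ha Hb Hc Hmin. pose proof PI_RGT_0 as HPI.
  destruct (three_interior a b c) as ((_ & H1) & (Hb' & H2) & (_ & H3 & _));
    rewrite ?(Rabs_pos_eq a), ?(Rabs_pos_eq b), ?(Rabs_pos_eq c) in * by lra; trivial.
  specialize (H1 ltac:(lra)). specialize (H2 ltac:(lra)). specialize (H3 ltac:(lra)).
  destruct (mderive_Exy_axis b (Rx a) (Rx c) (PI / 2)) as (F' & HF & HFip).
  assert (HD := lower_bound_derive_left (cls p q) A _ _ _ F' (PI / 2)
    (fun x => p * a + b * (p * cos x + q * sin x) + p * c) (- (b * p)) (PI / 2) Hmin HF).
  rewrite HFip, Exy_PI2, covec_Ry_Z, H1 in HD.
  rewrite covec_Ry_X, H1 in H3.
  set (z := covec A KZ (Rx a) (Ry b * Rx c)%M) in *.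
  assert (HD' : - (b * p) + (cos b * z + sin b * p - z) <= 0).
  { apply HD.
    - auto_derive; trivial. rewrite sin_PI2, cos_PI2. ring.
    - reflexivity.
    - rewrite sin_PI2, cos_PI2. ring.
    - lra.
    - intros e He. eexists; split; [apply cls_XEX; lra|lra]. }
  clear HD. clearbody z.
  assert (Hs : 0 < sin b) by (apply sin_gt_0; lra).
  assert (Hx := x_cos_lt_sin (b / 2) ltac:(lra)).
  assert (Hsh : 0 < sin (b / 2)) by (apply sin_gt_0; lra).
  assert (Hch : 0 < cos (b / 2)) by (apply cos_gt_0; lra).
  rewrite (cos_half' b), (sin_half b) in *.
  set (s := sin (b / 2)) in *. set (x := cos (b / 2)) in *.
  assert (E : z * x = - p * s).
  { apply Rmult_eq_reg_l with (2 * s); [|lra]. lra. }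
  assert (Hsq : s * s + x * x = 1).
  { unfold s, x. pose proof (sin2_cos2 (b / 2)). unfold Rsqr in *. lra. }
  assert (HD2 : 2 * s * (x * p - s * z) <= b * p) by lra.
  assert (HD3 : 2 * s * (x * x * p - s * (z * x)) <= b * p * x).
  { replace (2 * s * (x * x * p - s * (z * x))) with (2 * s * (x * p - s * z) * x) by ring.
    apply Rmult_le_compat_r; lra. }
  rewrite E in HD3. replace (x * x * p - s * (- p * s)) with (p * (s * s + x * x)) in HD3 by ring.
  rewrite Hsq in HD3. assert (p * (2 * s) <= p * (b * x)) by lra.
  apply Rmult_le_reg_l in H; lra.
Qed.
End Three.

(** The letter rotates [(p, z)] by [t] to a vector with first coordinate [- p]. The length is
    preserved, and in fact the second coordinate returns to [z = p cot (t / 2)]. *)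
Lemma arc_full p t z : 0 < p -> 0 < t < PI -> cos t * p - sin t * z = - p ->
  0 < z /\ z * sin t = p * (1 + cos t) /\ cos t * z + sin t * p = z.
Proof.
  intros Hp Ht H.
  assert (Hs : 0 < sin t) by (apply sin_gt_0; lra).
  assert (E : z * sin t = p * (1 + cos t)) by lra.
  assert (Hc : 0 < 1 + cos t).
  { assert (cos PI < cos t) by (apply cos_decreasing_1; lra). rewrite cos_PI in H0. lra. }
  split; [|split]; [|exact E|].
  - apply Rmult_lt_reg_r with (sin t); [assumption|]. rewrite E. nra.
  - apply Rmult_eq_reg_r with (sin t); [|lra].
    pose proof (sin2_cos2 t) as H2. unfold Rsqr in H2.
    replace ((cos t * z + sin t * p) * sin t) with (cos t * (z * sin t) + p * (sin t * sin t)) by ring.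
    rewrite E. replace (sin t * sin t) with (1 - cos t * cos t) by lra. ring.
Qed.

Section Three.
Variables (A : mat) (p q : R).
Hypotheses (Hp : 0 < p) (Hq : 0 < q).

(* Obtained by inserting a factor [Ry (- e)] in front of the word. *)
Lemma start_bound a v c z : 0 < a -> lower_bound (reach p q) A (Rx a * v)%M c ->
  reach p q (Rx a * v)%M c -> covec A KY (Rx a) v = q -> covec A KZ (Rx a) v = z ->
  z * sin a <= q * (1 + cos a).
Proof.
  intros Ha Hmin HM HY HZ.
  rewrite <- (mmul_1_l (Rx a)) in HY, HZ. rewrite covec_Rx_Y in HY. rewrite covec_Rx_Z in HZ.
  assert (Hst : - q <= covec A KY mid3 (Rx a * v)%M).
  { apply (insert_Ry_opp _ _ _ _ Hmin _ _ q 1); [apply mmul_1_l|lra|].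
    intros e He. eexists; split.
    - rewrite mmul_1_l. apply reach_app; [apply reach_Ry|exact HM].
    - rewrite Rabs_Ropp, Rabs_pos_eq; lra. }
  set (y := covec A KY mid3 (Rx a * v)%M) in *. set (w := covec A KZ mid3 (Rx a * v)%M) in *.
  pose proof (sin2_cos2 a) as H2. unfold Rsqr in H2.
  assert (y = q * cos a - z * sin a).
  { rewrite <- HY, <- HZ.
    replace ((cos a * y + sin a * w) * cos a - (cos a * w + - sin a * y) * sin a)
      with (y * (sin a * sin a + cos a * cos a)) by ring. rewrite H2; ring. }
  lra.
Qed.

(** At the end the [X] coordinate is exactly [- p] and the [Y] coordinate is
    [q cos c - z sin c <= q]. Only the lower bound needs a competitor, the four-letter word with
    [-Y] appended; it also yields [c <= t]. The bound [a <= t] comes from the start of the word,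
    hence from minimality among all words. *)
Lemma three_opp a b c : 0 < a <= PI -> 0 < b <= PI -> 0 < c <= PI ->
  minimizer (cls p q) A (Rx a * (Ry b * Rx (- c)))%M (p * a + q * b + p * c) ->
  good A p q (Rx a * (Ry b * Rx (- c)))%M (p * a + q * b + p * c).
Proof.
  intros Ha Hb Hc [HM Hmin]. pose proof PI_RGT_0 as HPI.
  assert (Ea : Rabs a = a) by (apply Rabs_pos_eq; lra).
  assert (Eb : Rabs b = b) by (apply Rabs_pos_eq; lra).
  assert (Ec : Rabs (- c) = c) by (rewrite Rabs_Ropp; apply Rabs_pos_eq; lra).
  destruct (three_interior A p q Hp Hq a b (- c)) as ((Ha' & H1) & (Hb' & H2) & (Hc' & _ & H3));
    rewrite ?Ea, ?Eb, ?Ec in *; trivial.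
  specialize (H1 ltac:(lra)). specialize (H2 ltac:(lra)). specialize (H3 ltac:(lra)).
  assert (HY2 := covec_Ry_Y A (Rx a) (Rx (- c)) b). rewrite H2 in HY2.
  assert (HZ2 := covec_Ry_Z A (Rx a) (Rx (- c)) b). rewrite H1 in HZ2.
  rewrite covec_Ry_X, H1 in H3.
  remember (covec A KZ (Rx a) (Ry b * Rx (- c))%M) as z eqn:Ez. symmetry in Ez.
  destruct (arc_full p b z Hp ltac:(lra)) as (Hz & Hzb & Hz2); [lra|].
  rewrite Hz2 in HZ2.
  set (u := (Rx a * Ry b)%M) in *.
  assert (Eu : (Rx a * (Ry b * Rx (- c)) = u * Rx (- c))%M) by (unfold u; weq).
  assert (Hsc : 0 < sin c) by (apply sin_gt_0; lra).
  assert (HXe : covec A KX (u * Rx (- c))%M mid3 = - p).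
  { rewrite covec_Rx_X, mmul_1_r. unfold u. rewrite covec_Ry_X, H1. subst z. lra. }
  assert (HYe : covec A KY (u * Rx (- c))%M mid3 = q * cos c - z * sin c).
  { rewrite covec_Rx_Y, mmul_1_r, HY2, HZ2, cos_neg, sin_neg. ring. }
  assert (HYlow : - q <= covec A KY (u * Rx (- c))%M mid3).
  { apply (insert_Ry_opp _ _ _ _ Hmin _ _ q PI); [unfold u; weq|lra|].
    intros e He. apply ex_cost with (p * a + q * b + p * c + q * e + p * 0); [|lra].
    eapply cls_eq; [apply (cls_XYXYX p q a b c e 0); lra| |reflexivity].
    unfold u; weq. }
  rewrite HYe in HYlow.
  split.
  - rewrite Eu. split; apply Rabs_le.
    + rewrite HXe. lra.
    + rewrite HYe. split; [lra|]. pose proof (COS_bound c). nra.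
  - intros Hg.
    (* The [X]-time of the pattern: the time in which an [X]-letter takes the [Y] coordinate of the
       covector from [q] to [- q] when the third coordinate is [z]. *)
    set (t := 2 * atan (q / z)).
    assert (Hat : 0 < atan (q / z) < PI / 2).
    { split; [|apply atan_bound]. rewrite <- atan_0. apply atan_increasing.
      apply Rdiv_lt_0_compat; assumption. }
    assert (Et2 : t / 2 = atan (q / z)) by (unfold t; field).
    assert (Hca : 0 < cos (atan (q / z))) by (apply cos_gt_0; lra).
    assert (Hrel : z * sin (t / 2) = q * cos (t / 2)).
    { rewrite Et2. pose proof (tan_atan (q / z)) as Ht. unfold tan in Ht.
      apply Rmult_eq_reg_r with (/ (z * cos (atan (q / z)))).
      2: { apply Rinv_neq_0_compat. apply Rmult_integral_contrapositive; lra. }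
      transitivity (sin (atan (q / z)) / cos (atan (q / z))); [field; lra|].
      rewrite Ht at 1. field; lra. }
    assert (Htr : 0 < t < PI) by (unfold t; lra).
    apply symclosure_1. apply (baseq3 p q a b c t).
    + split; [lra|].
      apply (half_angle_le z q a t); try lra.
      apply (start_bound a (Ry b * Rx (- c))%M (p * a + q * b + p * c)); trivial; try lra.
      now apply cls_reach.
    + split; [lra|]. apply (half_angle_le z q c t); lra.
    + lra.
    + lra.
    + apply half_angle_eq in Hzb; [|lra].
      apply Rmult_eq_reg_l with z; [|lra].
      replace (z * (p * sin (t / 2) * cos (b / 2))) with (p * (z * sin (t / 2)) * cos (b / 2)) by ring.
      replace (z * (q * cos (t / 2) * sin (b / 2))) with (q * cos (t / 2) * (z * sin (b / 2))) by ring.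
      rewrite Hrel, Hzb. ring.
Qed.
End Three.

Lemma sgn_abs t : exists s, sgn s * Rabs t = t.
Proof. unfold Rabs. destruct (Rcase_abs t); [exists true|exists false]; simpl; lra. Qed.

Lemma minimizer_eq S A M c M' c' : minimizer S A M c -> M = M' -> c = c' -> minimizer S A M' c'.
Proof. intros; subst; assumption. Qed.

(** Zero times leave two letters. Otherwise a symmetry makes the first two letters positive, and the
    sign of the third decides between a contradiction and [three_opp]. *)
Lemma three_letters A p q a b c c0 : 0 < p -> 0 < q ->
  minimizer (cls p q) A (Rx a * (Ry b * Rx c))%M c0 ->
  p * Rabs a + q * Rabs b + p * Rabs c <= c0 -> good_ex A p q.
Proof.
  intros Hp Hq H Hc. pose proof PI_RGT_0.
  destruct (wrap a) as (a' & Ha1 & Ha2 & Ha3 & _).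
  destruct (wrap b) as (b' & Hb1 & Hb2 & _ & Hb3).
  destruct (wrap c) as (c' & Hc1 & Hc2 & Hc3 & _).
  rewrite <- Ha3, <- Hb3, <- Hc3 in H.
  assert (H' : minimizer (cls p q) A (Rx a' * (Ry b' * Rx c'))%M (p * Rabs a' + q * Rabs b' + p * Rabs c')).
  { apply (minimizer_le _ _ _ c0); [assumption| |].
    - apply cls_XYX; lra.
    - assert (p * Rabs a' <= p * Rabs a) by (apply Rmult_le_compat_l; lra).
      assert (q * Rabs b' <= q * Rabs b) by (apply Rmult_le_compat_l; lra).
      assert (p * Rabs c' <= p * Rabs c) by (apply Rmult_le_compat_l; lra). lra. }
  clear a b c c0 H Hc Ha2 Hb2 Hc2 Ha3 Hb3 Hc3. rename a' into a, b' into b, c' into c, H' into H.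
  destruct (Req_dec c 0) as [->|Hc0].
  { apply (two_letters A p q Hp Hq a b (p * Rabs a + q * Rabs b + p * Rabs 0)).
    - eapply minimizer_eq; [exact H|weq|reflexivity].
    - rewrite Rabs_R0; lra. }
  destruct (Req_dec b 0) as [->|Hb0].
  { apply (two_letters A p q Hp Hq (a + c) 0 (p * Rabs a + q * Rabs 0 + p * Rabs c)).
    - eapply minimizer_eq; [exact H|weq|reflexivity].
    - rewrite Rabs_R0. assert (p * Rabs (a + c) <= p * (Rabs a + Rabs c)) by (apply Rmult_le_compat_l; [lra|apply Rabs_triang]). lra. }
  destruct (Req_dec a 0) as [->|Ha0].
  { apply (good_ex_conj swp).
    apply (two_letters _ q p Hq Hp b c (p * Rabs 0 + q * Rabs b + p * Rabs c)).
    - apply (minimizer_conj _ cls_sym swp p q).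
      eapply minimizer_eq; [exact H| |reflexivity].
      rewrite conj_mul, conj_swp_Rx, conj_swp_Ry. weq.
    - rewrite Rabs_R0; lra. }
  apply Rabs_pos_lt in Ha0, Hb0, Hc0.
  destruct (sgn_abs a) as [sa Esa]. destruct (sgn_abs b) as [sb Esb].
  assert (Ess : sgn sa * sgn sa = 1) by (destruct sa; simpl; ring).
  apply (good_ex_conj (false, (sa, sb))).
  set (c' := sgn sa * c).
  assert (Ec' : Rabs c' = Rabs c).
  { unfold c'. rewrite Rabs_mult. destruct sa; simpl; rewrite ?Rabs_R1, ?Rabs_Ropp, ?Rabs_R1; try ring.
    replace (-1) with (- (1)) by ring. rewrite Rabs_Ropp, Rabs_R1. ring. }
  assert (HEx : forall t, conjg (false, (sa, sb)) (Rx t) = Rx (sgn sa * t)).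
  { intros t. destruct sa, sb; simpl; rewrite ?Rmult_1_l, <- ?Ropp_mult_distr_l, ?Rmult_1_l;
    try replace (-1 * t) with (- t) by ring; apply mat_ext; simpl; trig; ring. }
  assert (HEy : forall t, conjg (false, (sa, sb)) (Ry t) = Ry (sgn sb * t)).
  { intros t. destruct sa, sb; simpl; rewrite ?Rmult_1_l, <- ?Ropp_mult_distr_l, ?Rmult_1_l;
    try replace (-1 * t) with (- t) by ring; apply mat_ext; simpl; trig; ring. }
  assert (Hm : minimizer (cls p q) (conjg (syminv (false, (sa, sb))) A)
    (Rx (Rabs a) * (Ry (Rabs b) * Rx c'))%M (p * Rabs a + q * Rabs b + p * Rabs c')).
  { apply (minimizer_conj _ cls_sym (false, (sa, sb)) p q).
    eapply minimizer_eq; [exact H| |].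
    - rewrite !conj_mul, !HEx, HEy, Esa, Esb. unfold c'.
      rewrite <- Rmult_assoc, Ess, Rmult_1_l. reflexivity.
    - now rewrite Ec'. }
  rewrite <- Ec' in Hc0, Hc1.
  unfold fstc, sndc; simpl fst; cbv iota.
  destruct (Rle_or_lt 0 c') as [Hs|Hs].
  - exfalso. rewrite (Rabs_pos_eq c') in * by assumption.
    eapply (three_same_sign _ p q Hp Hq (Rabs a) (Rabs b) c'); try lra.
    exact (proj2 Hm).
  - rewrite (Rabs_left c') in * by assumption.
    replace c' with (- - c') in Hm at 1 by ring.
    eexists _, _; split; [exact Hm|].
    apply three_opp; trivial; lra.
Qed.

(** * Four-letter minimizers *)

Lemma Rx_opp_PI : Rx (- PI) = Rx PI.
Proof. rewrite <- (Rx_2PI PI). f_equal; ring. Qed.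
Lemma Ry_opp_PI : Ry (- PI) = Ry PI.
Proof. rewrite <- (Ry_2PI PI). f_equal; ring. Qed.
Lemma Rx_PI_RyA t M : (Rx PI * (Ry t * M))%M = (Ry (- t) * (Rx PI * M))%M.
Proof. now rewrite <- !mmul_assoc, Rx_PI_Ry. Qed.
Lemma Ry_PI_RxA t M : (Ry PI * (Rx t * M))%M = (Rx (- t) * (Ry PI * M))%M.
Proof. now rewrite <- !mmul_assoc, Ry_PI_Rx. Qed.
Lemma Rx_2PI_1 : Rx (2 * PI) = mid3.
Proof. rewrite <- (Rx_2PI (2 * PI)), Rminus_diag. apply Rx_0. Qed.
Lemma Ry_2PI_1 : Ry (2 * PI) = mid3.
Proof. rewrite <- (Ry_2PI (2 * PI)), Rminus_diag. apply Ry_0. Qed.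

Section Four.
Variables (A : mat) (p q : R).
Hypotheses (Hp : 0 < p) (Hq : 0 < q).

(* The covector at the switches of [X Y -X -Y], in terms of its third coordinate [z], is
   [(p, q, z)], [(-p, q, z)] and [(-p, -q, z)]. *)
Lemma four_covector a b c v (u := (Rx a * Ry b)%M) : 0 < b < PI -> 0 < c < PI ->
  covec A KX (Rx a) (Ry b * (Rx (- c) * v))%M = p ->
  covec A KY (Rx a) (Ry b * (Rx (- c) * v))%M = q ->
  covec A KX u (Rx (- c) * v)%M = - p ->
  covec A KY (u * Rx (- c))%M v = - q ->
  exists z, 0 < z /\ z * sin b = p * (1 + cos b) /\ z * sin c = q * (1 + cos c) /\
    covec A KZ (Rx a) (Ry b * (Rx (- c) * v))%M = z /\
    covec A KX (u * Rx (- c))%M v = - p /\ covec A KZ (u * Rx (- c))%M v = z.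
Proof.
  intros Hb Hc H1 H2 H3 H4.
  remember (covec A KZ (Rx a) (Ry b * (Rx (- c) * v))%M) as z eqn:Ez. symmetry in Ez.
  exists z.
  assert (H3' := H3). unfold u in H3'. rewrite covec_Ry_X, H1, Ez in H3'.
  destruct (arc_full p b z Hp Hb) as (Hz & Hzb & Hz2); [lra|].
  assert (HY2 : covec A KY u (Rx (- c) * v)%M = q) by (unfold u; rewrite covec_Ry_Y; exact H2).
  assert (HZ2 : covec A KZ u (Rx (- c) * v)%M = z) by (unfold u; rewrite covec_Ry_Z, H1, Ez; exact Hz2).
  rewrite covec_Rx_Y, HY2, HZ2, cos_neg, sin_neg in H4.
  destruct (arc_full q c z Hq Hc) as (_ & Hzc & Hz3); [lra|].
  repeat split; trivial.
  - now rewrite covec_Rx_X.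
  - rewrite covec_Rx_Z, HY2, HZ2, cos_neg, sin_neg. lra.
Qed.

(** At the end the [Y] coordinate is [- q] and the [X] coordinate is [- p cos d + z sin d >= - p].
    The missing upper bound comes from appending [X], which leads to the five-letter family, and it
    also bounds [d] by [b]. *)
Lemma four_letters a b c d (M := (Rx a * (Ry b * (Rx (- c) * Ry (- d))))%M) :
  0 < a <= 2 * PI -> 0 < b <= PI -> 0 < c <= PI -> 0 < d <= PI ->
  minimizer (cls p q) A M (p * a + q * b + p * c + q * d) ->
  good A p q M (p * a + q * b + p * c + q * d).
Proof.
  intros Ha Hb Hc Hd [HM Hmin]. pose proof PI_RGT_0 as HPI.
  assert (Hpa := Rmult_lt_0_compat p a Hp ltac:(lra)).
  assert (Hqb := Rmult_lt_0_compat q b Hq ltac:(lra)).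
  assert (Hpc := Rmult_lt_0_compat p c Hp ltac:(lra)).
  assert (Hqd := Rmult_lt_0_compat q d Hq ltac:(lra)).
  assert (Ha' : a < 2 * PI).
  { destruct (proj2 Ha) as [|Ea]; [assumption|exfalso].
    assert (L := low_YXY A p q Hp Hq M _ b (- c) (- d) Hmin).
    unfold M in L. rewrite Ea, Rx_2PI_1, mmul_1_l in L. specialize (L eq_refl).
    rewrite !Rabs_Ropp, (Rabs_pos_eq b), (Rabs_pos_eq c), (Rabs_pos_eq d) in L by lra. subst a; lra. }
  (* A letter of time [PI] reverses the letters of the other axis that it passes. In each of the
     next three cases this collapses the word to a cheaper one with fewer letters. *)
  assert (Hb' : b < PI).
  { destruct (proj2 Hb) as [|Eb]; [assumption|exfalso].
    assert (L := low_XYX A p q Hp Hq M _ (a + c) (PI - d) 0 Hmin).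
    rewrite Rabs_R0, (Rabs_pos_eq (a + c)), (Rabs_pos_eq (PI - d)) in L by lra.
    subst b. assert (p * a + q * PI + p * c + q * d <= p * (a + c) + q * (PI - d) + p * 0); [|lra].
    apply L. unfold M. rewrite Ry_PI_RxA. weq. }
  assert (Hc' : c < PI).
  { destruct (proj2 Hc) as [|Ec]; [assumption|exfalso].
    assert (L := low_XYX A p q Hp Hq M _ (a - PI) (- b - d) 0 Hmin).
    rewrite Rabs_R0, (Rabs_left (- b - d)) in L by lra.
    subst c.
    assert (p * a + q * b + p * PI + q * d <= p * Rabs (a - PI) + q * - (- b - d) + p * 0).
    { apply L. unfold M. rewrite Rx_opp_PI, Rx_PI_Ry.
      rewrite <- (Rx_congr (a + PI) (a - PI)) by (right; right; ring).
      replace (Ry b) with (Ry (- - b)) by (f_equal; ring).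
      rewrite <- Rx_PI_Ry, <- Rx_PI_RyA. weq. }
    assert (p * Rabs (a - PI) < p * (a + PI)).
    { apply Rmult_lt_compat_l; [assumption|]. unfold Rabs; destruct Rcase_abs; lra. }
    lra. }
  assert (Hd' : d < PI).
  { destruct (proj2 Hd) as [|Ed]; [assumption|exfalso].
    assert (L := low_XYX A p q Hp Hq M _ a (b - PI) c Hmin).
    rewrite (Rabs_pos_eq a), (Rabs_pos_eq c), (Rabs_left1 (b - PI)) in L by lra.
    subst d.
    assert (p * a + q * b + p * c + q * PI <= p * a + q * - (b - PI) + p * c); [|lra].
    apply L. unfold M. rewrite Ry_opp_PI, <- Ry_PI_Rx.
    rewrite <- (Ry_congr (b + PI) (b - PI)) by (right; right; ring). weq. }
  assert (H1 : covec A KX (Rx a) (Ry b * (Rx (- c) * Ry (- d)))%M = p).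
  { apply Rle_antisym.
    - apply (insert_Rx _ _ _ _ Hmin _ _ p (2 * PI - a)); [reflexivity|lra|].
      intros e He. apply ex_cost with (p * (a + e) + q * b + p * c + q * d + p * 0); [|lra].
      eapply cls_eq; [apply (cls_XYXYX p q (a + e) b c d 0); lra|weq|reflexivity].
    - rewrite <- (Ropp_involutive p).
      apply (insert_Rx_opp _ _ _ _ Hmin _ _ (- p) a); [reflexivity|lra|].
      intros e He. apply ex_cost with (p * (a - e) + q * b + p * c + q * d + p * 0); [|lra].
      eapply cls_eq; [apply (cls_XYXYX p q (a - e) b c d 0); lra|weq|reflexivity]. }
  assert (H2 : covec A KY (Rx a) (Ry b * (Rx (- c) * Ry (- d)))%M = q).
  { apply Rle_antisym.
    - apply (insert_Ry _ _ _ _ Hmin _ _ q (PI - b)); [reflexivity|lra|].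
      intros e He. apply ex_cost with (p * a + q * (b + e) + p * c + q * d + p * 0); [|lra].
      eapply cls_eq; [apply (cls_XYXYX p q a (b + e) c d 0); lra|weq|reflexivity].
    - rewrite <- (Ropp_involutive q).
      apply (insert_Ry_opp _ _ _ _ Hmin _ _ (- q) b); [reflexivity|lra|].
      intros e He. apply ex_cost with (p * a + q * (b - e) + p * c + q * d + p * 0); [|lra].
      eapply cls_eq; [apply (cls_XYXYX p q a (b - e) c d 0); lra|weq|reflexivity]. }
  set (u := (Rx a * Ry b)%M).
  assert (H3 : covec A KX u (Rx (- c) * Ry (- d))%M = - p).
  { apply Rle_antisym.
    - apply (insert_Rx _ _ _ _ Hmin _ _ (- p) c); [unfold u, M; weq|lra|].
      intros e He. apply ex_cost with (p * a + q * b + p * (c - e) + q * d + p * 0); [|lra].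
      eapply cls_eq; [apply (cls_XYXYX p q a b (c - e) d 0); lra|unfold u; weq|reflexivity].
    - apply (insert_Rx_opp _ _ _ _ Hmin _ _ p (PI - c)); [unfold u, M; weq|lra|].
      intros e He. apply ex_cost with (p * a + q * b + p * (c + e) + q * d + p * 0); [|lra].
      eapply cls_eq; [apply (cls_XYXYX p q a b (c + e) d 0); lra|unfold u; weq|reflexivity]. }
  assert (H4 : covec A KY (u * Rx (- c))%M (Ry (- d)) = - q).
  { apply Rle_antisym.
    - apply (insert_Ry _ _ _ _ Hmin _ _ (- q) d); [unfold u, M; weq|lra|].
      intros e He. apply ex_cost with (p * a + q * b + p * c + q * (d - e) + p * 0); [|lra].
      eapply cls_eq; [apply (cls_XYXYX p q a b c (d - e) 0); lra|unfold u; weq|reflexivity].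
    - apply (insert_Ry_opp _ _ _ _ Hmin _ _ q (PI - d)); [unfold u, M; weq|lra|].
      intros e He. apply ex_cost with (p * a + q * b + p * c + q * (d + e) + p * 0); [|lra].
      eapply cls_eq; [apply (cls_XYXYX p q a b c (d + e) 0); lra|unfold u; weq|reflexivity]. }
  destruct (four_covector a b c (Ry (- d))) as (z & Hz & Hzb & Hzc & Hz1 & HX3 & HZ3); trivial; try lra.
  fold u in HX3, HZ3.
  assert (EM : M = (u * Rx (- c) * Ry (- d))%M) by (unfold M, u; weq).
  assert (HXe : covec A KX M mid3 = - p * cos d + z * sin d).
  { rewrite EM, covec_Ry_X, mmul_1_r, HX3, HZ3, cos_neg, sin_neg. ring. }
  assert (HYe : covec A KY M mid3 = - q).
  { now rewrite EM, covec_Ry_Y, mmul_1_r. }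
  assert (HXup : covec A KX M mid3 <= p).
  { apply (insert_Rx _ _ _ _ Hmin _ _ p PI); [apply mmul_1_r|lra|].
    intros e He. apply ex_cost with (p * a + q * b + p * c + q * d + p * e); [|lra].
    eapply cls_eq; [apply (cls_XYXYX p q a b c d e); lra|unfold M; weq|reflexivity]. }
  assert (Hsd : 0 < sin d) by (apply sin_gt_0; lra).
  split.
  - split; apply Rabs_le.
    + split; [|assumption]. rewrite HXe. pose proof (COS_bound d). nra.
    + rewrite HYe. lra.
  - intros Hg.
    (* From [PI] on, lengthening the first letter shortens the equivalent rotation in the opposite
       direction, so the covector would be at most [- p] instead of [p]. *)
    assert (HPIa : a < PI).
    { destruct (Rlt_or_le a PI) as [|Hge]; [assumption|exfalso].
      enough (covec A KX (Rx a) (Ry b * (Rx (- c) * Ry (- d)))%M <= - p) by lra.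
      apply (insert_Rx _ _ _ _ Hg _ _ (- p) (2 * PI - a)); [reflexivity|lra|].
      intros e He. eexists; split.
      - rewrite Rx_addA, <- (Rx_2PI (a + e)).
        apply reach_app; [apply reach_Rx|]. apply reach_app; [apply reach_Ry|].
        apply reach_app; [apply reach_Rx|apply reach_Ry].
      - rewrite !Rabs_Ropp, (Rabs_pos_eq b), (Rabs_pos_eq c), (Rabs_pos_eq d), (Rabs_left (a + e - 2 * PI)) by lra.
        assert (p * (a - PI) >= 0) by (apply Rle_ge, Rmult_le_pos; lra). lra. }
    assert (Hrb := half_angle_eq _ _ _ (conj (proj1 Hb) Hb') Hzb).
    assert (Hrc := half_angle_eq _ _ _ (conj (proj1 Hc) Hc') Hzc).
    apply symclosure_1. apply (baseq4 p q a b c d); try lra.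
    + split; [lra|].
      apply (half_angle_le z q a c); try lra.
      apply (start_bound A p q a (Ry b * (Rx (- c) * Ry (- d)))%M (p * a + q * b + p * c + q * d)); trivial; try lra.
      now apply cls_reach.
    + split; [lra|].
      apply (half_angle_le z p d b); try lra.
    + apply Rmult_eq_reg_l with z; [|lra].
      replace (z * (p * sin (c / 2) * cos (b / 2))) with (p * (z * sin (c / 2)) * cos (b / 2)) by ring.
      replace (z * (q * cos (c / 2) * sin (b / 2))) with (q * cos (c / 2) * (z * sin (b / 2))) by ring.
      rewrite Hrc, Hrb. ring.
Qed.
End Four.

(* The action of [w + x i + y j + z k], without normalization: multiplicative on all quaternions. *)
Definition quat_mat (w x y z : R) : mat :=
  mkm (w * w + x * x - y * y - z * z) (2 * (x * y - w * z)) (2 * (x * z + w * y))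
      (2 * (x * y + w * z)) (w * w - x * x + y * y - z * z) (2 * (y * z - w * x))
      (2 * (x * z - w * y)) (2 * (y * z + w * x)) (w * w - x * x - y * y + z * z).

Lemma quat_mat_mul w x y z w' x' y' z' : (quat_mat w x y z * quat_mat w' x' y' z')%M =
  quat_mat (w * w' - x * x' - y * y' - z * z') (w * x' + x * w' + y * z' - z * y')
           (w * y' - x * z' + y * w' + z * x') (w * z' + x * y' - y * x' + z * w').
Proof. mring. Qed.

Lemma quat_Rx t : Rx (2 * t) = quat_mat (cos t) (sin t) 0 0.
Proof.
  pose proof (sin2_cos2 t) as H; unfold Rsqr in H.
  apply mat_ext; simpl; rewrite ?cos_2a, ?sin_2a; lra.
Qed.
Lemma quat_Ry t : Ry (2 * t) = quat_mat (cos t) 0 (sin t) 0.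
Proof.
  pose proof (sin2_cos2 t) as H; unfold Rsqr in H.
  apply mat_ext; simpl; rewrite ?cos_2a, ?sin_2a; lra.
Qed.

(** In complex form the first two coordinates are [(cos y cos s - i sin y cos b) exp(i al)] and the
    last two are [(cos y sin s + i sin y sin b) exp(i be)]. The outer times enter only through the
    phases, by their sum and their difference. *)
Lemma quat_XYXYX a b s y e (al := (a + e) / 2) (be := (a - e) / 2) :
  (Rx a * (Ry (b + s) * (Rx (- (2 * y)) * (Ry (- (b - s)) * Rx e))))%M =
  quat_mat (cos y * cos s * cos al + sin y * cos b * sin al)
           (cos y * cos s * sin al - sin y * cos b * cos al)
           (cos y * sin s * cos be - sin y * sin b * sin be)
           (cos y * sin s * sin be + sin y * sin b * cos be).
Proof.
  set (a' := a / 2). set (e' := e / 2). set (u := (b + s) / 2). set (w := (b - s) / 2).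
  replace (Rx a) with (Rx (2 * a')) by (f_equal; unfold a'; field).
  replace (Rx e) with (Rx (2 * e')) by (f_equal; unfold e'; field).
  replace (Ry (b + s)) with (Ry (2 * u)) by (f_equal; unfold u; field).
  replace (Ry (- (b - s))) with (Ry (2 * - w)) by (f_equal; unfold w; field).
  replace (Rx (- (2 * y))) with (Rx (2 * - y)) by (f_equal; ring).
  rewrite !quat_Rx, !quat_Ry, !quat_mat_mul.
  replace al with (a' + e') by (unfold al, a', e'; field).
  replace be with (a' - e') by (unfold be, a', e'; field).
  replace b with (u + w) by (unfold u, w; field).
  replace s with (u - w) by (unfold u, w; field).
  rewrite ?cos_neg, ?sin_neg, ?cos_plus, ?cos_minus, ?sin_plus, ?sin_minus.
  f_equal; ring.
Qed.

Lemma polar_atan X Y : 0 < X ->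
  sqrt (X * X + Y * Y) * cos (atan (Y / X)) = X /\ sqrt (X * X + Y * Y) * sin (atan (Y / X)) = Y.
Proof.
  intros HX.
  assert (E : sqrt (X * X + Y * Y) = X * sqrt (1 + (Y / X)²)).
  { rewrite <- (sqrt_square X) at 3 by lra. rewrite <- sqrt_mult_alt by nra.
    f_equal. unfold Rsqr. field. lra. }
  assert (0 < sqrt (1 + (Y / X)²)) by (apply sqrt_lt_R0; pose proof (Rle_0_sqr (Y / X)); lra).
  rewrite E, cos_atan, sin_atan. split; field; lra.
Qed.

Ltac rmin := solve [apply Rle_refl | eapply Rle_trans; [apply Rmin_l|rmin]
  | eapply Rle_trans; [apply Rmin_r|rmin]].

Lemma atan_continuous x : continuous atan x.
Proof.
  apply continuity_pt_filterlim. apply derivable_continuous_pt.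
  exact (derivable_pt_atan x).
Qed.

Lemma continuous_near (f : R -> R) x eta : continuous f x -> 0 < eta ->
  exists d, 0 < d /\ forall t, Rabs (t - x) < d -> Rabs (f t - f x) < eta.
Proof.
  intros H Heta. apply continuity_pt_filterlim in H.
  destruct (H eta Heta) as (d & Hd & H'). exists d; split; [exact Hd|].
  intros t Ht. destruct (Req_dec t x) as [->|Hne]; [rewrite Rminus_diag, Rabs_R0; lra|].
  apply H'. split; [split; [exact I|congruence]|exact Ht].
Qed.

(* The word is kept fixed as a rotation while the two equal times [b] are changed to [b + s]
   and [b - s]; its modulus and argument are read off [quat_XYXYX]. *)
Lemma shorten_XYXYX a b c e eta : 0 < b < PI -> 0 < c < PI -> 0 < eta ->
  exists a' s c' e', Rabs (a' - a) < eta /\ Rabs s < eta /\ Rabs (c' - c) < eta /\ Rabs (e' - e) < eta /\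
    a' + c' + e' < a + c + e /\
    (Rx a' * (Ry (b + s) * (Rx (- c') * (Ry (- (b - s)) * Rx e'))))%M =
    (Rx a * (Ry b * (Rx (- c) * (Ry (- b) * Rx e))))%M.
Proof.
  intros Hb Hc Heta. set (y0 := c / 2).
  assert (Hsb : 0 < sin b) by (apply sin_gt_0; lra).
  assert (Hsy : 0 < sin y0) by (apply sin_gt_0; unfold y0; lra).
  assert (Hcy : 0 < cos y0) by (apply cos_gt_0; unfold y0; lra).
  (* Keeping the moduli forces [tan y ^ 2 = T s] for half the middle time [y]. [Th] and [Ps] are the
     phases of the two complex factors, up to sign and a quarter turn, for which the outer times
     have to compensate. *)
  set (T := fun s => (sin b * sin b - sin s * sin s) / (sin b * sin b * (cos y0 * cos y0)) - 1).
  set (Y := fun s => atan (sqrt (T s))).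
  set (Th := fun s => atan (sqrt (T s) * cos b / cos s)).
  set (Ps := fun s => atan (sin s / (sqrt (T s) * sin b))).
  assert (Hy0 := sin2_cos2 y0). unfold Rsqr in Hy0.
  assert (HT0 : sqrt (T 0) = tan y0).
  { unfold T, tan. rewrite sin_0.
    replace ((sin b * sin b - 0 * 0) / (sin b * sin b * (cos y0 * cos y0)) - 1)
      with ((sin y0 / cos y0) * (sin y0 / cos y0)).
    - apply sqrt_square. apply Rlt_le, Rdiv_lt_0_compat; assumption.
    - field_simplify; [|lra|lra]. replace (sin y0 ^ 2) with (1 - cos y0 ^ 2); [field; lra|].
      simpl. rewrite !Rmult_1_r. lra. }
  assert (Htan : 0 < tan y0) by (unfold tan; apply Rdiv_lt_0_compat; assumption).
  assert (HTpos : 0 < T 0).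
  { destruct (Rle_or_lt (T 0) 0) as [Hle|]; [|assumption].
    rewrite sqrt_neg_0 in HT0 by assumption. lra. }
  assert (cT : continuous T 0).
  { apply @ex_derive_continuous. unfold T. auto_derive. repeat split; trivial. }
  assert (csT : continuous (fun s => sqrt (T s)) 0).
  { apply (continuous_comp T sqrt); [exact cT|]. apply continuous_sqrt. }
  assert (ccos : continuous cos 0) by apply continuous_cos.
  assert (csin : continuous sin 0) by apply continuous_sin.
  assert (cinv : forall x, x <> 0 -> continuous Rinv x).
  { intros x Hx. apply @ex_derive_continuous. auto_derive; trivial. }
  assert (cY : continuous Y 0).
  { apply (continuous_comp (fun s => sqrt (T s)) atan); [exact csT|apply atan_continuous]. }
  assert (cTh : continuous Th 0).
  { apply (continuous_comp (fun s => sqrt (T s) * cos b / cos s) atan); [|apply atan_continuous].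
    apply @continuous_mult; [apply @continuous_mult; [exact csT|apply continuous_const]|].
    apply (continuous_comp cos Rinv); [exact ccos|]. apply cinv. rewrite cos_0; lra. }
  assert (cPs : continuous Ps 0).
  { apply (continuous_comp (fun s => sin s / (sqrt (T s) * sin b)) atan); [|apply atan_continuous].
    apply @continuous_mult; [exact csin|].
    apply (continuous_comp (fun s => sqrt (T s) * sin b) Rinv).
    - apply @continuous_mult; [exact csT|apply continuous_const].
    - apply cinv. rewrite HT0. apply Rgt_not_eq. apply Rmult_gt_0_compat; assumption. }
  destruct (continuous_near T 0 (T 0) cT HTpos) as (d1 & Hd1 & H1).
  destruct (continuous_near Y 0 (eta / 2) cY ltac:(lra)) as (d2 & Hd2 & H2).
  destruct (continuous_near Th 0 (eta / 2) cTh ltac:(lra)) as (d3 & Hd3 & H3).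
  destruct (continuous_near Ps 0 (eta / 2) cPs ltac:(lra)) as (d4 & Hd4 & H4).
  set (m := Rmin (Rmin d1 d2) (Rmin (Rmin d3 d4) (Rmin eta (Rmin (PI / 2) (Rmin b (PI - b)))))).
  assert (Hm : 0 < m) by (unfold m; repeat apply Rmin_pos; lra).
  assert (Hml : m <= d1 /\ m <= d2 /\ m <= d3 /\ m <= d4 /\ m <= eta /\ m <= PI / 2 /\ m <= b /\ m <= PI - b).
  { unfold m; repeat split; rmin. }
  set (s := m / 2). destruct Hml as (? & ? & ? & ? & ? & ? & ? & ?).
  assert (Hs : 0 < s < m) by (unfold s; lra).
  assert (Hs0 : Rabs (s - 0) < m) by (rewrite Rminus_0_r, Rabs_pos_eq; lra).
  specialize (H1 s ltac:(lra)). specialize (H2 s ltac:(lra)).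
  specialize (H3 s ltac:(lra)). specialize (H4 s ltac:(lra)).
  clearbody m. clear cT csT ccos csin cinv cY cTh cPs.
  assert (HTs : 0 < T s) by (apply Rabs_lt_between in H1; lra).
  assert (Hr : 0 < sqrt (T s)) by (apply sqrt_lt_R0; assumption).
  assert (Er : sqrt (T s) * sqrt (T s) = T s) by (apply sqrt_sqrt; lra).
  set (y := Y s) in *.
  assert (Hy : 0 < y < PI / 2).
  { split; [|apply atan_bound]. unfold y, Y. rewrite <- atan_0. now apply atan_increasing. }
  assert (Hcys : 0 < cos y) by (apply cos_gt_0; lra).
  assert (Hsys : 0 < sin y) by (apply sin_gt_0; lra).
  assert (Ety : sin y / cos y = sqrt (T s)) by apply (tan_atan (sqrt (T s))).
  assert (Esy : sin y = sqrt (T s) * cos y) by (rewrite <- Ety; field; lra).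
  assert (Hyy := sin2_cos2 y). unfold Rsqr in Hyy.
  assert (Hss : 0 < sin s) by (apply sin_gt_0; lra).
  assert (Hcs : 0 < cos s) by (apply cos_gt_0; lra).
  assert (Hcs1 : cos s < 1) by (rewrite <- cos_0; apply cos_decreasing_1; lra).
  assert (Hcsb : cos b < cos s) by (apply cos_decreasing_1; lra).
  assert (Hcsb' : 0 < cos b + cos s).
  { assert (E : cos (PI - s) = - cos s) by (rewrite cos_minus, cos_PI, sin_PI; ring).
    assert (cos (PI - s) < cos b) by (apply cos_decreasing_1; lra). lra. }
  assert (Hsq := sin2_cos2 s). unfold Rsqr in Hsq.
  assert (Hbq := sin2_cos2 b). unfold Rsqr in Hbq.
  (* The definition of [T] cleared of denominators; it says that the second complex coordinate keeps
     its modulus. The first one then does so too, the quaternion having norm one. *)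
  assert (Hcon : cos y * cos y * (sin b * sin b - sin s * sin s) = sin b * sin b * (cos y0 * cos y0)).
  { assert (E : cos y * cos y * (1 + T s) = 1).
    { rewrite <- Er. replace (cos y * cos y * (1 + sqrt (T s) * sqrt (T s)))
        with (cos y * cos y + (sqrt (T s) * cos y) * (sqrt (T s) * cos y)) by ring.
      rewrite <- Esy. lra. }
    unfold T in E.
    replace (sin b * sin b * (cos y0 * cos y0)) with (sin b * sin b * (cos y0 * cos y0) * 1) by ring.
    rewrite <- E. field. lra. }
  assert (Hmod : cos y * sin s * (cos y * sin s) + sin y * sin b * (sin y * sin b)
     = sin y0 * sin b * (sin y0 * sin b)).
  { replace (sin y * sin b * (sin y * sin b)) with ((1 - cos y * cos y) * (sin b * sin b)) by (rewrite <- Hyy; ring).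
    replace (sin y0 * sin b * (sin y0 * sin b)) with ((1 - cos y0 * cos y0) * (sin b * sin b)) by (rewrite <- Hy0; ring).
    lra. }
  assert (Hmod' : cos y * cos s * (cos y * cos s) + sin y * cos b * (sin y * cos b)
     = cos y0 * 1 * (cos y0 * 1) + sin y0 * cos b * (sin y0 * cos b)).
  { replace (cos y * cos s * (cos y * cos s)) with (cos y * cos y - cos y * sin s * (cos y * sin s))
      by (replace (cos y * cos y) with (cos y * cos y * 1) at 1 by ring; rewrite <- Hsq; ring).
    replace (sin y * cos b * (sin y * cos b)) with (sin y * sin y - sin y * sin b * (sin y * sin b))
      by (replace (sin y * sin y) with (sin y * sin y * 1) at 1 by ring; rewrite <- Hbq; ring).
    replace (sin y0 * cos b * (sin y0 * cos b)) with (sin y0 * sin y0 - sin y0 * sin b * (sin y0 * sin b))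
      by (replace (sin y0 * sin y0) with (sin y0 * sin y0 * 1) at 1 by ring; rewrite <- Hbq; ring).
    lra. }
  assert (EY0 : Y 0 = y0).
  { unfold Y. rewrite HT0. apply atan_tan. unfold y0; lra. }
  assert (EPs0 : Ps 0 = 0) by (unfold Ps; rewrite sin_0; unfold Rdiv; rewrite Rmult_0_l; apply atan_0).
  set (r0 := sqrt (cos y0 * 1 * (cos y0 * 1) + sin y0 * cos b * (sin y0 * cos b))).
  assert (Hr0 : 0 < r0).
  { apply sqrt_lt_R0. assert (0 < cos y0 * cos y0) by (apply Rmult_lt_0_compat; assumption).
    pose proof (Rle_0_sqr (sin y0 * cos b)) as Q. unfold Rsqr in Q. lra. }
  assert (P0 : r0 * cos (Th 0) = cos y0 * 1 /\ r0 * sin (Th 0) = sin y0 * cos b).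
  { unfold Th, r0. rewrite HT0, cos_0.
    replace (tan y0 * cos b / 1) with (sin y0 * cos b / (cos y0 * 1)) by (unfold tan; field; lra).
    apply polar_atan. lra. }
  assert (P1 : r0 * cos (Th s) = cos y * cos s /\ r0 * sin (Th s) = sin y * cos b).
  { unfold Th, r0. rewrite <- Hmod', <- Ety.
    replace (sin y / cos y * cos b / cos s) with (sin y * cos b / (cos y * cos s)) by (field; lra).
    apply polar_atan. now apply Rmult_lt_0_compat. }
  set (rho := sin y0 * sin b).
  assert (Hrho : 0 < rho) by now apply Rmult_lt_0_compat.
  assert (P2 : rho * cos (Ps s) = sin y * sin b /\ rho * sin (Ps s) = cos y * sin s).
  { assert (E : rho = sqrt (sin y * sin b * (sin y * sin b) + cos y * sin s * (cos y * sin s))).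
    { rewrite Rplus_comm, Hmod. symmetry. apply sqrt_square. lra. }
    rewrite E. unfold Ps. rewrite <- Ety.
    replace (sin s / (sin y / cos y * sin b)) with (cos y * sin s / (sin y * sin b)) by (field; lra).
    apply polar_atan. now apply Rmult_lt_0_compat. }
  destruct P0 as [P0c P0s], P1 as [P1c P1s], P2 as [P2c P2s].
  rewrite EY0, EPs0 in *. rewrite Rminus_0_r in H4.
  apply Rabs_lt_between in H2, H3, H4.
  (* The total [X]-time changes by twice the change of [y + Th]. Both sums lie in [[0, PI]], so
     their cosines can be compared; with the modulus equation the comparison comes down to
     [cos s < 1]. *)
  assert (Hlt : y + Th s < y0 + Th 0).
  { assert (Hrange : forall t u, 0 < u < PI / 2 -> - u < atan t -> 0 <= u + atan t <= PI).
    { intros t u Hu Ht. pose proof (atan_bound t). lra. }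
    assert (Hlow : forall k u, 0 < tan u -> 0 < u < PI / 2 -> -1 < k -> - u < atan (tan u * k)).
    { intros k u Htu Hu Hk. rewrite <- (atan_tan u) at 1 by lra. rewrite <- atan_opp.
      apply atan_increasing. nra. }
    assert (R1 : 0 <= y + Th s <= PI).
    { apply Hrange; [lra|]. unfold Th. rewrite <- Ety. fold (tan y).
      replace (tan y * cos b / cos s) with (tan y * (cos b / cos s)) by (field; lra).
      apply Hlow; [unfold tan; apply Rdiv_lt_0_compat; assumption|lra|].
      apply Rmult_lt_reg_r with (cos s); [assumption|]. field_simplify; lra. }
    assert (R0 : 0 <= y0 + Th 0 <= PI).
    { apply Hrange; [unfold y0; lra|]. unfold Th. rewrite HT0, cos_0.
      replace (tan y0 * cos b / 1) with (tan y0 * cos b) by field.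
      apply Hlow; [assumption|unfold y0; lra|lra]. }
    destruct (Rlt_or_le (y + Th s) (y0 + Th 0)) as [|Hge]; [assumption|exfalso].
    assert (Hc2 : cos (y + Th s) <= cos (y0 + Th 0)) by (apply cos_decr_1; lra).
    rewrite !cos_plus in Hc2.
    apply (Rmult_le_compat_l r0) in Hc2; [|lra].
    replace (r0 * (cos y * cos (Th s) - sin y * sin (Th s)))
      with (cos y * (r0 * cos (Th s)) - sin y * (r0 * sin (Th s))) in Hc2 by ring.
    replace (r0 * (cos y0 * cos (Th 0) - sin y0 * sin (Th 0)))
      with (cos y0 * (r0 * cos (Th 0)) - sin y0 * (r0 * sin (Th 0))) in Hc2 by ring.
    rewrite P0c, P0s, P1c, P1s in Hc2.
    set (x := cos y * cos y) in *. set (x0 := cos y0 * cos y0) in *.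
    set (k := cos b) in *. set (l := cos s) in *.
    assert (Hx : x * l - (1 - x) * k <= x0 - (1 - x0) * k).
    { unfold x, x0 in *. replace (1 - cos y * cos y) with (sin y * sin y) by lra.
      replace (1 - cos y0 * cos y0) with (sin y0 * sin y0) by lra. lra. }
    assert (Hx2 : x * ((l - k) * (l + k)) = (1 - k * k) * x0).
    { replace (1 - k * k) with (sin b * sin b) by lra.
      rewrite <- Hcon. f_equal. transitivity (l * l - k * k); [ring|lra]. }
    assert (0 < x0) by (unfold x0; now apply Rmult_lt_0_compat).
    assert (Hx3 : x * (l + k) <= x0 * (1 + k)) by lra.
    apply (Rmult_le_compat_l (l - k)) in Hx3; [|lra].
    replace ((l - k) * (x * (l + k))) with (x * ((l - k) * (l + k))) in Hx3 by ring.
    rewrite Hx2 in Hx3.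
    assert (0 < (1 + k) * x0 * (1 - l)) by (apply Rmult_lt_0_compat; [apply Rmult_lt_0_compat|]; lra). lra. }
  (* The half sum of the outer times is shifted by [Th s - Th 0] and the half difference by [Ps s],
     where [Ps 0 = 0]. *)
  exists (a + (Th s - Th 0) + Ps s), s, (2 * y), (e + (Th s - Th 0) - Ps s).
  split; [apply Rabs_def1; lra|]. split; [rewrite Rabs_pos_eq; lra|].
  split; [apply Rabs_def1; unfold y0 in *; lra|]. split; [apply Rabs_def1; lra|].
  split; [unfold y0 in *; lra|].
  replace (Ry b) with (Ry (b + 0)) by (f_equal; ring).
  replace (Ry (- b)) with (Ry (- (b - 0))) by (f_equal; ring).
  replace (Rx (- c)) with (Rx (- (2 * y0))) by (f_equal; unfold y0; field).
  rewrite !quat_XYXYX, cos_0, sin_0, !Rmult_0_r.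
  rewrite <- P1c, <- P1s, <- P2c, <- P2s, <- P0c, <- P0s. fold rho.
  set (al := (a + e) / 2 - Th 0).
  replace ((a + (Th s - Th 0) + Ps s + (e + (Th s - Th 0) - Ps s)) / 2) with (al + Th s) by (unfold al; field).
  replace ((a + (Th s - Th 0) + Ps s - (e + (Th s - Th 0) - Ps s)) / 2) with ((a - e) / 2 + Ps s) by field.
  replace ((a + e) / 2) with (al + Th 0) by (unfold al; field).
  assert (I1 : forall t, cos t * cos (al + t) + sin t * sin (al + t) = cos al).
  { intros t. replace al with (al + t - t) at 3 by ring. rewrite cos_minus. ring. }
  assert (I2 : forall t, cos t * sin (al + t) - sin t * cos (al + t) = sin al).
  { intros t. replace al with (al + t - t) at 3 by ring. rewrite sin_minus. ring. }
  set (be := (a - e) / 2).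
  assert (I3 : cos (Ps s) * cos (be + Ps s) + sin (Ps s) * sin (be + Ps s) = cos be).
  { replace be with (be + Ps s - Ps s) at 3 by ring. rewrite cos_minus. ring. }
  assert (I4 : cos (Ps s) * sin (be + Ps s) - sin (Ps s) * cos (be + Ps s) = sin be).
  { replace be with (be + Ps s - Ps s) at 3 by ring. rewrite sin_minus. ring. }
  f_equal.
  - transitivity (r0 * cos al); [rewrite <- (I1 (Th s)) | rewrite <- (I1 (Th 0))]; ring.
  - transitivity (r0 * sin al); [rewrite <- (I2 (Th s)) | rewrite <- (I2 (Th 0))]; ring.
  - rewrite <- I4. ring.
  - rewrite <- I3. ring.
Qed.

(** * Five-letter minimizers *)

Definition rot90 : sym := (true, (true, false)).
Lemma conj_rot90_Rx t : conjg rot90 (Rx t) = Ry t.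
Proof. mring. Qed.
Lemma conj_rot90_Ry t : conjg rot90 (Ry t) = Rx (- t).
Proof. apply mat_ext; simpl; trig; ring. Qed.

Section Five.
Variables (A : mat) (p q : R).
Hypotheses (Hp : 0 < p) (Hq : 0 < q).

(** Stationarity in the times makes both [Y]-letters full arcs with the same third coordinate [z],
    so [d = b]. The deformation then keeps the total [Y]-time and saves [X]-time; [eta] keeps it
    inside the ranges of the family. *)
Lemma five_interior a b c d e (M := (Rx a * (Ry b * (Rx (- c) * (Ry (- d) * Rx e))))%M) :
  0 < a < 2 * PI -> 0 < b < PI -> 0 < c < PI -> 0 < d < PI -> 0 < e < PI ->
  ~ lower_bound (cls p q) A M (p * a + q * b + p * c + q * d + p * e).
Proof.
  intros Ha Hb Hc Hd He Hmin. pose proof PI_RGT_0 as HPI.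
  assert (H1 : covec A KX (Rx a) (Ry b * (Rx (- c) * (Ry (- d) * Rx e)))%M = p).
  { apply Rle_antisym.
    - apply (insert_Rx _ _ _ _ Hmin _ _ p (2 * PI - a)); [reflexivity|lra|].
      intros t Ht. apply ex_cost with (p * (a + t) + q * b + p * c + q * d + p * e); [|lra].
      eapply cls_eq; [apply (cls_XYXYX p q (a + t) b c d e); lra|weq|reflexivity].
    - rewrite <- (Ropp_involutive p).
      apply (insert_Rx_opp _ _ _ _ Hmin _ _ (- p) a); [reflexivity|lra|].
      intros t Ht. apply ex_cost with (p * (a - t) + q * b + p * c + q * d + p * e); [|lra].
      eapply cls_eq; [apply (cls_XYXYX p q (a - t) b c d e); lra|weq|reflexivity]. }
  assert (H2 : covec A KY (Rx a) (Ry b * (Rx (- c) * (Ry (- d) * Rx e)))%M = q).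
  { apply Rle_antisym.
    - apply (insert_Ry _ _ _ _ Hmin _ _ q (PI - b)); [reflexivity|lra|].
      intros t Ht. apply ex_cost with (p * a + q * (b + t) + p * c + q * d + p * e); [|lra].
      eapply cls_eq; [apply (cls_XYXYX p q a (b + t) c d e); lra|weq|reflexivity].
    - rewrite <- (Ropp_involutive q).
      apply (insert_Ry_opp _ _ _ _ Hmin _ _ (- q) b); [reflexivity|lra|].
      intros t Ht. apply ex_cost with (p * a + q * (b - t) + p * c + q * d + p * e); [|lra].
      eapply cls_eq; [apply (cls_XYXYX p q a (b - t) c d e); lra|weq|reflexivity]. }
  set (u := (Rx a * Ry b)%M).
  assert (H3 : covec A KX u (Rx (- c) * (Ry (- d) * Rx e))%M = - p).
  { apply Rle_antisym.
    - apply (insert_Rx _ _ _ _ Hmin _ _ (- p) c); [unfold u, M; weq|lra|].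
      intros t Ht. apply ex_cost with (p * a + q * b + p * (c - t) + q * d + p * e); [|lra].
      eapply cls_eq; [apply (cls_XYXYX p q a b (c - t) d e); lra|unfold u; weq|reflexivity].
    - apply (insert_Rx_opp _ _ _ _ Hmin _ _ p (PI - c)); [unfold u, M; weq|lra|].
      intros t Ht. apply ex_cost with (p * a + q * b + p * (c + t) + q * d + p * e); [|lra].
      eapply cls_eq; [apply (cls_XYXYX p q a b (c + t) d e); lra|unfold u; weq|reflexivity]. }
  assert (H4 : covec A KY (u * Rx (- c))%M (Ry (- d) * Rx e)%M = - q).
  { apply Rle_antisym.
    - apply (insert_Ry _ _ _ _ Hmin _ _ (- q) d); [unfold u, M; weq|lra|].
      intros t Ht. apply ex_cost with (p * a + q * b + p * c + q * (d - t) + p * e); [|lra].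
      eapply cls_eq; [apply (cls_XYXYX p q a b c (d - t) e); lra|unfold u; weq|reflexivity].
    - apply (insert_Ry_opp _ _ _ _ Hmin _ _ q (PI - d)); [unfold u, M; weq|lra|].
      intros t Ht. apply ex_cost with (p * a + q * b + p * c + q * (d + t) + p * e); [|lra].
      eapply cls_eq; [apply (cls_XYXYX p q a b c (d + t) e); lra|unfold u; weq|reflexivity]. }
  assert (H5 : covec A KX (u * Rx (- c) * Ry (- d))%M (Rx e) = p).
  { apply Rle_antisym.
    - apply (insert_Rx _ _ _ _ Hmin _ _ p (PI - e)); [unfold u, M; weq|lra|].
      intros t Ht. apply ex_cost with (p * a + q * b + p * c + q * d + p * (e + t)); [|lra].
      eapply cls_eq; [apply (cls_XYXYX p q a b c d (e + t)); lra|unfold u; weq|reflexivity].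
    - rewrite <- (Ropp_involutive p).
      apply (insert_Rx_opp _ _ _ _ Hmin _ _ (- p) e); [unfold u, M; weq|lra|].
      intros t Ht. apply ex_cost with (p * a + q * b + p * c + q * d + p * (e - t)); [|lra].
      eapply cls_eq; [apply (cls_XYXYX p q a b c d (e - t)); lra|unfold u; weq|reflexivity]. }
  destruct (four_covector A p q Hp Hq a b c (Ry (- d) * Rx e)%M)
    as (z & Hz & Hzb & Hzc & Hz1 & HX3 & HZ3); trivial.
  fold u in HX3, HZ3.
  rewrite covec_Ry_X, HX3, HZ3, cos_neg, sin_neg in H5.
  assert (Hzd : z * sin d = p * (1 + cos d)) by lra.
  assert (d = b).
  { apply Rle_antisym.
    - apply (half_angle_le z p d b); trivial; [now apply half_angle_eq|lra].
    - apply (half_angle_le z p b d); trivial; [now apply half_angle_eq|lra]. }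
  subst d.
  set (eta := Rmin (Rmin (Rmin a (2 * PI - a)) (Rmin b (PI - b))) (Rmin (Rmin c (PI - c)) (Rmin e (PI - e)))).
  assert (Heta : 0 < eta) by (unfold eta; repeat apply Rmin_pos; lra).
  assert (Hl : eta <= a /\ eta <= 2 * PI - a /\ eta <= b /\ eta <= PI - b /\
               eta <= c /\ eta <= PI - c /\ eta <= e /\ eta <= PI - e)
    by (unfold eta; repeat split; rmin).
  clearbody eta.
  destruct (shorten_XYXYX a b c e eta Hb Hc Heta) as (a' & s & c' & e' & Ka & Ks & Kc & Ke & Kl & KM).
  apply Rabs_lt_between in Ka, Ks, Kc, Ke.
  assert (L := Hmin _ _ (cls_XYXYX p q a' (b + s) c' (b - s) e' ltac:(lra) ltac:(lra) ltac:(lra) ltac:(lra) ltac:(lra))).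
  rewrite KM in L. unfold M in L.
  assert (p * (a' + c' + e') < p * (a + c + e)) by (apply Rmult_lt_compat_l; assumption).
  lra.
Qed.

Lemma five_letters a b c d e (M := (Rx a * (Ry b * (Rx (- c) * (Ry (- d) * Rx e))))%M) :
  0 < a <= 2 * PI -> 0 < b <= PI -> 0 < c <= PI -> 0 < d <= PI -> 0 < e <= PI ->
  minimizer (cls p q) A M (p * a + q * b + p * c + q * d + p * e) -> good_ex A p q.
Proof.
  intros Ha Hb Hc Hd He [HM Hmin]. pose proof PI_RGT_0 as HPI.
  assert (Hpa := Rmult_lt_0_compat p a Hp ltac:(lra)).
  assert (Hqb := Rmult_lt_0_compat q b Hq ltac:(lra)).
  assert (Hpc := Rmult_lt_0_compat p c Hp ltac:(lra)).
  assert (Hqd := Rmult_lt_0_compat q d Hq ltac:(lra)).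
  assert (Hpe := Rmult_lt_0_compat p e Hp ltac:(lra)).
  assert (HpPI := Rmult_lt_0_compat p PI Hp ltac:(lra)).
  assert (Hb' : b < PI).
  { destruct (proj2 Hb) as [|Eb]; [assumption|exfalso].
    assert (L := low_XYX A p q Hp Hq M _ (a + c) (PI - d) e Hmin).
    rewrite (Rabs_pos_eq e), (Rabs_pos_eq (a + c)), (Rabs_pos_eq (PI - d)) in L by lra.
    subst b. assert (p * a + q * PI + p * c + q * d + p * e <= p * (a + c) + q * (PI - d) + p * e); [|lra].
    apply L. unfold M. rewrite Ry_PI_RxA. weq. }
  assert (Hc' : c < PI).
  { destruct (proj2 Hc) as [|Ec]; [assumption|exfalso].
    assert (L := low_XYX A p q Hp Hq M _ a (b + d) (e - PI) Hmin).
    rewrite (Rabs_pos_eq a), (Rabs_pos_eq (b + d)), (Rabs_left1 (e - PI)) in L by lra.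
    subst c.
    assert (p * a + q * b + p * PI + q * d + p * e <= p * a + q * (b + d) + p * - (e - PI)); [|lra].
    apply L. unfold M. rewrite Rx_opp_PI, Rx_PI_RyA.
    rewrite <- (Rx_congr (PI + e) (e - PI)) by (right; right; ring). weq. }
  assert (Hd' : d < PI).
  { destruct (proj2 Hd) as [|Ed]; [assumption|exfalso].
    assert (L := low_XYX A p q Hp Hq M _ a (b - PI) (c + e) Hmin).
    rewrite (Rabs_pos_eq a), (Rabs_pos_eq (c + e)), (Rabs_left1 (b - PI)) in L by lra.
    subst d.
    assert (p * a + q * b + p * c + q * PI + p * e <= p * a + q * - (b - PI) + p * (c + e)); [|lra].
    apply L. unfold M. rewrite Ry_opp_PI, <- Ry_PI_RxA.
    rewrite <- (Ry_congr (b + PI) (b - PI)) by (right; right; ring). weq. }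
  assert (Ha' : a < 2 * PI).
  { destruct (proj2 Ha) as [|Ea]; [assumption|exfalso].
    assert (HC : cls p q M (q * b + p * c + q * d + p * e)).
    { eapply cls_eq; [apply (cls_sym rot90); apply (cls_XYXYX (fstc rot90 p q) (sndc rot90 p q) b c d e 0); lra| |].
      - unfold M. rewrite !conj_mul, !conj_rot90_Rx, !conj_rot90_Ry, Ea, Rx_2PI_1, Ropp_involutive. weq.
      - unfold fstc, sndc; simpl. ring. }
    specialize (Hmin _ _ HC). lra. }
  destruct (proj2 He) as [He'|Ee].
  { exfalso. apply (five_interior a b c d e); trivial; lra. }
  (* The last letter [Rx PI] moves to the front and reverses both [Y]-letters on its way. If
     [a <= PI], this is a four-letter word up to a reflection of [Y]; otherwise wrapping [a + PI] to
     [a - PI] makes it cheaper. *)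
  assert (EM : M = (Rx (a + PI) * (Ry (- b) * (Rx (- c) * Ry d)))%M).
  { unfold M. rewrite Ee. rewrite <- (Ropp_involutive d) at 2.
    replace (Ry (- d) * Rx PI)%M with (Rx PI * Ry (- - d))%M
      by (rewrite Rx_PI_Ry; repeat f_equal; ring).
    rewrite (Rx_addA (- c) PI), (Rplus_comm (- c)), <- (Rx_addA PI).
    rewrite <- (Ropp_involutive b) at 1. rewrite <- Rx_PI_RyA. weq. }
  destruct (Rle_or_lt a PI) as [Hle|Hgt].
  - apply (good_ex_conj flipy). unfold fstc, sndc; simpl fst; cbv iota.
    assert (Hm : minimizer (cls p q) (conjg (syminv flipy) A)
       (Rx (a + PI) * (Ry b * (Rx (- c) * Ry (- d))))%M (p * (a + PI) + q * b + p * c + q * d)).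
    { apply (minimizer_conj _ cls_sym flipy p q).
      eapply minimizer_eq; [split; [exact HM|exact Hmin]| |].
      - rewrite EM, !conj_mul, !conj_flipy_Rx, !conj_flipy_Ry, Ropp_involutive. reflexivity.
      - rewrite Ee. ring. }
    eexists _, _; split; [exact Hm|]. apply four_letters; trivial; lra.
  - exfalso.
    assert (HC : cls p q M (p * (a - PI) + q * b + p * c + q * d + p * 0)).
    { eapply cls_eq; [apply (cls_XYXYX' p q (a - PI) b c d 0); lra| |reflexivity].
      rewrite EM, (Rx_congr (a + PI) (a - PI)) by (right; right; ring). weq. }
    specialize (Hmin _ _ HC). lra.
Qed.

Lemma base5_good a b c d e (M := (Rx a * (Ry b * (Rx (- c) * (Ry (- d) * Rx e))))%M) :
  0 <= a <= 2 * PI -> 0 <= b <= PI -> 0 <= c <= PI -> 0 <= d <= PI -> 0 <= e <= PI ->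
  minimizer (cls p q) A M (p * a + q * b + p * c + q * d + p * e) -> good_ex A p q.
Proof.
  intros Ha Hb Hc Hd He H. pose proof PI_RGT_0 as HPI.
  assert (Habs : forall k x y, 0 < k -> 0 <= x -> 0 <= y -> k * Rabs (x - y) <= k * (x + y)).
  { intros k x y Hk Hx Hy. apply Rmult_le_compat_l; [lra|]. unfold Rabs; destruct Rcase_abs; lra. }
  destruct (proj1 Hb) as [Hb0|<-].
  2: { eapply (three_letters A p q (a - c) (- d) e _ Hp Hq);
         [eapply minimizer_eq; [exact H|unfold M; weq|reflexivity]|].
       rewrite Rabs_Ropp, (Rabs_pos_eq d), (Rabs_pos_eq e) by lra.
       specialize (Habs p a c Hp). lra. }
  destruct (proj1 Hc) as [Hc0|<-].
  2: { eapply (three_letters A p q a (b - d) e _ Hp Hq);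
         [eapply minimizer_eq; [exact H|unfold M; rewrite Ropp_0; weq|reflexivity]|].
       rewrite (Rabs_pos_eq a), (Rabs_pos_eq e) by lra.
       specialize (Habs q b d Hq). lra. }
  destruct (proj1 Hd) as [Hd0|<-].
  2: { eapply (three_letters A p q a b (e - c) _ Hp Hq);
         [eapply minimizer_eq; [exact H|unfold M; rewrite Ropp_0; weq|reflexivity]|].
       rewrite (Rabs_pos_eq a), (Rabs_pos_eq b) by lra.
       specialize (Habs p e c Hp). lra. }
  destruct (proj1 Ha) as [Ha0|<-]; destruct (proj1 He) as [He0|<-].
  - apply (five_letters a b c d e); trivial; lra.
  - assert (H' : minimizer (cls p q) A (Rx a * (Ry b * (Rx (- c) * Ry (- d))))%M (p * a + q * b + p * c + q * d)).
    { eapply minimizer_eq; [exact H|unfold M; weq|ring]. }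
    eexists _, _; split; [exact H'|]. apply four_letters; trivial; lra.
  - apply (good_ex_conj rot90). unfold fstc, sndc; simpl fst; cbv iota.
    assert (Hm : minimizer (cls q p) (conjg (syminv rot90) A)
       (Rx b * (Ry c * (Rx (- d) * Ry (- e))))%M (q * b + p * c + q * d + p * e)).
    { apply (minimizer_conj _ cls_sym rot90 p q).
      eapply minimizer_eq; [exact H| |ring].
      unfold M. rewrite !conj_mul, !conj_rot90_Rx, !conj_rot90_Ry, Ropp_involutive. weq. }
    eexists _, _; split; [exact Hm|]. apply four_letters; trivial; lra.
  - apply (good_ex_conj swp). unfold fstc, sndc; simpl fst; cbv iota.
    apply (three_letters _ q p b (- c) (- d) (p * 0 + q * b + p * c + q * d + p * 0) Hq Hp).
    + apply (minimizer_conj _ cls_sym swp p q).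
      eapply minimizer_eq; [exact H| |ring].
      unfold M. rewrite !conj_mul, !conj_swp_Rx, !conj_swp_Ry. weq.
    + rewrite !Rabs_Ropp, (Rabs_pos_eq b), (Rabs_pos_eq c), (Rabs_pos_eq d) by lra. lra.
Qed.
End Five.

(** * Minimizers with an oblique letter *)

Lemma mderive_Exy_angle ph : mderive (fun t => Exy t ph) 0 (Exy 0 ph * (cos ph *: KX + sin ph *: KY))%M.
Proof.
  assert (H : mderive (fun t => Exy t ph) 0 (Rz ph * (Rx 0 * KX * Rz (- ph)))%M).
  { unfold Exy. apply mderive_mul_const_l, mderive_mul_const_r, mderive_Rx. }
  replace (Exy 0 ph * (cos ph *: KX + sin ph *: KY))%M with (Rz ph * (Rx 0 * KX * Rz (- ph)))%M; [exact H|].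
  rewrite Exy_0_l, Rx_0, !mmul_1_l.
  apply mat_ext; simpl; rewrite ?cos_neg, ?sin_neg; ring.
Qed.

Lemma covec_combine A a b K1 K2 u v : covec A (a *: K1 + b *: K2)%M u v = a * covec A K1 u v + b * covec A K2 u v.
Proof.
  unfold covec. rewrite mmul_add_l, mmul_add_r, !mmul_scale_l, !mmul_scale_r, ip_add_r, !ip_scale_r. ring.
Qed.

(** [mu] is the planar component of the covector perpendicular to the axis; the letter turns the
    pair formed by [mu] and the third coordinate by the angle [th]. *)
Lemma covec_Exy_Y A u v th ph (X := covec A KX u (Exy th ph * v)%M) (Y := covec A KY u (Exy th ph * v)%M)
    (Z := covec A KZ u (Exy th ph * v)%M) (mu := cos ph * Y - sin ph * X) :
  cos ph * covec A KY (u * Exy th ph)%M v - sin ph * covec A KX (u * Exy th ph)%M v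
    = cos th * mu + sin th * Z /\
  covec A KZ (u * Exy th ph)%M v = cos th * Z - sin th * mu.
Proof.
  assert (E : (u * Exy th ph = u * Rz ph * Rx th * Rz (- ph))%M) by (unfold Exy; rewrite !mmul_assoc; reflexivity).
  assert (E' : (Exy th ph * v = Rz ph * (Rx th * (Rz (- ph) * v)))%M) by (unfold Exy; rewrite !mmul_assoc; reflexivity).
  unfold mu, X, Y, Z. rewrite E, E'.
  rewrite !covec_Rz_X, !covec_Rz_Y, !covec_Rz_Z, !covec_Rx_X, !covec_Rx_Y, !covec_Rx_Z, !covec_Rz_X, !covec_Rz_Y, !covec_Rz_Z, cos_neg, sin_neg.
  set (x := covec A KX u _). set (y := covec A KY u _). set (z := covec A KZ u _).
  pose proof (sin2_cos2 ph) as H. unfold Rsqr in H.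
  split; [|ring].
  match goal with |- ?l = ?r => transitivity ((sin ph * sin ph + cos ph * cos ph) * r) end; [ring|rewrite H; ring].
Qed.

(** The perpendicular component [mu] is the same at both ends. Combined with stationarity in the
    axis this gives [mu * (th / 2 * cos (th / 2) - sin (th / 2)) = 0], and the second factor is
    negative. So [mu = 0]: the axis points along [(p, q)], and the third coordinate vanishes. *)
Lemma arc_E A p q th ph u v : 0 < th < 2 * PI ->
  covec A KX u (Exy th ph * v)%M = p -> covec A KY u (Exy th ph * v)%M = q ->
  covec A KX (u * Exy th ph)%M v = p -> covec A KY (u * Exy th ph)%M v = q ->
  th * (q * cos ph - p * sin ph) + (covec A KZ (u * Exy th ph)%M v - covec A KZ u (Exy th ph * v)%M) = 0 ->
  covec A KZ (u * Exy th ph)%M v = 0 /\ p * sin ph = q * cos ph.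
Proof.
  intros Hth H1 H2 H3 H4 H5.
  destruct (covec_Exy_Y A u v th ph) as [E1 E2].
  rewrite H1, H2, H3, H4 in E1. rewrite H1, H2 in E2.
  set (z1 := covec A KZ u (Exy th ph * v)%M) in *. set (z2 := covec A KZ (u * Exy th ph)%M v) in *.
  set (mu := cos ph * q - sin ph * p) in *.
  replace (q * cos ph - p * sin ph) with mu in H5 by (unfold mu; ring).
  assert (Hx := x_cos_lt_sin (th / 2) ltac:(lra)).
  assert (Hs : 0 < sin (th / 2)) by (apply sin_gt_0; lra).
  rewrite (cos_half' th), (sin_half th) in *.
  pose proof (sin2_cos2 (th / 2)) as Hsq. unfold Rsqr in Hsq.
  set (s := sin (th / 2)) in *. set (x := cos (th / 2)) in *.
  assert (Ez : z1 * x = mu * s).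
  { apply Rmult_eq_reg_l with (2 * s); [|lra]. lra. }
  assert (E5 : th * mu = 2 * s * (z1 * s + x * mu)) by (rewrite E2 in H5; lra).
  assert (E6 : mu * (th / 2 * x - s) = 0).
  { assert (th * mu * x = 2 * s * mu).
    { rewrite E5. replace (2 * s * (z1 * s + x * mu) * x) with (2 * s * (s * (z1 * x) + x * x * mu)) by ring.
      rewrite Ez. replace (s * (mu * s) + x * x * mu) with (mu * (s * s + x * x)) by ring.
      rewrite Hsq. ring. }
    lra. }
  apply Rmult_integral in E6. destruct E6 as [Emu|]; [|lra].
  rewrite Emu in *.
  assert (Ez1 : z1 = 0).
  { assert (0 = 2 * s * (z1 * s)) by lra.
    destruct (Rmult_integral _ _ (eq_sym H)) as [|Hz]; [lra|].
    destruct (Rmult_integral _ _ Hz); lra. }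
  split; [rewrite E2, Ez1; ring|unfold mu in Emu; lra].
Qed.

Definition lastm (k : bool) (b : R) : mat := if k then Ry b else Rx b.
Definition lastc (k : bool) (p q : R) : R := if k then q else p.

Section ELetter.
Variables (A : mat) (p q : R).
Hypotheses (Hp : 0 < p) (Hq : 0 < q).

Lemma cls_XE k a th ph b : 0 <= a <= 2 * PI -> 0 <= th <= 2 * PI -> 0 <= ph <= PI / 2 -> 0 <= b <= 2 * PI ->
  cls p q (Rx a * (Exy th ph * lastm k b))%M (p * a + th * (p * cos ph + q * sin ph) + lastc k p q * b).
Proof. destruct k; [apply cls_XEY|apply cls_XEX]. Qed.
Lemma cls_YE k a th ph b : 0 <= a <= 2 * PI -> 0 <= th <= 2 * PI -> 0 <= ph <= PI / 2 -> 0 <= b <= 2 * PI ->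
  cls p q (Ry a * (Exy th ph * lastm k b))%M (q * a + th * (p * cos ph + q * sin ph) + lastc k p q * b).
Proof. destruct k; [apply cls_YEY|apply cls_YEX]. Qed.

Lemma lastm_0 k : lastm k 0 = mid3.
Proof. destruct k; [apply Ry_0|apply Rx_0]. Qed.
Lemma lastm_2PI k : lastm k (2 * PI) = mid3.
Proof. destruct k; [apply Ry_2PI_1|apply Rx_2PI_1]. Qed.

(** Stationarity in [th] gives [cos ph X + sin ph Y = w] for the planar covector [(X, Y)] at both
    ends of the oblique letter. With the conditions from neighbouring or inserted letters this
    forces the corner [(p, q)], and [arc_E] applies. As the third coordinate is then [0], the last
    letter cannot move the covector out of the box. *)
Lemma E_letter k a th ph b (M := (Rx a * (Exy th ph * lastm k b))%M)
    (c := p * a + th * (p * cos ph + q * sin ph) + lastc k p q * b) :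
  0 <= a <= 2 * PI -> 0 < th <= 2 * PI -> 0 < ph < PI / 2 -> 0 <= b <= 2 * PI ->
  minimizer (cls p q) A M c -> good A p q M c.
Proof.
  intros Ha Hth Hph Hb [HM Hmin]. pose proof PI_RGT_0 as HPI.
  assert (Hcp : 0 < cos ph) by (apply cos_gt_0; lra).
  assert (Hsp : 0 < sin ph) by (apply sin_gt_0; lra).
  set (w := p * cos ph + q * sin ph) in *.
  assert (Hw : 0 < w).
  { assert (0 < p * cos ph) by now apply Rmult_lt_0_compat.
    assert (0 < q * sin ph) by now apply Rmult_lt_0_compat. unfold w; lra. }
  assert (Hlc : 0 < lastc k p q) by (destruct k; assumption).
  assert (Hth' : th < 2 * PI).
  { destruct (proj2 Hth) as [|Eth]; [assumption|exfalso].
    assert (HC : cls p q M (p * a + 0 * w + lastc k p q * b)).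
    { eapply cls_eq; [apply (cls_XE k a 0 ph b); lra| |reflexivity].
      unfold M. rewrite Eth, Exy_2PI, Exy_0_l. reflexivity. }
    specialize (Hmin _ _ HC). unfold c in Hmin.
    assert (0 < th * w) by (apply Rmult_lt_0_compat; lra). lra. }
  assert (Ha' : a < 2 * PI).
  { destruct (proj2 Ha) as [|Ea]; [assumption|exfalso].
    assert (HC : cls p q M (p * 0 + th * w + lastc k p q * b)).
    { eapply cls_eq; [apply (cls_XE k 0 th ph b); lra| |reflexivity].
      unfold M. rewrite Ea, Rx_2PI_1, Rx_0. reflexivity. }
    specialize (Hmin _ _ HC). unfold c in Hmin.
    assert (0 < p * a) by (apply Rmult_lt_0_compat; lra). lra. }
  assert (Hb' : b < 2 * PI).
  { destruct (proj2 Hb) as [|Eb]; [assumption|exfalso].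
    assert (HC : cls p q M (p * a + th * w + lastc k p q * 0)).
    { eapply cls_eq; [apply (cls_XE k a th ph 0); lra| |reflexivity].
      unfold M. rewrite Eb, lastm_2PI, lastm_0. reflexivity. }
    specialize (Hmin _ _ HC). unfold c in Hmin.
    assert (0 < lastc k p q * b) by (apply Rmult_lt_0_compat; lra). lra. }
  set (E := Exy th ph). set (v := lastm k b).
  assert (Hn : cos ph * covec A KX (Rx a) (E * v)%M + sin ph * covec A KY (Rx a) (E * v)%M = w /\
               cos ph * covec A KX (Rx a * E)%M v + sin ph * covec A KY (Rx a * E)%M v = w).
  { rewrite <- !covec_combine.
    assert (Hgen : forall u v', (u * v')%M = M ->
      (forall e, 0 < th + e < 2 * PI -> (u * (Exy e ph * v'))%M = (Rx a * (Exy (th + e) ph * lastm k b))%M) ->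
      covec A (cos ph *: KX + sin ph *: KY)%M u v' = w).
    { intros u v' Huv He. apply Rle_antisym.
      - apply (insert_pos _ _ _ _ Hmin (fun t => Exy t ph) _ u v' w (2 * PI - th));
          [apply mderive_Exy_angle|apply Exy_0_l|exact Huv|lra|].
        intros e Hee. apply ex_cost with (p * a + (th + e) * w + lastc k p q * b); [|unfold c; lra].
        rewrite He by lra. apply cls_XE; lra.
      - rewrite <- (Ropp_involutive w).
        apply (insert_neg _ _ _ _ Hmin (fun t => Exy t ph) _ u v' (- w) th);
          [apply mderive_Exy_angle|apply Exy_0_l|exact Huv|lra|].
        intros e Hee. apply ex_cost with (p * a + (th + - e) * w + lastc k p q * b); [|unfold c; lra].
        rewrite He by lra. apply cls_XE; lra. }
    split; apply Hgen; unfold M, E, v; intros; weq. }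
  destruct Hn as [Hn1 Hn2].
  assert (Hfin : forall x y, cos ph * x + sin ph * y = w -> x <= p -> y <= q -> x = p /\ y = q).
  { intros x y Hxy Hx Hy. unfold w in Hxy.
    assert (cos ph * (p - x) >= 0) by (apply Rle_ge, Rmult_le_pos; lra).
    assert (sin ph * (q - y) >= 0) by (apply Rle_ge, Rmult_le_pos; lra).
    assert (Z1 : cos ph * (p - x) = 0) by lra. assert (Z2 : sin ph * (q - y) = 0) by lra.
    apply Rmult_integral in Z1, Z2. destruct Z1, Z2; lra. }
  assert (Hs1 : covec A KX (Rx a) (E * v)%M = p /\ covec A KY (Rx a) (E * v)%M = q).
  { assert (HX1 : covec A KX (Rx a) (E * v)%M <= p).
    { apply (insert_Rx _ _ _ _ Hmin _ _ p (2 * PI - a)); [reflexivity|lra|].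
      intros e He. apply ex_cost with (p * (a + e) + th * w + lastc k p q * b); [|unfold c; lra].
      eapply cls_eq; [apply (cls_XE k (a + e) th ph b); lra|unfold E, v; weq|reflexivity]. }
    destruct (proj1 Ha) as [Ha0|Ha0].
    - assert (HX2 : p <= covec A KX (Rx a) (E * v)%M).
      { rewrite <- (Ropp_involutive p) at 1.
        apply (insert_Rx_opp _ _ _ _ Hmin _ _ (- p) a); [reflexivity|lra|].
        intros e He. apply ex_cost with (p * (a - e) + th * w + lastc k p q * b); [|unfold c; lra].
        eapply cls_eq; [apply (cls_XE k (a - e) th ph b); lra|unfold E, v; weq|reflexivity]. }
      assert (HXe : covec A KX (Rx a) (E * v)%M = p) by lra.
      split; [exact HXe|]. rewrite HXe in Hn1.
      apply Rmult_eq_reg_l with (sin ph); [|lra]. unfold w in Hn1; lra.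
    - apply Hfin; trivial.
      apply (insert_Ry _ _ _ _ Hmin _ _ q PI); [reflexivity|lra|].
      intros e He. apply ex_cost with (q * e + th * w + lastc k p q * b); [|unfold c; rewrite <- Ha0; lra].
      eapply cls_eq; [apply (cls_YE k e th ph b); lra| |reflexivity].
      unfold E, v. rewrite <- Ha0. weq. }
  assert (Hs2 : covec A KX (Rx a * E)%M v = p /\ covec A KY (Rx a * E)%M v = q).
  { destruct (proj1 Hb) as [Hb0|Hb0].
    - assert (Hup : forall e, 0 < e < 2 * PI - b -> exists c', cls p q (Rx a * E * (lastm k e * v))%M c' /\ c' <= c + lastc k p q * e).
      { intros e He. apply ex_cost with (p * a + th * w + lastc k p q * (b + e)); [|unfold c; lra].
        eapply cls_eq; [apply (cls_XE k a th ph (b + e)); lra| |reflexivity].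
        unfold E, v. destruct k; simpl; weq. }
      assert (Hdn : forall e, 0 < e < b -> exists c', cls p q (Rx a * E * (lastm k (- e) * v))%M c' /\ c' <= c + - lastc k p q * e).
      { intros e He. apply ex_cost with (p * a + th * w + lastc k p q * (b - e)); [|unfold c; lra].
        eapply cls_eq; [apply (cls_XE k a th ph (b - e)); lra| |reflexivity].
        unfold E, v. destruct k; simpl; weq. }
      assert (HuvM : (Rx a * E * v)%M = M) by (unfold M, E, v; rewrite mmul_assoc; reflexivity).
      destruct k; simpl in Hup, Hdn.
      + assert (U := insert_Ry _ _ _ _ Hmin _ _ q (2 * PI - b) HuvM ltac:(lra) Hup).
        assert (D := insert_Ry_opp _ _ _ _ Hmin _ _ (- q) b HuvM ltac:(lra) Hdn).
        assert (HYe : covec A KY (Rx a * E)%M v = q) by lra.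
        split; [|exact HYe]. rewrite HYe in Hn2.
        apply Rmult_eq_reg_l with (cos ph); [|lra]. unfold w in Hn2; lra.
      + assert (U := insert_Rx _ _ _ _ Hmin _ _ p (2 * PI - b) HuvM ltac:(lra) Hup).
        assert (D := insert_Rx_opp _ _ _ _ Hmin _ _ (- p) b HuvM ltac:(lra) Hdn).
        assert (HXe : covec A KX (Rx a * E)%M v = p) by lra.
        split; [exact HXe|]. rewrite HXe in Hn2.
        apply Rmult_eq_reg_l with (sin ph); [|lra]. unfold w in Hn2; lra.
    - assert (Ev : v = mid3) by (unfold v; rewrite <- Hb0; apply lastm_0).
      apply Hfin; trivial.
      + apply (insert_Rx _ _ _ _ Hmin _ _ p PI); [unfold M, E, v; rewrite mmul_assoc; reflexivity|lra|].
        intros e He. apply ex_cost with (p * a + th * w + p * e); [|unfold c; rewrite <- Hb0; lra].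
        eapply cls_eq; [apply (cls_XEX p q a th ph e); lra| |reflexivity].
        rewrite Ev. unfold E. weq.
      + apply (insert_Ry _ _ _ _ Hmin _ _ q PI); [unfold M, E, v; rewrite mmul_assoc; reflexivity|lra|].
        intros e He. apply ex_cost with (p * a + th * w + q * e); [|unfold c; rewrite <- Hb0; lra].
        eapply cls_eq; [apply (cls_XEY p q a th ph e); lra| |reflexivity].
        rewrite Ev. unfold E. weq. }
  destruct Hs1 as [HX1 HY1], Hs2 as [HX2 HY2].
  assert (Hphi : th * (q * cos ph - p * sin ph) + (covec A KZ (Rx a * E)%M v - covec A KZ (Rx a) (E * v)%M) = 0).
  { destruct (mderive_Exy_axis th (Rx a) v ph) as (F' & HF & HFip).
    specialize (HFip A). fold E in HFip. rewrite <- HFip.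
    assert (Hf : is_derive (fun x => p * a + th * (p * cos x + q * sin x) + lastc k p q * b) ph
       (th * (q * cos ph - p * sin ph))) by (auto_derive; trivial; ring).
    apply Rle_antisym.
    - apply (lower_bound_derive_left (cls p q) A M c _ F' ph _ _ ph Hmin HF Hf eq_refl eq_refl); [lra|].
      intros e He. eexists; split; [apply cls_XE; lra|lra].
    - apply (lower_bound_derive (cls p q) A M c _ F' ph _ _ (PI / 2 - ph) Hmin HF Hf eq_refl eq_refl); [lra|].
      intros e He. eexists; split; [apply cls_XE; lra|lra]. }
  destruct (arc_E A p q th ph (Rx a) v) as [HZ2 Hrel]; trivial; [lra|].
  fold E in HZ2.
  assert (EM : M = (Rx a * E * v)%M) by (unfold M, E, v; rewrite mmul_assoc; reflexivity).
  split.
  - rewrite EM. unfold v in *. destruct k; simpl in *; split; apply Rabs_le.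
    + rewrite covec_Ry_X, mmul_1_r, HX2, HZ2. pose proof (COS_bound b). nra.
    + rewrite covec_Ry_Y, mmul_1_r, HY2. lra.
    + rewrite covec_Rx_X, mmul_1_r, HX2. lra.
    + rewrite covec_Rx_Y, mmul_1_r, HY2, HZ2. pose proof (COS_bound b). nra.
  - intros Hg.
    assert (HE : reach p q E (th * w)).
    { eapply reach_eq; [apply (reach_Exy p q th ph); lra|reflexivity|].
      unfold w. rewrite (Rabs_pos_eq (cos ph)), (Rabs_pos_eq (sin ph)) by lra. reflexivity. }
    assert (HL : forall t, reach p q (lastm k t) (lastc k p q * Rabs t)).
    { intros t. destruct k; [apply reach_Ry|apply reach_Rx]. }
    assert (HaPI : a <= PI).
    { destruct (Rle_or_lt a PI) as [|Hgt]; [assumption|exfalso].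
      assert (L := Hg _ _ (reach_app _ _ _ _ _ _ (reach_Rx p q (a - 2 * PI)) (reach_app _ _ _ _ _ _ HE (HL b)))).
      rewrite Rx_2PI in L. fold v in L. unfold M, c in L. fold E v in L.
      rewrite (Rabs_left (a - 2 * PI)), (Rabs_pos_eq b) in L by lra.
      assert (0 < p * (a - PI)) by (apply Rmult_lt_0_compat; lra). lra. }
    assert (HbPI : b <= PI).
    { destruct (Rle_or_lt b PI) as [|Hgt]; [assumption|exfalso].
      assert (L := Hg _ _ (reach_app _ _ _ _ _ _ (reach_Rx p q a) (reach_app _ _ _ _ _ _ HE (HL (b - 2 * PI))))).
      replace (lastm k (b - 2 * PI)) with v in L by (unfold v; destruct k; simpl; [now rewrite Ry_2PI|now rewrite Rx_2PI]).
      unfold M, c in L. fold E v in L.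
      rewrite (Rabs_left (b - 2 * PI)), (Rabs_pos_eq a) in L by lra.
      assert (0 < lastc k p q * (b - PI)) by (apply Rmult_lt_0_compat; lra). lra. }
    apply symclosure_1. unfold M, c. destruct k; simpl; [apply baseqXY|apply baseqXX]; trivial; lra.
Qed.

Lemma baseE_good k a th ph b :
  0 <= a <= 2 * PI -> 0 <= th <= 2 * PI -> 0 <= ph <= PI / 2 -> 0 <= b <= 2 * PI ->
  minimizer (cls p q) A (Rx a * (Exy th ph * lastm k b))%M
     (p * a + th * (p * cos ph + q * sin ph) + lastc k p q * b) -> good_ex A p q.
Proof.
  intros Ha Hth Hph Hb H. pose proof PI_RGT_0 as HPI.
  destruct (proj1 Hph) as [Hph0|<-].
  2: { rewrite Exy_0, cos_0, sin_0 in H. destruct k; simpl in H.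
       - eapply (three_letters A p q (a + th) b 0); trivial; [eapply minimizer_eq; [exact H|weq|reflexivity]|].
         rewrite Rabs_R0, (Rabs_pos_eq (a + th)), (Rabs_pos_eq b) by lra. lra.
       - eapply (three_letters A p q (a + th + b) 0 0); trivial; [eapply minimizer_eq; [exact H|weq|reflexivity]|].
         rewrite Rabs_R0, (Rabs_pos_eq (a + th + b)) by lra. lra. }
  destruct (proj2 Hph) as [Hph1| ->].
  2: { rewrite Exy_PI2, cos_PI2, sin_PI2 in H. destruct k; simpl in H.
       - eapply (three_letters A p q a (th + b) 0); trivial; [eapply minimizer_eq; [exact H|weq|reflexivity]|].
         rewrite Rabs_R0, (Rabs_pos_eq (th + b)), (Rabs_pos_eq a) by lra. lra.
       - eapply (three_letters A p q a th b); trivial; [eapply minimizer_eq; [exact H|weq|reflexivity]|].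
         rewrite (Rabs_pos_eq a), (Rabs_pos_eq b), (Rabs_pos_eq th) by lra. lra. }
  destruct (proj1 Hth) as [Hth0|<-].
  2: { rewrite Exy_0_l in H. destruct k; simpl in H.
       - eapply (three_letters A p q a b 0); trivial; [eapply minimizer_eq; [exact H|weq|reflexivity]|].
         rewrite Rabs_R0, (Rabs_pos_eq a), (Rabs_pos_eq b) by lra. lra.
       - eapply (three_letters A p q (a + b) 0 0); trivial; [eapply minimizer_eq; [exact H|weq|reflexivity]|].
         rewrite Rabs_R0, (Rabs_pos_eq (a + b)) by lra. lra. }
  eexists _, _; split; [exact H|]. apply E_letter; trivial; lra.
Qed.
End ELetter.

Lemma minimizer_good A p q M c : 0 < p -> 0 < q -> minimizer (cls p q) A M c -> good_ex A p q.
Proof.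
  intros Hp Hq H. destruct (proj1 H) as (g & M0 & HB & EM). subst M.
  apply (good_ex_conj g). apply (minimizer_conj _ cls_sym) in H.
  assert (Hp' := fstc_pos g p q Hp Hq). assert (Hq' := sndc_pos g p q Hp Hq).
  revert H HB Hp' Hq'. generalize (fstc g p q) (sndc g p q) (conjg (syminv g) A).
  clear. intros p q A H HB Hp Hq.
  destruct HB.
  - eapply (three_letters A p q _ _ _ _ Hp Hq H); lra.
  - eapply (base5_good A p q Hp Hq); [..|exact H]; assumption.
  - eapply (baseE_good A p q Hp Hq false); [..|exact H]; assumption.
  - eapply (baseE_good A p q Hp Hq true); [..|exact H]; assumption.
Qed.

(** * Minima of Lipschitz functions on boxes *)

Definition inbox (bs : list (R * R)) (x : list R) : Prop :=
  Forall2 (fun b t => fst b <= t <= snd b) bs x.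

Fixpoint ldist (x y : list R) : R :=
  match x, y with
  | a :: x', b :: y' => Rabs (a - b) + ldist x' y'
  | _, _ => 0
  end.

Lemma ldist_ge0 x y : 0 <= ldist x y.
Proof.
  revert y; induction x as [|a x IH]; intros [|b y]; simpl; try lra.
  pose proof (Rabs_pos (a - b)). specialize (IH y). lra.
Qed.

Lemma ldist_refl x : ldist x x = 0.
Proof. induction x as [|a x IH]; simpl; [lra|]. rewrite Rminus_diag, Rabs_R0, IH; lra. Qed.

(** Induction on the dimension: the minimum over the remaining coordinates is a Lipschitz function
    of the first one, to which the one-variable theorem applies. *)
Lemma box_min_lipschitz K bs : 0 <= K -> List.Forall (fun b => fst b <= snd b) bs -> forall f,
  (forall x y, inbox bs x -> inbox bs y -> Rabs (f x - f y) <= K * ldist x y) ->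
  exists x, inbox bs x /\ forall y, inbox bs y -> f x <= f y.
Proof.
  intros HK Hbs. induction Hbs as [|[l u] bs Hlu Hbs IH]; intros f Hf; try simpl in Hlu.
  - exists []. split; [constructor|]. intros y Hy. inversion Hy; lra.
  - assert (Hch : forall t, exists x, l <= t <= u ->
      inbox bs x /\ forall y, inbox bs y -> f (t :: x) <= f (t :: y)).
    { intros t. destruct (excluded_middle_informative (l <= t <= u)) as [Ht|Ht]; [|exists []; tauto].
      destruct (IH (fun x => f (t :: x))) as (x & Hx & Hmin).
      - intros x y Hx Hy. eapply Rle_trans; [apply Hf; constructor; simpl; assumption|].
        simpl. rewrite Rminus_diag, Rabs_R0. lra.
      - exists x. auto. }
    set (xi := fun t => proj1_sig (constructive_indefinite_description _ (Hch t))).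
    assert (Hxi : forall t, l <= t <= u -> inbox bs (xi t) /\
       forall y, inbox bs y -> f (t :: xi t) <= f (t :: y)).
    { intros t. unfold xi. apply (proj2_sig (constructive_indefinite_description _ (Hch t))). }
    (* Two-sided continuity is required at the endpoints as well; clamping extends the partial
       minimum to the line without increasing distances. *)
    set (cl := fun t => Rmax l (Rmin u t)).
    assert (Hcl : forall t, l <= cl t <= u).
    { intros t. unfold cl, Rmax, Rmin. destruct (Rle_dec u t), Rle_dec; lra. }
    assert (HclL : forall s t, Rabs (cl s - cl t) <= Rabs (s - t)).
    { intros s t. unfold cl, Rmax, Rmin, Rabs.
      destruct (Rle_dec u s), (Rle_dec u t); repeat destruct Rle_dec; repeat destruct Rcase_abs; lra. }
    set (m := fun t => f (cl t :: xi (cl t))).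
    assert (HmL1 : forall s t, m s - m t <= K * Rabs (s - t)).
    { intros s t. destruct (Hxi (cl s) (Hcl s)) as [_ H1]. destruct (Hxi (cl t) (Hcl t)) as [H2 _].
      specialize (H1 _ H2).
      assert (H3 := Hf (cl s :: xi (cl t)) (cl t :: xi (cl t))).
      simpl in H3. rewrite ldist_refl, Rplus_0_r in H3.
      specialize (H3 ltac:(constructor; simpl; [apply Hcl|assumption]) ltac:(constructor; simpl; [apply Hcl|assumption])).
      apply Rabs_le_between in H3.
      assert (K * Rabs (cl s - cl t) <= K * Rabs (s - t)) by (apply Rmult_le_compat_l; auto).
      unfold m. lra. }
    assert (Hcont : forall t, l <= t <= u -> continuity_pt m t).
    { intros t _ eps Heps. exists (eps / (K + 1)). split.
      - apply Rdiv_lt_0_compat; lra.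
      - intros s [_ Hs]. simpl in *. unfold R_dist in *.
        assert (HmL : Rabs (m s - m t) <= K * Rabs (s - t)).
        { apply Rabs_le. split; [|apply HmL1]. specialize (HmL1 t s).
          rewrite Rabs_minus_sym in HmL1. lra. }
        apply Rle_lt_trans with (1 := HmL).
        apply (Rmult_lt_compat_r (K + 1)) in Hs; [|lra].
        unfold Rdiv in Hs. rewrite Rmult_assoc, Rinv_l in Hs by lra.
        pose proof (Rabs_pos (s - t)). nra. }
    destruct (continuity_ab_min m l u Hlu Hcont) as (t & Hmin & Ht).
    exists (cl t :: xi (cl t)). split.
    + constructor; simpl; [apply Hcl|apply Hxi, Hcl].
    + intros y Hy. inversion Hy as [|? b ? y' Hb Hy' E1 E2]; subst. simpl in Hb.
      specialize (Hmin b Hb). fold (m t). apply Rle_trans with (1 := Hmin).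
      unfold m. assert (Ecl : cl b = b).
      { unfold cl, Rmax, Rmin. destruct (Rle_dec u b), Rle_dec; lra. }
      rewrite Ecl. now apply Hxi.
Qed.

(** The bound is carried along with the Lipschitz constant because the product rule needs it. *)
Definition blip (bs : list (R * R)) (f : list R -> R) : Prop :=
  exists K B, 0 <= K /\ 0 <= B /\ forall x y, inbox bs x -> inbox bs y ->
    Rabs (f x) <= B /\ Rabs (f x - f y) <= K * ldist x y.

Lemma box_min bs f : List.Forall (fun b => fst b <= snd b) bs -> blip bs f ->
  exists x, inbox bs x /\ forall y, inbox bs y -> f x <= f y.
Proof.
  intros Hbs (K & B & HK & _ & H). apply (box_min_lipschitz K); trivial.
  intros x y Hx Hy. now apply H.
Qed.

Section Blip.
Variable bs : list (R * R).

Lemma blip_const c : blip bs (fun _ => c).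
Proof.
  exists 0, (Rabs c). repeat split; try lra; [apply Rabs_pos|].
  rewrite Rminus_diag, Rabs_R0. lra.
Qed.

Lemma inbox_bound x : inbox bs x ->
  forall i, Rabs (nth i x 0) <= fold_right (fun b s => Rabs (fst b) + Rabs (snd b) + s) 0 bs.
Proof.
  intros H. induction H as [|[l u] t bs' x' Hb Hx IH]; simpl in *.
  - intros [|i]; rewrite Rabs_R0; lra.
  - intros [|i]; simpl.
    + specialize (IH (length x')). pose proof (Rabs_pos (nth (length x') x' 0)).
      unfold Rabs at 1 2 3. repeat destruct Rcase_abs; lra.
    + specialize (IH i). pose proof (Rabs_pos l). pose proof (Rabs_pos u). lra.
Qed.

Lemma blip_nth i : blip bs (fun x => nth i x 0).
Proof.
  exists 1, (fold_right (fun b s => Rabs (fst b) + Rabs (snd b) + s) 0 bs).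
  split; [lra|]. split.
  { induction bs as [|b l IH]; simpl; [lra|].
    pose proof (Rabs_pos (fst b)). pose proof (Rabs_pos (snd b)). lra. }
  intros x y Hx Hy. split; [now apply inbox_bound|].
  rewrite Rmult_1_l. revert y Hy i.
  induction Hx as [|b t bs' x' Hb Hx IH]; intros y Hy i; inversion Hy; subst.
  - rewrite Rminus_diag, Rabs_R0. simpl; lra.
  - destruct i as [|i]; simpl; [pose proof (ldist_ge0 x' l'); lra|].
    specialize (IH _ H3 i). pose proof (Rabs_pos (t - y0)). lra.
Qed.

Lemma blip_plus f g : blip bs f -> blip bs g -> blip bs (fun x => f x + g x).
Proof.
  intros (K & B & HK & HB & H) (K' & B' & HK' & HB' & H').
  exists (K + K'), (B + B'). split; [lra|]. split; [lra|]. intros x y Hx Hy.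
  destruct (H x y Hx Hy) as [H1 H2], (H' x y Hx Hy) as [H3 H4]. split.
  - eapply Rle_trans; [apply Rabs_triang|lra].
  - replace (f x + g x - (f y + g y)) with ((f x - f y) + (g x - g y)) by ring.
    eapply Rle_trans; [apply Rabs_triang|lra].
Qed.

Lemma blip_mult f g : blip bs f -> blip bs g -> blip bs (fun x => f x * g x).
Proof.
  intros (K & B & HK & HB & H) (K' & B' & HK' & HB' & H').
  exists (K * B' + B * K'), (B * B'). split; [nra|]. split; [nra|]. intros x y Hx Hy.
  destruct (H x y Hx Hy) as [H1 H2], (H' x y Hx Hy) as [H3 H4]. destruct (H y y Hy Hy) as [H5 _]. split.
  - rewrite Rabs_mult. apply Rmult_le_compat; trivial; apply Rabs_pos.
  - replace (f x * g x - f y * g y) with ((f x - f y) * g x + f y * (g x - g y)) by ring.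
    eapply Rle_trans; [apply Rabs_triang|]. rewrite !Rabs_mult.
    pose proof (ldist_ge0 x y).
    assert (Rabs (f x - f y) * Rabs (g x) <= K * ldist x y * B')
      by (apply Rmult_le_compat; trivial; apply Rabs_pos).
    assert (Rabs (f y) * Rabs (g x - g y) <= B * (K' * ldist x y))
      by (apply Rmult_le_compat; trivial; apply Rabs_pos).
    lra.
Qed.

Lemma blip_comp (g : R -> R) f : (forall s t, Rabs (g s - g t) <= Rabs (s - t)) ->
  blip bs f -> blip bs (fun x => g (f x)).
Proof.
  intros Hg (K & B & HK & HB & H). exists K, (Rabs (g 0) + B).
  split; [lra|]. split; [pose proof (Rabs_pos (g 0)); lra|]. intros x y Hx Hy.
  destruct (H x y Hx Hy) as [H1 H2]. split.
  - replace (g (f x)) with (g 0 + (g (f x) - g 0)) by ring.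
    eapply Rle_trans; [apply Rabs_triang|]. specialize (Hg (f x) 0). rewrite Rminus_0_r in Hg. lra.
  - eapply Rle_trans; [apply Hg|exact H2].
Qed.

Lemma blip_opp f : blip bs f -> blip bs (fun x => - f x).
Proof.
  apply (blip_comp Ropp). intros s t. replace (- s - - t) with (- (s - t)) by ring. rewrite Rabs_Ropp; lra.
Qed.
Lemma blip_minus f g : blip bs f -> blip bs g -> blip bs (fun x => f x - g x).
Proof. intros Hf Hg. apply blip_plus; [exact Hf|now apply blip_opp]. Qed.
Lemma blip_abs f : blip bs f -> blip bs (fun x => Rabs (f x)).
Proof. apply (blip_comp Rabs). intros s t. apply Rabs_triang_inv2. Qed.
Lemma blip_pos f : blip bs f -> blip bs (fun x => Rmax 0 (f x)).
Proof.
  apply (blip_comp (Rmax 0)). intros s t. unfold Rmax, Rabs.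
  repeat destruct Rle_dec; repeat destruct Rcase_abs; lra.
Qed.

Lemma lipschitz_of_derive (f f' : R -> R) : (forall x, is_derive f x (f' x)) ->
  (forall x, Rabs (f' x) <= 1) -> forall s t, Rabs (f s - f t) <= Rabs (s - t).
Proof.
  intros Hf Hb.
  assert (H : forall s t, s < t -> Rabs (f s - f t) <= Rabs (s - t)).
  { intros s t Hst.
    destruct (MVT_cor2 f f' s t Hst) as (c & Hc & _); [intros; apply is_derive_Reals, Hf|].
    rewrite (Rabs_minus_sym (f s)), Hc, Rabs_mult, (Rabs_minus_sym s).
    rewrite <- (Rmult_1_l (Rabs (t - s))) at 2. apply Rmult_le_compat_r; [apply Rabs_pos|apply Hb]. }
  intros s t. destruct (Rtotal_order s t) as [Hl|[->|Hg]]; [now apply H| |].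
  - rewrite !Rminus_diag; lra.
  - rewrite Rabs_minus_sym, (Rabs_minus_sym s). now apply H.
Qed.

Lemma blip_sin f : blip bs f -> blip bs (fun x => sin (f x)).
Proof.
  apply blip_comp. apply (lipschitz_of_derive sin cos).
  - intros; auto_derive; trivial; ring.
  - intros x. apply Rabs_le. apply COS_bound.
Qed.
Lemma blip_cos f : blip bs f -> blip bs (fun x => cos (f x)).
Proof.
  apply blip_comp. apply (lipschitz_of_derive cos (fun x => - sin x)).
  - intros; auto_derive; trivial; ring.
  - intros x. rewrite Rabs_Ropp. apply Rabs_le. apply SIN_bound.
Qed.

Definition blipm (F : list R -> mat) : Prop :=
  (blip bs (fun x => m11 (F x)) /\ blip bs (fun x => m12 (F x)) /\ blip bs (fun x => m13 (F x))) /\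
  (blip bs (fun x => m21 (F x)) /\ blip bs (fun x => m22 (F x)) /\ blip bs (fun x => m23 (F x))) /\
  (blip bs (fun x => m31 (F x)) /\ blip bs (fun x => m32 (F x)) /\ blip bs (fun x => m33 (F x))).

Lemma blipm_const M : blipm (fun _ => M).
Proof. repeat apply conj; apply blip_const. Qed.
Lemma blipm_mul F G : blipm F -> blipm G -> blipm (fun x => F x * G x)%M.
Proof.
  intros ((?&?&?)&(?&?&?)&(?&?&?)) ((?&?&?)&(?&?&?)&(?&?&?)).
  unfold blipm; simpl; repeat apply conj; repeat (apply blip_plus || apply blip_mult); assumption.
Qed.
Lemma blipm_Rx f : blip bs f -> blipm (fun x => Rx (f x)).
Proof.
  intros H. unfold blipm; simpl; repeat apply conj;
  repeat (apply blip_const || apply blip_opp || apply blip_cos || apply blip_sin || assumption).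
Qed.
Lemma blipm_Ry f : blip bs f -> blipm (fun x => Ry (f x)).
Proof.
  intros H. unfold blipm; simpl; repeat apply conj;
  repeat (apply blip_const || apply blip_opp || apply blip_cos || apply blip_sin || assumption).
Qed.
Lemma blipm_Rz f : blip bs f -> blipm (fun x => Rz (f x)).
Proof.
  intros H. unfold blipm; simpl; repeat apply conj;
  repeat (apply blip_const || apply blip_opp || apply blip_cos || apply blip_sin || assumption).
Qed.
Lemma blipm_Exy f g : blip bs f -> blip bs g -> blipm (fun x => Exy (f x) (g x)).
Proof.
  intros Hf Hg. unfold Exy. repeat apply blipm_mul.
  - now apply blipm_Rz.
  - now apply blipm_Rx.
  - apply blipm_Rz. now apply blip_opp.
Qed.
Lemma blipm_conj g F : blipm F -> blipm (fun x => conjg g (F x)).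
Proof.
  intros H. unfold conjg. apply blipm_mul; [apply blipm_const|].
  apply blipm_mul; [exact H|apply blipm_const].
Qed.
Lemma blip_ip A F : blipm F -> blip bs (fun x => ip A (F x)).
Proof.
  intros ((?&?&?)&(?&?&?)&(?&?&?)). unfold ip.
  repeat (apply blip_plus || apply blip_mult); trivial; apply blip_const.
Qed.
End Blip.

Ltac blip := repeat first
  [ apply blipm_conj | apply blipm_Rx | apply blipm_Ry | apply blipm_Exy | apply blipm_mul
  | apply blip_ip | apply blip_const | apply blip_nth | apply blip_abs | apply blip_pos | apply blip_minus
  | apply blip_opp | apply blip_plus | apply blip_mult | apply blip_sin | apply blip_cos ].

Lemma finite_min {I T : Type} (S : I -> T -> Prop) (f : I -> T -> R) (l : list I) : l <> [] ->
  (forall i, exists x, S i x /\ forall y, S i y -> f i x <= f i y) ->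
  exists i x, S i x /\ forall j y, In j l -> S j y -> f i x <= f j y.
Proof.
  intros Hl H. induction l as [|i l IH]; [congruence|].
  destruct (H i) as (x & Hx & Hmin).
  destruct l as [|i' l].
  - exists i, x. split; [exact Hx|]. intros j y [<-|[]]. apply Hmin.
  - destruct IH as (i1 & x1 & Hx1 & Hmin1); [discriminate|].
    destruct (Rle_or_lt (f i x) (f i1 x1)).
    + exists i, x. split; [exact Hx|]. intros j y [<-|Hj] Hy; [now apply Hmin|].
      specialize (Hmin1 j y Hj Hy). lra.
    + exists i1, x1. split; [exact Hx1|]. intros j y [<-|Hj] Hy; [|now apply Hmin1].
      specialize (Hmin y Hy). lra.
Qed.

(** * Existence of minimizers over the class *)

Definition bools := [true; false].
Definition syms : list sym := list_prod bools (list_prod bools bools).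
Lemma in_syms g : In g syms.
Proof. dsym g; simpl; tauto. Qed.

Inductive basefam := Fam3 | Fam5 | FamXX | FamXY.
Definition basebox (f : basefam) : list (R * R) :=
  match f with
  | Fam3 => [(- (2 * PI), 2 * PI); (- (2 * PI), 2 * PI); (- (2 * PI), 2 * PI)]
  | Fam5 => [(0, 2 * PI); (0, PI); (0, PI); (0, PI); (0, PI)]
  | _ => [(0, 2 * PI); (0, 2 * PI); (0, PI / 2); (0, 2 * PI)]
  end.
Definition basemat (f : basefam) (x : list R) : mat :=
  let a := nth 0 x 0 in let b := nth 1 x 0 in let c := nth 2 x 0 in
  let d := nth 3 x 0 in let e := nth 4 x 0 in
  match f with
  | Fam3 => (Rx a * (Ry b * Rx c))%M
  | Fam5 => (Rx a * (Ry b * (Rx (- c) * (Ry (- d) * Rx e))))%M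
  | FamXX => (Rx a * (Exy b c * Rx d))%M
  | FamXY => (Rx a * (Exy b c * Ry d))%M
  end.
Definition basecost (p q : R) (f : basefam) (x : list R) : R :=
  let a := nth 0 x 0 in let b := nth 1 x 0 in let c := nth 2 x 0 in
  let d := nth 3 x 0 in let e := nth 4 x 0 in
  match f with
  | Fam3 => p * Rabs a + q * Rabs b + p * Rabs c
  | Fam5 => p * a + q * b + p * c + q * d + p * e
  | FamXX => p * a + b * (p * cos c + q * sin c) + p * d
  | FamXY => p * a + b * (p * cos c + q * sin c) + q * d
  end.

Ltac inv_inbox H := repeat (let Hx := fresh "Hx" in let H' := fresh H in
   inversion H as [|? ? ? ? Hx H']; subst; clear H; rename H' into H; simpl in Hx);
   try (inversion H; subst; clear H).

Lemma base_param p q f x : inbox (basebox f) x -> base p q (basemat f x) (basecost p q f x).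
Proof.
  destruct f; simpl; intros H; unfold inbox in H.
  all: inv_inbox H; unfold basemat, basecost; simpl; constructor; try (apply Rabs_le); assumption.
Qed.

Ltac boxin := unfold inbox; simpl; repeat (apply List.Forall2_cons; [simpl; lra|]); apply List.Forall2_nil.

Lemma base_param_inv p q M c : base p q M c ->
  exists f x, inbox (basebox f) x /\ M = basemat f x /\ c = basecost p q f x.
Proof.
  intros [a b c' Ha Hb Hc|a b c' d e|a th ph b|a th ph b]; intros.
  - apply Rabs_le_between in Ha, Hb, Hc.
    exists Fam3, [a; b; c']. split; [boxin|split; reflexivity].
  - exists Fam5, [a; b; c'; d; e]. split; [boxin|split; reflexivity].
  - exists FamXX, [a; th; ph; b]. split; [boxin|split; reflexivity].
  - exists FamXY, [a; th; ph; b]. split; [boxin|split; reflexivity].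
Qed.

Lemma minimizer_exists A p q : exists M c, minimizer (cls p q) A M c.
Proof.
  pose proof PI_RGT_0 as HPI.
  destruct (finite_min (fun i x => inbox (basebox (snd i)) x)
    (fun i x => basecost (fstc (fst i) p q) (sndc (fst i) p q) (snd i) x + ip A (conjg (fst i) (basemat (snd i) x)))
    (list_prod syms [Fam3; Fam5; FamXX; FamXY])) as ([g f] & x & Hx & Hmin); [discriminate| |].
  - intros [g f]. simpl. apply box_min.
    + destruct f; simpl; repeat (apply List.Forall_cons; [simpl; lra|]); apply List.Forall_nil.
    + destruct f; unfold basemat, basecost; simpl; blip.
  - simpl in Hx. eexists _, _. split.
    + exists g, (basemat f x). split; [now apply base_param|reflexivity].
    + intros M' c' (g' & M0 & HB & ->). apply base_param_inv in HB.
      destruct HB as (f' & x' & Hx' & -> & ->). apply (Hmin (g', f')); [|exact Hx'].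
      apply in_prod; [apply in_syms|destruct f'; simpl; tauto].
Qed.

Lemma good_exists A p q : 0 < p -> 0 < q -> good_ex A p q.
Proof.
  intros Hp Hq. destruct (minimizer_exists A p q) as (M & c & H).
  now apply (minimizer_good A p q M c).
Qed.

(** * Minimizers over the class are minimal among all words *)

Lemma mtrans_Rx t : mtrans (Rx t) = Rx (- t).
Proof. apply mat_ext; simpl; trig; ring. Qed.
Lemma mtrans_Ry t : mtrans (Ry t) = Ry (- t).
Proof. apply mat_ext; simpl; trig; ring. Qed.
Lemma mtrans_Rz t : mtrans (Rz t) = Rz (- t).
Proof. apply mat_ext; simpl; trig; ring. Qed.
Lemma mtrans_Exy t ph : mtrans (Exy t ph) = Exy (- t) ph.
Proof.
  unfold Exy. rewrite !mtrans_mul, mtrans_Rx, !mtrans_Rz, Ropp_involutive. apply mmul_assoc.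
Qed.

Definition orth (M : mat) : Prop := (mtrans M * M)%M = mid3.

Lemma orth_mul M N : orth M -> orth N -> orth (M * N)%M.
Proof.
  unfold orth. intros H1 H2.
  rewrite mtrans_mul, mmul_assoc, <- (mmul_assoc (mtrans M)), H1, mmul_1_l. exact H2.
Qed.
Lemma orth_Exy t ph : orth (Exy t ph).
Proof.
  unfold orth. rewrite mtrans_Exy, Exy_add, Rplus_opp_l. apply Exy_0_l.
Qed.
Lemma reach_orth p q M c : reach p q M c -> orth M.
Proof.
  induction 1; [unfold orth; mring|]. apply orth_mul; [assumption|apply orth_Exy].
Qed.

Lemma ip_orth_l M X Y : orth M -> ip (M * X)%M (M * Y)%M = ip X Y.
Proof.
  intros H. rewrite ip_mul_l, <- mmul_assoc, H, mmul_1_l. reflexivity.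
Qed.
Lemma ip_Exy_r A t ph : ip (A * mtrans (Exy t ph))%M (A * mtrans (Exy t ph))%M = ip A A.
Proof.
  rewrite ip_mul_r, mtransK, mmul_assoc.
  rewrite (orth_Exy t ph : (mtrans (Exy t ph) * Exy t ph)%M = mid3), mmul_1_r. reflexivity.
Qed.
Lemma ip_bound A X : Rabs (ip A X) <= (ip A A + ip X X) / 2.
Proof.
  assert (H1 : 0 <= ip (A + X)%M (A + X)%M) by (unfold ip; nra).
  assert (H2 : 0 <= ip (A + (-1) *: X)%M (A + (-1) *: X)%M) by (unfold ip; nra).
  apply Rabs_le. unfold ip in *; simpl in *. lra.
Qed.

(** Rodrigues' formula, which separates the first-order term from a remainder of size
    [1 - cos t]. *)
Lemma Exy_expand t ph (N := (cos ph *: KX + sin ph *: KY)%M) :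
  Exy t ph = (mid3 + (sin t *: N + (1 - cos t) *: (N * N)))%M.
Proof.
  pose proof (sin2_cos2 ph) as H. unfold Rsqr in H.
  assert (Hs : sin ph * sin ph = 1 - cos ph * cos ph) by lra.
  apply mat_ext; unfold N; simpl; rewrite ?cos_neg, ?sin_neg;
  ring_simplify; simpl; rewrite ?Rmult_1_r, ?Hs; try ring.
Qed.

Lemma one_minus_cos t : 0 <= 1 - cos t <= t * t / 2.
Proof.
  rewrite (cos_half' t).
  assert (H : Rabs (sin (t / 2)) <= Rabs (t / 2)).
  { assert (L := lipschitz_of_derive sin cos).
    specialize (L (fun x => ltac:(auto_derive; trivial; ring)) (fun x => Rabs_le _ _ (COS_bound x)) (t / 2) 0).
    rewrite sin_0, !Rminus_0_r in L. exact L. }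
  apply Rsqr_le_abs_1 in H. unfold Rsqr in H.
  pose proof (Rle_0_sqr (sin (t / 2))) as H0. unfold Rsqr in H0. lra.
Qed.

Section HJB.
Variables (p q : R).
Hypotheses (Hp : 0 < p) (Hq : 0 < q).
Variable ph : R.
Let w := p * Rabs (cos ph) + q * Rabs (sin ph).

(** [ip (A * mtrans (Exy d ph)) M1] evaluates [A] on [M1] followed by [Exy d ph]. A good minimizer
    [M2] of this shifted functional is compared with [M1] there, and used as a competitor under [A]
    itself. Passing from the shifted functional back to [A] multiplies [M2] by [Exy (- d) ph], whose
    first-order effect is at most [d * w] since the end covector of [M2] lies in the polar. *)
Lemma hjb_step A M c M1 c1 d : 0 <= d ->
  lower_bound (cls p q) A M c -> cls p q M1 c1 ->
  c + ip A M <= c1 + ip (A * mtrans (Exy d ph))%M M1 + (d * w + (ip A A + 2) * (d * d)).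
Proof.
  intros Hd Hlb H1. set (A' := (A * mtrans (Exy d ph))%M).
  destruct (good_exists A' p q Hp Hq) as (M2 & c2 & [HM2 Hmin] & [HX HY] & _).
  assert (L1 := Hmin _ _ H1). assert (L2 := Hlb _ _ HM2).
  set (N := (cos ph *: KX + sin ph *: KY)%M).
  assert (E : ip A M2 = ip A' (M2 * Exy (- d) ph)%M).
  { rewrite ip_mul_r. unfold A'. rewrite !mtrans_Exy, Ropp_involutive, mmul_assoc, Exy_add.
    rewrite Rplus_opp_l, Exy_0_l, mmul_1_r. reflexivity. }
  rewrite (Exy_expand (- d) ph), cos_neg, sin_neg in E. fold N in E.
  rewrite !mmul_add_r, !mmul_scale_r, mmul_1_r, !ip_add_r, !ip_scale_r in E.
  assert (HN : - ip A' (M2 * N)%M = cos ph * covec A' KX M2 mid3 + sin ph * covec A' KY M2 mid3).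
  { rewrite <- covec_combine. unfold covec. now rewrite mmul_1_r. }
  assert (HNb : Rabs (ip A' (M2 * N)%M) <= w).
  { rewrite <- Rabs_Ropp, HN. eapply Rle_trans; [apply Rabs_triang|]. rewrite !Rabs_mult. unfold w.
    pose proof (Rabs_pos (cos ph)). pose proof (Rabs_pos (sin ph)). nra. }
  assert (Hs : Rabs (sin d) <= d).
  { assert (L := lipschitz_of_derive sin cos).
    specialize (L (fun x => ltac:(auto_derive; trivial; ring)) (fun x => Rabs_le _ _ (COS_bound x)) d 0).
    rewrite sin_0, !Rminus_0_r, (Rabs_pos_eq d) in L by assumption. exact L. }
  assert (B1 : - sin d * ip A' (M2 * N)%M <= d * w).
  { eapply Rle_trans; [apply Rle_abs|]. rewrite Rabs_mult, Rabs_Ropp.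
    apply Rmult_le_compat; trivial; apply Rabs_pos. }
  (* The remainder depends on [A] only through [ip A A], because [M2] and the shift are orthogonal;
     the [2] is the squared norm of [N * N]. *)
  assert (B2 : (1 - cos d) * ip A' (M2 * (N * N))%M <= (ip A A + 2) * (d * d)).
  { destruct (one_minus_cos d) as [Hc1 Hc2].
    assert (HB := ip_bound A' (M2 * (N * N))%M).
    rewrite ip_orth_l in HB by (eapply reach_orth, cls_reach, HM2).
    unfold A' in HB at 2 3. rewrite ip_Exy_r in HB.
    assert (HNN : ip (N * N)%M (N * N)%M = 2).
    { pose proof (sin2_cos2 ph) as H. unfold Rsqr in H.
      transitivity (2 * ((sin ph * sin ph + cos ph * cos ph) * (sin ph * sin ph + cos ph * cos ph))).
      - unfold N, ip; simpl. ring.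
      - rewrite H; ring. }
    rewrite HNN in HB.
    assert (HA : 0 <= ip A A) by (unfold ip; nra).
    apply Rabs_le_between in HB.
    apply Rle_trans with ((1 - cos d) * ((ip A A + 2) / 2)).
    - apply Rmult_le_compat_l; lra.
    - assert (0 <= d * d) by nra.
      apply Rle_trans with (d * d / 2 * ((ip A A + 2) / 2)); [apply Rmult_le_compat_r; lra|]. nra. }
  lra.
Qed.

(** Each step multiplies [A] by a rotation and so preserves [ip A A]: the error constant is the same
    in all steps. *)
Lemma hjb_steps d n : 0 <= d -> forall A M c M1 c1,
  lower_bound (cls p q) A M c -> cls p q M1 c1 ->
  c + ip A M <= c1 + ip (A * mtrans (Exy (INR n * d) ph))%M M1 + INR n * (d * w + (ip A A + 2) * (d * d)).
Proof.
  intros Hd. induction n as [|n IH]; intros A M c M1 c1 Hlb H1.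
  - simpl. rewrite Rmult_0_l, Exy_0_l.
    replace (mtrans mid3) with mid3 by mring. rewrite mmul_1_r. specialize (Hlb _ _ H1). lra.
  - rewrite S_INR.
    destruct (minimizer_exists (A * mtrans (Exy d ph))%M p q) as (M2 & c2 & HM2 & Hmin2).
    assert (L := hjb_step A M c M2 c2 d Hd Hlb HM2).
    assert (L' := IH _ M2 c2 M1 c1 Hmin2 H1).
    rewrite ip_Exy_r, mmul_assoc, <- mtrans_mul, Exy_add in L'.
    replace (INR n * d + d) with ((INR n + 1) * d) in L' by ring. lra.
Qed.

Lemma hjb A M c M1 c1 th : 0 <= th ->
  lower_bound (cls p q) A M c -> cls p q M1 c1 ->
  c + ip A M <= c1 + ip (A * mtrans (Exy th ph))%M M1 + th * w.
Proof.
  intros Hth Hlb H1. apply Rnot_lt_le. intros Hlt.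
  set (gap := c + ip A M - (c1 + ip (A * mtrans (Exy th ph))%M M1 + th * w)).
  assert (Hgap : 0 < gap) by (unfold gap; lra).
  set (K := (ip A A + 2) * (th * th)).
  destruct (INR_unbounded (K / gap)) as [n Hn].
  set (m := S n).
  (* With [m] steps of length [th / m] the quadratic errors add up to [K / m], which a large [m]
     makes smaller than the supposed gap. *)
  assert (Hm : 0 < INR m) by (apply lt_0_INR; unfold m; lia).
  assert (Hmn : INR n < INR m) by (apply lt_INR; unfold m; lia).
  assert (L := hjb_steps (th / INR m) m ltac:(apply Rmult_le_pos; [lra|left; apply Rinv_0_lt_compat; lra]) A M c M1 c1 Hlb H1).
  replace (INR m * (th / INR m)) with th in L by (field; lra).
  replace (INR m * (th / INR m * w + (ip A A + 2) * (th / INR m * (th / INR m)))) with (th * w + K / INR m) in L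
    by (unfold K; field; lra).
  assert (HK : K / INR m < gap).
  { apply Rmult_lt_reg_r with (INR m); [assumption|].
    replace (K / INR m * INR m) with K by (field; lra).
    assert (K / gap < INR m) by lra.
    apply (Rmult_lt_compat_r gap) in H; [|assumption].
    replace (K / gap * gap) with K in H by (field; lra). lra. }
  unfold gap in HK. lra.
Qed.
End HJB.

(** Induction on the word for all functionals at once: the last factor is absorbed into [A], and
    [hjb] compares the minimal values before and after. *)
Lemma lower_bound_reach p q A M c : 0 < p -> 0 < q ->
  lower_bound (cls p q) A M c -> lower_bound (reach p q) A M c.
Proof.
  intros Hp Hq H M' c' Hr. revert A M c H.
  induction Hr as [|M' c' th ph Hr IH Hth]; intros A M c H.
  - apply H. pose proof PI_RGT_0.
    eapply cls_eq; [apply (cls_XYX p q 0 0 0); rewrite Rabs_R0; lra|weq|rewrite Rabs_R0; ring].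
  - rewrite ip_mul_r.
    destruct (minimizer_exists (A * mtrans (Exy th ph))%M p q) as (M2 & c2 & HM2 & Hmin2).
    specialize (IH _ _ _ Hmin2).
    assert (L := hjb p q Hp Hq ph A M c M2 c2 th Hth H HM2). lra.
Qed.

Theorem penalized_optimum A p q : 0 < p -> 0 < q ->
  exists M c, clsq p q M c /\ lower_bound (reach p q) A M c /\ reach p q M c.
Proof.
  intros Hp Hq. destruct (good_exists A p q Hp Hq) as (M & c & [HM Hmin] & _ & Hg).
  assert (Hlb := lower_bound_reach p q A M c Hp Hq Hmin).
  exists M, c. split; [now apply Hg|]. split; [exact Hlb|]. now apply cls_reach.
Qed.

(** * Letting the penalty tend to infinity *)

Inductive patfam := P2 | P3 | P4 | PXX | PXY.
Definition patbox (f : patfam) : list (R * R) :=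
  match f with
  | P2 => [(0, PI); (0, PI)]
  | P3 | P4 => [(0, PI); (0, PI); (0, PI); (0, PI)]
  | PXX | PXY => [(0, PI); (0, 2 * PI); (0, PI / 2); (0, PI)]
  end.
Definition patmat (f : patfam) (x : list R) : mat :=
  let a := nth 0 x 0 in let b := nth 1 x 0 in let c := nth 2 x 0 in let d := nth 3 x 0 in
  match f with
  | P2 => (Rx a * Ry b)%M
  | P3 => (Rx a * (Ry b * Rx (- c)))%M
  | P4 => (Rx a * (Ry b * (Rx (- c) * Ry (- d))))%M
  | PXX => (Rx a * (Exy b c * Rx d))%M
  | PXY => (Rx a * (Exy b c * Ry d))%M
  end.
Definition patcost (p q : R) (f : patfam) (x : list R) : R :=
  let a := nth 0 x 0 in let b := nth 1 x 0 in let c := nth 2 x 0 in let d := nth 3 x 0 in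
  match f with
  | P2 => p * a + q * b
  | P3 => p * a + q * b + p * c
  | P4 => p * a + q * b + p * c + q * d
  | PXX => p * a + b * (p * cos c + q * sin c) + p * d
  | PXY => p * a + b * (p * cos c + q * sin c) + q * d
  end.
(* Vanishes exactly on the parameters that satisfy the relations of the pattern. *)
Definition patdefect (p q : R) (f : patfam) (x : list R) : R :=
  let a := nth 0 x 0 in let b := nth 1 x 0 in let c := nth 2 x 0 in let d := nth 3 x 0 in
  match f with
  | P2 => 0
  | P3 => Rmax 0 (a - d) + Rmax 0 (c - d)
          + Rabs (p * sin (d * / 2) * cos (b * / 2) - q * cos (d * / 2) * sin (b * / 2))
  | P4 => Rmax 0 (a - c) + Rmax 0 (d - b)
          + Rabs (p * sin (c * / 2) * cos (b * / 2) - q * cos (c * / 2) * sin (b * / 2))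
  | PXX | PXY => Rabs (p * sin c - q * cos c)
  end.

Lemma patdefect_ge0 p q f x : 0 <= patdefect p q f x.
Proof.
  destruct f; unfold patdefect; simpl; repeat apply Rplus_le_le_0_compat;
  try apply Rmax_l; try apply Rabs_pos; lra.
Qed.

Lemma Rabs_eq0 x : Rabs x = 0 -> x = 0.
Proof. intros H. destruct (Req_dec x 0) as [|Hn]; [assumption|]. now apply Rabs_no_R0 in Hn. Qed.
Lemma Rmax0_le x : Rmax 0 x <= 0 -> x <= 0.
Proof. pose proof (Rmax_r 0 x). lra. Qed.

Lemma baseq_param p q f x : inbox (patbox f) x -> patdefect p q f x = 0 ->
  baseq p q (patmat f x) (patcost p q f x).
Proof.
  destruct f; unfold inbox; simpl; intros H HD.
  all: inv_inbox H; unfold patmat, patcost, patdefect in *; simpl in *.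
  - now apply baseq2.
  - assert (E1 := Rmax_l 0 (y - y2)). assert (E2 := Rmax_l 0 (y1 - y2)).
    match type of HD with _ + Rabs ?z = 0 => pose proof (Rabs_pos z); assert (Z : Rabs z = 0) by lra end.
    assert (Z1 : Rmax 0 (y - y2) <= 0) by lra. assert (Z2 : Rmax 0 (y1 - y2) <= 0) by lra.
    apply Rabs_eq0 in Z. apply Rmax0_le in Z1, Z2.
    apply (baseq3 p q y y0 y1 y2); unfold Rdiv; lra.
  - assert (E1 := Rmax_l 0 (y - y1)). assert (E2 := Rmax_l 0 (y2 - y0)).
    match type of HD with _ + Rabs ?z = 0 => pose proof (Rabs_pos z); assert (Z : Rabs z = 0) by lra end.
    assert (Z1 : Rmax 0 (y - y1) <= 0) by lra. assert (Z2 : Rmax 0 (y2 - y0) <= 0) by lra.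
    apply Rabs_eq0 in Z. apply Rmax0_le in Z1, Z2.
    apply (baseq4 p q y y0 y1 y2); unfold Rdiv; lra.
  - apply Rabs_eq0 in HD. apply baseqXX; trivial; lra.
  - apply Rabs_eq0 in HD. apply baseqXY; trivial; lra.
Qed.

Lemma baseq_param_inv p q M c : baseq p q M c ->
  exists f x, inbox (patbox f) x /\ patdefect p q f x = 0 /\ M = patmat f x /\ c = patcost p q f x.
Proof.
  intros [a b|a b c' t|a b c' d|a th ph b|a th ph b]; intros.
  - exists P2, [a; b]. split; [boxin|]. repeat split; reflexivity.
  - exists P3, [a; b; c'; t]. split; [boxin|]. repeat split; try reflexivity.
    unfold patdefect; simpl. fold (t / 2) (b / 2).
    rewrite !Rmax_left by lra. rewrite H3, Rminus_diag, Rabs_R0. ring.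
  - exists P4, [a; b; c'; d]. split; [boxin|]. repeat split; try reflexivity.
    unfold patdefect; simpl. fold (c' / 2) (b / 2).
    rewrite !Rmax_left by lra. rewrite H3, Rminus_diag, Rabs_R0. ring.
  - exists PXX, [a; th; ph; b]. split; [boxin|]. repeat split; try reflexivity.
    unfold patdefect; simpl. rewrite H3, Rminus_diag, Rabs_R0. ring.
  - exists PXY, [a; th; ph; b]. split; [boxin|]. repeat split; try reflexivity.
    unfold patdefect; simpl. rewrite H3, Rminus_diag, Rabs_R0. ring.
Qed.

Lemma orth_ip M : orth M -> ip M M = 3.
Proof.
  intros H. rewrite <- (mmul_1_r M). rewrite ip_orth_l by assumption. unfold ip; simpl; ring.
Qed.

Lemma orth_Rx t : orth (Rx t).
Proof. unfold orth. rewrite mtrans_Rx, Rx_add, Rplus_opp_l. apply Rx_0. Qed.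
Lemma orth_Ry t : orth (Ry t).
Proof. unfold orth. rewrite mtrans_Ry, Ry_add, Rplus_opp_l. apply Ry_0. Qed.
Lemma orth_conj g M : orth M -> orth (conjg g M).
Proof.
  intros H. unfold conjg. apply orth_mul; [apply symmx_orth|]. apply orth_mul; [exact H|].
  unfold orth. rewrite mtransK. rewrite <- (syminvK g) at 1 2. rewrite symmx_inv, mtransK. apply symmx_orth.
Qed.

Lemma orth_patmat f x : orth (patmat f x).
Proof.
  destruct f; unfold patmat; repeat first [apply orth_Rx | apply orth_Ry | apply orth_Exy | apply orth_mul].
Qed.

Lemma ip_orth_le M N : orth M -> orth N -> ip M N <= 3.
Proof.
  intros H1 H2. pose proof (ip_bound M N) as H. rewrite !orth_ip in H by assumption.
  apply Rabs_le_between in H. lra.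
Qed.

(** Both matrices have squared norm [3], so [2 * (3 - ip M N)] is the square of their distance. *)
Lemma ip_orth_eq M N : orth M -> orth N -> ip M N = 3 -> N = M.
Proof.
  intros H1 H2 H.
  assert (E : ip (M + (-1) *: N)%M (M + (-1) *: N)%M = 0).
  { transitivity (ip M M + ip N N - 2 * ip M N); [unfold ip; simpl; ring|].
    rewrite !orth_ip, H by assumption. ring. }
  destruct M, N; unfold ip in E; simpl in E.
  assert (Hz : forall x y : R, 0 <= (x + -1 * y) * (x + -1 * y)) by (intros x y; apply Rle_0_sqr).
  assert (Hz' : forall x y : R, (x + -1 * y) * (x + -1 * y) <= 0 -> y = x).
  { intros x y Hxy. assert (x + -1 * y = 0) by (apply Rsqr_0_uniq; unfold Rsqr; pose proof (Hz x y); lra). lra. }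
  pose proof (Hz m11 m0) as Q1. pose proof (Hz m12 m1) as Q2. pose proof (Hz m13 m2) as Q3.
  pose proof (Hz m21 m3) as Q4. pose proof (Hz m22 m4) as Q5. pose proof (Hz m23 m5) as Q6.
  pose proof (Hz m31 m6) as Q7. pose proof (Hz m32 m7) as Q8. pose proof (Hz m33 m8) as Q9.
  f_equal; apply Hz'; lra.
Qed.

Lemma infimum (S : R -> Prop) b : (exists x, S x) -> (forall x, S x -> b <= x) ->
  exists m, b <= m /\ (forall x, S x -> m <= x) /\ forall b', (forall x, S x -> b' <= x) -> b' <= m.
Proof.
  intros (x0 & Hx0) Hb.
  destruct (completeness (fun y => S (- y))) as (m & Hm1 & Hm2).
  - exists (- b). intros y Hy. specialize (Hb _ Hy). lra.
  - exists (- x0). now rewrite Ropp_involutive.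
  - assert (L : forall b', (forall x, S x -> b' <= x) -> b' <= - m).
    { intros b' Hb'. assert (m <= - b'); [|lra]. apply Hm2. intros y Hy. specialize (Hb' _ Hy). lra. }
    exists (- m). split; [now apply L|]. split; [|exact L].
    intros x Hx. assert (- x <= m); [|lra]. apply Hm1. now rewrite Ropp_involutive.
Qed.

(** [F] adds three nonnegative defects: the violated pattern relations, the distance from [g], and
    the excess of the cost over the infimum [m]. The penalized optimum for [- K g] has cost at most
    [m] and satisfies the relations, so its value of [F] is at most [m / K]. The minimum of [F] is
    therefore [0], and a point where it is attained is the optimum. *)
Theorem optimum_exists p q g : 0 < p -> 0 < q -> orth g -> (exists c, reach p q g c) ->
  exists c, clsq p q g c /\ forall c', reach p q g c' -> c <= c'.
Proof.
  intros Hp Hq Hg Hex. pose proof PI_RGT_0 as HPI.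
  destruct (infimum (reach p q g) 0 Hex) as (m & Hm0 & Hm & Hm').
  { intros x Hx. apply (reach_ge0 p q g x); [lra|lra|exact Hx]. }
  set (F := fun (i : sym * patfam) x =>
     patdefect (fstc (fst i) p q) (sndc (fst i) p q) (snd i) x
     + (3 - ip g (conjg (fst i) (patmat (snd i) x)))
     + Rmax 0 (patcost (fstc (fst i) p q) (sndc (fst i) p q) (snd i) x - m)).
  destruct (finite_min (fun i x => inbox (patbox (snd i)) x) F
    (list_prod syms [P2; P3; P4; PXX; PXY])) as ([s f] & x & Hx & Hmin); [discriminate| |].
  { intros [s f]. simpl. apply box_min.
    - destruct f; simpl; repeat (apply List.Forall_cons; [simpl; lra|]); apply List.Forall_nil.
    - unfold F; destruct f; unfold patmat, patcost, patdefect; simpl; blip. }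
  assert (Hle : forall k : nat, F (s, f) x <= m / INR (S k)).
  { intros k. set (K := INR (S k)). assert (HK : 0 < K) by (apply lt_0_INR; lia).
    destruct (penalized_optimum ((- K) *: g)%M p q Hp Hq) as (M & c & (s' & M0 & HB & ->) & Hlb & HR).
    assert (Hc : c <= m /\ 3 - ip g (conjg s' M0) <= m / K).
    { assert (Hall : c + K * (3 - ip g (conjg s' M0)) <= m).
      { apply Hm'. intros c' Hc'. specialize (Hlb _ _ Hc').
        rewrite !ip_scale_l, (orth_ip g Hg) in Hlb. lra. }
      assert (H3 := ip_orth_le g _ Hg (reach_orth _ _ _ _ HR)).
      assert (0 <= K * (3 - ip g (conjg s' M0))) by (apply Rmult_le_pos; lra).
      assert (Hc0 : 0 <= c) by (apply (reach_ge0 p q (conjg s' M0)); [lra|lra|exact HR]).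
      split; [lra|]. apply Rmult_le_reg_l with K; [assumption|].
      replace (K * (m / K)) with m by (field; lra). lra. }
    apply baseq_param_inv in HB. destruct HB as (f' & x' & Hx' & HD & -> & ->).
    eapply Rle_trans; [apply (Hmin (s', f') x')|].
    - apply in_prod; [apply in_syms|destruct f'; simpl; tauto].
    - exact Hx'.
    - unfold F. cbn [fst snd]. rewrite HD, Rmax_left by lra. lra. }
  assert (HF0 : F (s, f) x <= 0).
  { apply Rnot_lt_le. intros Hpos. destruct (INR_unbounded (m / F (s, f) x)) as [n Hn].
    specialize (Hle n). assert (HS : 0 < INR (S n)) by (apply lt_0_INR; lia).
    assert (INR n < INR (S n)) by (apply lt_INR; lia).
    apply (Rmult_le_compat_r (INR (S n))) in Hle; [|lra].
    replace (m / INR (S n) * INR (S n)) with m in Hle by (field; lra).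
    assert (HH : m / F (s, f) x * F (s, f) x < INR (S n) * F (s, f) x) by (apply Rmult_lt_compat_r; lra).
    replace (m / F (s, f) x * F (s, f) x) with m in HH by (field; lra). lra. }
  unfold F in HF0. cbn [fst snd] in HF0, Hx.
  assert (D0 := patdefect_ge0 (fstc s p q) (sndc s p q) f x).
  assert (I0 := ip_orth_le g _ Hg (orth_conj s _ (orth_patmat f x))).
  assert (R0 := Rmax_l 0 (patcost (fstc s p q) (sndc s p q) f x - m)).
  exists (patcost (fstc s p q) (sndc s p q) f x). split.
  - exists s, (patmat f x). split; [apply baseq_param; [exact Hx|lra]|].
    symmetry. apply ip_orth_eq; [exact Hg|apply orth_conj, orth_patmat|lra].
  - intros c' Hc'. specialize (Hm _ Hc').
    assert (Hz : patcost (fstc s p q) (sndc s p q) f x - m <= 0) by (apply Rmax0_le; lra). lra.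
Qed.

(** * Euler angles *)

Lemma unit_polar a b : a * a + b * b = 1 -> exists t, cos t = a /\ sin t = b.
Proof.
  intros H. assert (Ha : -1 <= a <= 1) by nra.
  destruct (Rle_or_lt 0 b) as [Hb|Hb].
  - exists (acos a). rewrite cos_acos, sin_acos by assumption. split; [reflexivity|].
    replace (1 - a²) with (b * b) by (unfold Rsqr; lra). now apply sqrt_square.
  - exists (- acos a). rewrite cos_neg, sin_neg, cos_acos, sin_acos by assumption. split; [reflexivity|].
    replace (1 - a²) with ((- b) * (- b)) by (unfold Rsqr; lra). rewrite sqrt_square; lra.
Qed.

Lemma polar a b : exists r t, 0 <= r /\ a = r * cos t /\ b = r * sin t.
Proof.
  destruct (Req_dec (a * a + b * b) 0) as [H0|H0].
  - exists 0, 0. assert (a = 0) by nra. assert (b = 0) by nra. lra.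
  - assert (Hpos : 0 < a * a + b * b) by nra.
    set (r := sqrt (a * a + b * b)). assert (Hr : 0 < r) by now apply sqrt_lt_R0.
    assert (Hrr : r * r = a * a + b * b) by (apply sqrt_sqrt; lra).
    destruct (unit_polar (a / r) (b / r)) as (t & Hc & Hs).
    { replace (a / r * (a / r) + b / r * (b / r)) with ((a * a + b * b) / (r * r)) by (field; lra).
      rewrite Hrr. field. lra. }
    exists r, t. rewrite Hc, Hs. repeat split; [lra|field; lra|field; lra].
Qed.

Lemma mdet_mul A B : mdet (A * B)%M = mdet A * mdet B.
Proof. unfold mdet; simpl; ring. Qed.
Lemma mdet_Rx t : mdet (Rx t) = 1.
Proof. pose proof (sin2_cos2 t) as H. unfold Rsqr in H. unfold mdet; simpl. lra. Qed.
Lemma mdet_Ry t : mdet (Ry t) = 1.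
Proof. pose proof (sin2_cos2 t) as H. unfold Rsqr in H. unfold mdet; simpl. lra. Qed.

Lemma orth_trans M : orth M -> mdet M = 1 -> (M * mtrans M)%M = mid3.
Proof.
  intros H Hdet.
  set (adj := mkm (m22 M * m33 M - m23 M * m32 M) (m13 M * m32 M - m12 M * m33 M) (m12 M * m23 M - m13 M * m22 M)
                  (m23 M * m31 M - m21 M * m33 M) (m11 M * m33 M - m13 M * m31 M) (m13 M * m21 M - m11 M * m23 M)
                  (m21 M * m32 M - m22 M * m31 M) (m12 M * m31 M - m11 M * m32 M) (m11 M * m22 M - m12 M * m21 M)).
  assert (E : (M * adj)%M = mid3).
  { transitivity (mscale (mdet M) mid3); [unfold adj, mdet; mring|rewrite Hdet; mring]. }
  replace (mtrans M) with adj; [exact E|].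
  rewrite <- (mmul_1_l adj). rewrite <- (H : (mtrans M * M)%M = mid3), mmul_assoc, E. apply mmul_1_r.
Qed.

(** Needed so that the infimum is taken over a nonempty set of costs. Two rotations bring the first
    column to the first axis; what is left is a rotation about it. *)
Lemma euler_XYX g : inSO3 g -> exists a b c, g = (Rx a * (Ry b * Rx c))%M.
Proof.
  intros [Ho Hdet]. change (orth g) in Ho.
  destruct (polar (- m31 g) (m21 g)) as (r & a & Hr & H31 & H21).
  set (g1 := (Rx (- a) * g)%M).
  assert (Ho1 : orth g1) by (apply orth_mul; [apply orth_Rx|exact Ho]).
  assert (Hsa := sin2_cos2 a). unfold Rsqr in Hsa.
  assert (E11 : m11 g1 = m11 g) by (simpl; ring).
  assert (E21 : m21 g1 = 0).
  { simpl. rewrite cos_neg, sin_neg, H21. replace (m31 g) with (- (r * cos a)) by lra. ring. }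
  assert (E31 : m31 g1 = - r).
  { simpl. rewrite cos_neg, sin_neg, H21. replace (m31 g) with (- (r * cos a)) by lra.
    transitivity (- r * (sin a * sin a + cos a * cos a)); [ring|rewrite Hsa; ring]. }
  assert (Hn : m11 g * m11 g + r * r = 1).
  { assert (E := f_equal m11 Ho1). simpl m11 in E at 1.
    change (m11 (mtrans g1)) with (m11 g1) in E.
    assert (E' : m11 g1 * m11 g1 + m21 g1 * m21 g1 + m31 g1 * m31 g1 = 1) by exact E.
    rewrite E11, E21, E31 in E'. lra. }
  destruct (unit_polar _ _ Hn) as (b & Hcb & Hsb).
  set (g2 := (Ry (- b) * g1)%M).
  assert (Ho2 : orth g2) by (apply orth_mul; [apply orth_Ry|exact Ho1]).
  assert (Hd2 : mdet g2 = 1).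
  { unfold g2, g1. rewrite !mdet_mul, mdet_Rx, mdet_Ry, Hdet. ring. }
  assert (C1 : m11 g2 = 1).
  { change (m11 g2) with (cos (- b) * m11 g1 + 0 * m21 g1 + sin (- b) * m31 g1).
    rewrite E11, E21, E31, cos_neg, sin_neg, Hcb, Hsb. lra. }
  assert (C2 : m21 g2 = 0).
  { change (m21 g2) with (0 * m11 g1 + 1 * m21 g1 + 0 * m31 g1). rewrite E21. ring. }
  assert (C3 : m31 g2 = 0).
  { change (m31 g2) with (- sin (- b) * m11 g1 + 0 * m21 g1 + cos (- b) * m31 g1).
    rewrite E11, E31, cos_neg, sin_neg, Hcb, Hsb. ring. }
  assert (Hg : g = (Rx a * (Ry b * g2))%M).
  { unfold g2, g1. rewrite <- (mmul_assoc (Ry b)), Ry_add, Rplus_opp_r, Ry_0, mmul_1_l.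
    now rewrite Rx_addA, Rplus_opp_r, Rx_0, mmul_1_l. }
  assert (Ho2' := orth_trans g2 Ho2 Hd2).
  clearbody g2. destruct g2 as [u11 u12 u13 u21 u22 u23 u31 u32 u33]. simpl in C1, C2, C3. subst u11 u21 u31.
  unfold mdet in Hd2; simpl in Hd2.
  assert (F1 := f_equal m11 Ho2'). assert (F2 := f_equal m12 Ho2). assert (F3 := f_equal m13 Ho2).
  assert (F4 := f_equal m22 Ho2'). assert (F5 := f_equal m22 Ho2). assert (F6 := f_equal m33 Ho2).
  assert (F7 := f_equal m23 Ho2). simpl in *.
  assert (u12 = 0) by lra. assert (u13 = 0) by lra. subst u12 u13.
  destruct (unit_polar u22 u32) as (c & Hc & Hs); [lra|].
  exists a, b, c. rewrite Hg. do 2 f_equal. unfold Rx.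
  assert (u33 = u22 /\ u23 = - u32) as [-> ->].
  { assert (Hz : (u33 - u22) * (u33 - u22) + (u23 + u32) * (u23 + u32) = 0).
    { transitivity ((u22 * u22 + u32 * u32) + (u23 * u23 + u33 * u33) - 2 * (u22 * u33 - u23 * u32)); [ring|].
      assert (u22 * u33 - u23 * u32 = 1) by lra. lra. }
    pose proof (Rle_0_sqr (u33 - u22)) as Q1. pose proof (Rle_0_sqr (u23 + u32)) as Q2. unfold Rsqr in Q1, Q2.
    assert (u33 - u22 = 0) by (apply Rsqr_0_uniq; unfold Rsqr; lra).
    assert (u23 + u32 = 0) by (apply Rsqr_0_uniq; unfold Rsqr; lra). lra. }
  rewrite Hc, Hs. reflexivity.
Qed.

(** * Words in an orthonormal frame *)

Definition frame (X Y : vec) : mat :=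
  mkm (vx X) (vx Y) (vy X * vz Y - vz X * vy Y)
      (vy X) (vy Y) (vz X * vx Y - vx X * vz Y)
      (vz X) (vz Y) (vx X * vy Y - vy X * vx Y).

(** The factor written in the frame whose first two axes are [X] and [Y]. *)
Definition letter (f : factor) : mat :=
  let '(t, (a, b)) := f in let n := sqrt (a * a + b * b) in
  rot_unit (t * n) (mkv (/ n * a) (/ n * b) 0).
Arguments letter : simpl never.
Definition wprod (w : word) : mat := fold_right (fun f M => (letter f * M)%M) mid3 w.

Section Frame.
Variables (X Y : vec).
Hypotheses (HX : dot X X = 1) (HY : dot Y Y = 1) (HXY : dot X Y = 0).

(** With [Z] the third column, these are the coordinates of [Y × Z = X] and [Z × X = Y]; the
    remaining cyclic relation is the definition of [Z]. *)
Lemma frame_cross :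
  let Q := frame X Y in
  (m22 Q * m33 Q - m32 Q * m23 Q = m11 Q /\ m32 Q * m13 Q - m12 Q * m33 Q = m21 Q /\
   m12 Q * m23 Q - m22 Q * m13 Q = m31 Q) /\
  (m23 Q * m31 Q - m33 Q * m21 Q = m12 Q /\ m33 Q * m11 Q - m13 Q * m31 Q = m22 Q /\
   m13 Q * m21 Q - m23 Q * m11 Q = m32 Q).
Proof.
  destruct X as [x1 x2 x3], Y as [y1 y2 y3]. unfold dot in *; simpl in *.
  repeat split;
  [ transitivity (x1 * (y1 * y1 + y2 * y2 + y3 * y3) - y1 * (x1 * y1 + x2 * y2 + x3 * y3))
  | transitivity (x2 * (y1 * y1 + y2 * y2 + y3 * y3) - y2 * (x1 * y1 + x2 * y2 + x3 * y3))
  | transitivity (x3 * (y1 * y1 + y2 * y2 + y3 * y3) - y3 * (x1 * y1 + x2 * y2 + x3 * y3))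
  | transitivity (y1 * (x1 * x1 + x2 * x2 + x3 * x3) - x1 * (x1 * y1 + x2 * y2 + x3 * y3))
  | transitivity (y2 * (x1 * x1 + x2 * x2 + x3 * x3) - x2 * (x1 * y1 + x2 * y2 + x3 * y3))
  | transitivity (y3 * (x1 * x1 + x2 * x2 + x3 * x3) - x3 * (x1 * y1 + x2 * y2 + x3 * y3)) ];
  try ring; rewrite HXY, ?HX, ?HY; ring.
Qed.

Lemma frame_det : mdet (frame X Y) = 1.
Proof.
  destruct frame_cross as ((E1 & E2 & E3) & _).
  transitivity (m11 (frame X Y) * (m22 (frame X Y) * m33 (frame X Y) - m32 (frame X Y) * m23 (frame X Y))
    + m21 (frame X Y) * (m32 (frame X Y) * m13 (frame X Y) - m12 (frame X Y) * m33 (frame X Y))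
    + m31 (frame X Y) * (m12 (frame X Y) * m23 (frame X Y) - m22 (frame X Y) * m13 (frame X Y))).
  - unfold mdet. ring.
  - rewrite E1, E2, E3. exact HX.
Qed.

Lemma frame_orth : orth (frame X Y).
Proof.
  destruct X as [x1 x2 x3], Y as [y1 y2 y3]. unfold dot in *; simpl in *.
  apply mat_ext; simpl; try lra.
  transitivity ((x1 * x1 + x2 * x2 + x3 * x3) * (y1 * y1 + y2 * y2 + y3 * y3)
     - (x1 * y1 + x2 * y2 + x3 * y3) * (x1 * y1 + x2 * y2 + x3 * y3)); [ring|].
  rewrite HX, HY, HXY. ring.
Qed.

Lemma frame_orth_r : (frame X Y * mtrans (frame X Y))%M = mid3.
Proof. apply orth_trans; [apply frame_orth|apply frame_det]. Qed.

Lemma rot_unit_frame s a b :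
  rot_unit s (fvec X Y (a, b)) = (frame X Y * (rot_unit s (mkv a b 0) * mtrans (frame X Y)))%M.
Proof.
  assert (HT := frame_orth_r). destruct frame_cross as ((E1 & E2 & E3) & (E4 & E5 & E6)).
  set (Q := frame X Y) in *.
  assert (EV : fvec X Y (a, b) = mkv (a * m11 Q + b * m12 Q) (a * m21 Q + b * m22 Q) (a * m31 Q + b * m32 Q))
    by reflexivity.
  rewrite EV. clearbody Q.
  set (k := 1 - cos s).
  (* Identity, cross-product and projection parts are conjugated separately; [frame_cross] is what
     carries the cross-product matrix to the new frame. *)
  assert (ED : forall n1 n2 n3, rot_unit s (mkv n1 n2 n3) =
    (cos s *: mid3 + (sin s *: mkm 0 (- n3) n2 n3 0 (- n1) (- n2) n1 0
      + k *: mkm (n1 * n1) (n1 * n2) (n1 * n3) (n2 * n1) (n2 * n2) (n2 * n3) (n3 * n1) (n3 * n2) (n3 * n3)))%M)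
    by (intros; unfold rot_unit, k; mring).
  rewrite !ED, !mmul_add_l, !mmul_add_r, !mmul_scale_l, !mmul_scale_r, mmul_1_l, HT.
  f_equal. f_equal.
  - f_equal.
    transitivity (let n1 := a * (m22 Q * m33 Q - m32 Q * m23 Q) + b * (m23 Q * m31 Q - m33 Q * m21 Q) in
      let n2 := a * (m32 Q * m13 Q - m12 Q * m33 Q) + b * (m33 Q * m11 Q - m13 Q * m31 Q) in
      let n3 := a * (m12 Q * m23 Q - m22 Q * m13 Q) + b * (m13 Q * m21 Q - m23 Q * m11 Q) in
      mkm 0 (- n3) n2 n3 0 (- n1) (- n2) n1 0).
    + now rewrite E1, E2, E3, E4, E5, E6.
    + mring.
  - f_equal. mring.
Qed.

Lemma rot_frame t ab :
  rot t (fvec X Y ab) = (frame X Y * (letter (t, ab) * mtrans (frame X Y)))%M.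
Proof.
  destruct ab as [a b]. unfold rot, letter.
  assert (En : vnorm (fvec X Y (a, b)) = sqrt (a * a + b * b)).
  { unfold vnorm. f_equal.
    transitivity (a * a * dot X X + b * b * dot Y Y + 2 * a * b * dot X Y).
    - unfold dot, fvec, vadd, vscale; simpl; ring.
    - rewrite HX, HY, HXY. ring. }
  rewrite En. set (n := sqrt (a * a + b * b)).
  replace (vscale (/ n) (fvec X Y (a, b))) with (fvec X Y (/ n * a, / n * b)).
  - apply rot_unit_frame.
  - unfold fvec, vadd, vscale; simpl. f_equal; ring.
Qed.

Lemma word_prod_frame w :
  word_prod X Y w = (frame X Y * (wprod w * mtrans (frame X Y)))%M.
Proof.
  induction w as [|[t ab] w IH]; simpl.
  - change (word_prod X Y []) with mid3. rewrite mmul_1_l. symmetry. apply frame_orth_r.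
  - change (word_prod X Y ((t, ab) :: w)) with (rot t (fvec X Y ab) * word_prod X Y w)%M.
    rewrite IH, rot_frame, !mmul_assoc, <- (mmul_assoc (mtrans (frame X Y)) (frame X Y)).
    rewrite (frame_orth : (mtrans (frame X Y) * frame X Y)%M = mid3), mmul_1_l. reflexivity.
Qed.

Lemma fvec_neq0 ab : ab <> (0, 0) -> fvec X Y ab <> vzero.
Proof.
  destruct ab as [a b]. intros Hab E. apply Hab.
  assert (Ex := f_equal vx E). assert (Ey := f_equal vy E). assert (Ez := f_equal vz E). simpl in *.
  assert (a = 0).
  { transitivity (a * dot X X + b * dot X Y); [rewrite HX, HXY; ring|].
    transitivity (vx X * (a * vx X + b * vx Y) + vy X * (a * vy X + b * vy Y) + vz X * (a * vz X + b * vz Y)).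
    - unfold dot; ring.
    - rewrite Ex, Ey, Ez. ring. }
  assert (b = 0).
  { transitivity (a * dot X Y + b * dot Y Y); [rewrite HY, HXY; ring|].
    transitivity (vx Y * (a * vx X + b * vx Y) + vy Y * (a * vy X + b * vy Y) + vz Y * (a * vz X + b * vz Y)).
    - unfold dot; ring.
    - rewrite Ex, Ey, Ez. ring. }
  congruence.
Qed.
End Frame.

(** * Factors as rotations, and the symmetries acting on words *)

Lemma rot_unit_Exy s ph : rot_unit s (mkv (cos ph) (sin ph) 0) = Exy s ph.
Proof.
  pose proof (sin2_cos2 ph) as H. unfold Rsqr in H.
  assert (Hs : sin ph * sin ph = 1 - cos ph * cos ph) by lra.
  apply mat_ext; unfold rot_unit; simpl; rewrite ?cos_neg, ?sin_neg;
  ring_simplify; simpl; rewrite ?Rmult_1_r, ?Hs; try ring.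
Qed.

Lemma letter_Exy t a b n ph : 0 < n -> a = n * cos ph -> b = n * sin ph ->
  letter (t, (a, b)) = Exy (t * n) ph.
Proof.
  intros Hn -> ->. unfold letter.
  replace (n * cos ph * (n * cos ph) + n * sin ph * (n * sin ph)) with (n * n).
  - rewrite sqrt_square by lra. rewrite <- rot_unit_Exy. do 2 f_equal; field; lra.
  - pose proof (sin2_cos2 ph) as H. unfold Rsqr in H.
    transitivity (n * n * (sin ph * sin ph + cos ph * cos ph)); [rewrite H|]; ring.
Qed.

Lemma letter_X t : letter (t, (1, 0)) = Rx t.
Proof.
  rewrite (letter_Exy t 1 0 1 0), Rmult_1_r by (rewrite ?cos_0, ?sin_0; lra). apply Exy_0.
Qed.
Lemma letter_Y t : letter (t, (0, 1)) = Ry t.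
Proof.
  rewrite (letter_Exy t 0 1 1 (PI / 2)), Rmult_1_r by (rewrite ?cos_PI2, ?sin_PI2; lra). apply Exy_PI2.
Qed.
Lemma letter_mX t : letter (t, (-1, 0)) = Rx (- t).
Proof.
  rewrite (letter_Exy t (-1) 0 1 PI), Rmult_1_r by (rewrite ?cos_PI, ?sin_PI; lra). apply Exy_PI.
Qed.
Lemma letter_mY t : letter (t, (0, -1)) = Ry (- t).
Proof.
  rewrite (letter_Exy t 0 (-1) 1 (- (PI / 2))), Rmult_1_r
    by (rewrite ?cos_neg, ?sin_neg, ?cos_PI2, ?sin_PI2; lra). apply Exy_mPI2.
Qed.

Lemma reach_wprod kappa w : List.Forall (fun f => 0 <= fst f /\ snd f <> (0, 0)) w ->
  reach 1 kappa (wprod w) (cost kappa w).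
Proof.
  induction 1 as [|[t [a b]] w [Ht Hab] Hw IH]; simpl in *.
  - apply reach_nil.
  - apply reach_app; [|exact IH].
    destruct (polar a b) as (n & ph & Hn & Ea & Eb).
    assert (Hn' : 0 < n).
    { destruct Hn as [|<-]; [assumption|]. exfalso. apply Hab. f_equal; lra. }
    rewrite (letter_Exy t a b n ph Hn' Ea Eb).
    eapply reach_eq; [apply (reach_Exy 1 kappa (t * n) ph); apply Rmult_le_pos; lra|reflexivity|].
    rewrite Ea, Eb, !Rabs_mult, (Rabs_pos_eq n) by lra. ring.
Qed.

Definition coefact (g : sym) (ab : R * R) : R * R :=
  let '(w, (s1, s2)) := g in
  if w then (sgn s1 * snd ab, sgn s2 * fst ab) else (sgn s1 * fst ab, sgn s2 * snd ab).
Definition facact (g : sym) (f : factor) : factor := (fst f, coefact g (snd f)).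
Definition cost2 (p q : R) (w : word) : R :=
  fold_right (fun f acc => fst f * (p * Rabs (fst (snd f)) + q * Rabs (snd (snd f))) + acc) 0 w.

Lemma letter_act g f : letter (facact g f) = conjg g (letter f).
Proof.
  destruct f as [t [a b]]. unfold facact, letter; simpl.
  assert (E : forall a' b', coefact g (a, b) = (a', b') -> sqrt (a' * a' + b' * b') = sqrt (a * a + b * b)).
  { intros a' b' E. f_equal. dsym g; simpl in E; inversion E; ring. }
  destruct (coefact g (a, b)) as [a' b'] eqn:Eab. rewrite (E a' b' eq_refl).
  set (n := sqrt (a * a + b * b)). clearbody n.
  dsym g; simpl in Eab; inversion Eab; subst a' b'; apply mat_ext; simpl; ring.
Qed.

Lemma wprod_act g w : wprod (map (facact g) w) = conjg g (wprod w).
Proof.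
  induction w as [|f w IH]; simpl; [now rewrite conj_1|]. now rewrite letter_act, IH, conj_mul.
Qed.

Lemma cost_act g kappa w : cost kappa (map (facact g) w) = cost2 (fstc g 1 kappa) (sndc g 1 kappa) w.
Proof.
  assert (E1 : Rabs (-1) = 1) by (rewrite Rabs_left; lra).
  induction w as [|[t [a b]] w IH]; simpl; [reflexivity|].
  rewrite IH. f_equal. f_equal.
  dsym g; simpl; rewrite ?Rabs_mult, ?E1, ?Rabs_R1; unfold fstc, sndc; simpl; ring.
Qed.

Lemma coefact_neq0 g ab : ab <> (0, 0) -> coefact g ab <> (0, 0).
Proof.
  destruct ab as [a b]. intros H E. apply H. dsym g; simpl in E; inversion E; f_equal; lra.
Qed.

Lemma subword_act g w v : subword w v -> subword (map (facact g) w) (map (facact g) v).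
Proof.
  assert (Ed : facact g dfac = dfac).
  { unfold facact, dfac; simpl. f_equal. dsym g; simpl; f_equal; ring. }
  intros (pre & blk & post & -> & Hl & Hlen & H).
  exists (map (facact g) pre), (map (facact g) blk), (map (facact g) post).
  rewrite !map_app, !length_map. repeat split; trivial.
  - rewrite <- Ed, !map_nth. simpl. f_equal. now apply H.
  - rewrite <- Ed, !map_nth. simpl. now apply H.
Qed.

(** * Matching the optimum with the patterns *)

(** [pact_list] applies the last generator first, so the exchange of the axes precedes the sign
    changes, as in [symmx]. *)
Definition symgens (g : sym) : list gen :=
  let '(w, (s1, s2)) := g in
  match s1, s2 with
  | false, false => []
  | false, true => [Grho]
  | true, true => [Gnu]
  | true, false => [Grho; Gnu]
  end ++ (if w then [Gvs] else []).

Ltac leq := repeat match goal with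
  | |- _ :: _ = _ :: _ => apply f_equal2
  | |- (_, _) = (_, _) => apply f_equal2
  | |- [] = [] => reflexivity
  end; try reflexivity; try ring.

Lemma instantiate_patI g kappa tU tV :
  instantiate kappa 0 (fstc g tU tV) (sndc g tU tV) 0 (pact_list (symgens g) patI) =
  map (facact g) [(tU, (1, 0)); (tV, (0, 1)); (tU, (-1, 0)); (tV, (0, -1))].
Proof. dsym g; cbv -[Rplus Rmult Ropp Rminus IZR]; leq. Qed.

(** For [c = 0] the label [W_+] is [X - kappa Y]. Applying [Grho] first turns it into
    [W_- = X + kappa Y], matching the oblique axes between [X] and [Y]; in the third pattern it also
    turns [-Y] into [Y]. The coefficients are swapped beforehand so that the action of [g] restores
    [1] and [kappa]. *)
Lemma instantiate_patII g kappa t :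
  instantiate kappa 0 0 0 t (pact_list (symgens g ++ [Grho]) patII) =
  map (facact g) [(PI, (1, 0)); (t, (fstc g 1 kappa, sndc g 1 kappa)); (PI, (1, 0))].
Proof. dsym g; cbv -[Rplus Rmult Ropp Rminus IZR PI]; leq. Qed.

Lemma instantiate_patIII g kappa t :
  instantiate kappa 0 0 0 t (pact_list (symgens g ++ [Grho]) patIII) =
  map (facact g) [(PI, (1, 0)); (t, (fstc g 1 kappa, sndc g 1 kappa)); (PI, (0, 1))].
Proof. dsym g; cbv -[Rplus Rmult Ropp Rminus IZR PI]; leq. Qed.

Lemma tan_PI2 : tan (PI / 2) = 0.
Proof. unfold tan. rewrite cos_PI2. unfold Rdiv. rewrite Rinv_0. ring. Qed.

(* At [PI] both tangents are the junk value [0] of a division by [0], so that the relation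
   of pattern (I) also holds for the pair of times [PI, PI]. *)
Lemma patI_relation p q t b : 0 < p -> 0 < q -> 0 <= t <= PI -> 0 <= b <= PI ->
  p * sin (t / 2) * cos (b / 2) = q * cos (t / 2) * sin (b / 2) ->
  (t = 0 /\ b = 0) \/ (0 < t /\ 0 < b /\ p * tan (t / 2) = q * tan (b / 2)).
Proof.
  intros Hp Hq Ht Hb H. pose proof PI_RGT_0 as HPI.
  destruct (proj1 Ht) as [Ht0|<-].
  - destruct (proj1 Hb) as [Hb0|<-].
    + right. split; [assumption|]. split; [assumption|].
      assert (St : 0 < sin (t / 2)) by (apply sin_gt_0; lra).
      assert (Sb : 0 < sin (b / 2)) by (apply sin_gt_0; lra).
      destruct (proj2 Ht) as [Ht1|Ht1].
      * assert (Ct : 0 < cos (t / 2)) by (apply cos_gt_0; lra).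
        destruct (proj2 Hb) as [Hb1|Hb1].
        -- assert (Cb : 0 < cos (b / 2)) by (apply cos_gt_0; lra).
           unfold tan. apply Rmult_eq_reg_r with (cos (t / 2) * cos (b / 2)); [|nra].
           transitivity (p * sin (t / 2) * cos (b / 2)); [field; lra|]. rewrite H. field; lra.
        -- exfalso. rewrite Hb1, cos_PI2, sin_PI2 in H.
           assert (0 < q * cos (t / 2)) by (apply Rmult_lt_0_compat; lra). lra.
      * destruct (proj2 Hb) as [Hb1|Hb1].
        -- exfalso. assert (Cb : 0 < cos (b / 2)) by (apply cos_gt_0; lra).
           rewrite Ht1, cos_PI2, sin_PI2 in H.
           assert (0 < p * cos (b / 2)) by (apply Rmult_lt_0_compat; lra). lra.
        -- rewrite Ht1, Hb1, tan_PI2. ring.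
    + exfalso. replace (0 / 2) with 0 in H by field. rewrite cos_0, sin_0 in H.
      assert (St : 0 < sin (t / 2)) by (apply sin_gt_0; lra).
      assert (0 < p * sin (t / 2)) by (apply Rmult_lt_0_compat; lra). lra.
  - left. split; [reflexivity|]. destruct (proj1 Hb) as [Hb0|<-]; [exfalso|reflexivity].
    replace (0 / 2) with 0 in H by field. rewrite cos_0, sin_0 in H.
    assert (Sb : 0 < sin (b / 2)) by (apply sin_gt_0; lra).
    assert (0 < q * sin (b / 2)) by (apply Rmult_lt_0_compat; lra). lra.
Qed.

Lemma subword_intro pre blk post w : (1 <= length blk)%nat -> length w = length blk ->
  (forall i, (i < length blk)%nat ->
      snd (nth i w dfac) = snd (nth i blk dfac) /\
      (if (Nat.eqb i 0 || Nat.eqb i (length blk - 1))%bool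
       then 0 <= fst (nth i w dfac) <= fst (nth i blk dfac)
       else fst (nth i w dfac) = fst (nth i blk dfac))) ->
  subword w (pre ++ blk ++ post).
Proof. intros. exists pre, blk, post. auto. Qed.

Ltac subword_tac := simpl; try lia; intros i Hi;
  repeat (destruct i as [|i]; [simpl; split; [reflexivity|lra]|]; try (exfalso; lia)).

Lemma word_of_baseq kappa g M c : 0 < kappa ->
  baseq (fstc g 1 kappa) (sndc g 1 kappa) M c ->
  exists w pw, List.Forall (fun f => 0 <= fst f /\ snd f <> (0, 0)) w /\
    wprod w = conjg g M /\ cost kappa w = c /\ pattern_family kappa 0 pw /\ subword w pw.
Proof.
  intros Hk HB. pose proof PI_RGT_0 as HPI.
  set (p := fstc g 1 kappa) in *. set (q := sndc g 1 kappa) in *.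
  assert (Hp : 0 < p) by (apply fstc_pos; lra). assert (Hq : 0 < q) by (apply sndc_pos; lra).
  assert (E1 : Rabs (-1) = 1) by (rewrite Rabs_left; lra).
  (* The symmetry is removed first; in the remaining word [p] and [q] are the costs of the first and
     the second axis. *)
  enough (HE : exists w pw, List.Forall (fun f => 0 <= fst f /\ snd f <> (0, 0)) w /\
    wprod w = M /\ cost2 p q w = c /\ pattern_family kappa 0 (map (facact g) pw) /\ subword w pw).
  { destruct HE as (w & pw & H1 & H2 & H3 & H4 & H5).
    exists (map (facact g) w), (map (facact g) pw). split; [|split; [|split; [|split]]].
    - apply List.Forall_map. eapply List.Forall_impl; [|exact H1]. intros [t ab] [Ht Hab]. simpl in *.
      split; [exact Ht|]. now apply coefact_neq0.
    - now rewrite wprod_act, H2.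
    - now rewrite cost_act.
    - exact H4.
    - now apply subword_act. }
  assert (FI : forall tU tV, 0 < tU <= PI -> 0 < tV <= PI -> p * tan (tU / 2) = q * tan (tV / 2) ->
    pattern_family kappa 0 (map (facact g) [(tU, (1, 0)); (tV, (0, 1)); (tU, (-1, 0)); (tV, (0, -1))])).
  { intros tU tV HU HV HT. exists (symgens g). left. exists (fstc g tU tV), (sndc g tU tV).
    rewrite instantiate_patI.
    unfold p, q, fstc, sndc in *. destruct (fst g); repeat split; try lra. }
  assert (NX : (1, 0) <> (0, 0) :> R * R) by (intros E; inversion E; lra).
  assert (NY : (0, 1) <> (0, 0) :> R * R) by (intros E; inversion E; lra).
  assert (NmX : (-1, 0) <> (0, 0) :> R * R) by (intros E; inversion E; lra).
  assert (NmY : (0, -1) <> (0, 0) :> R * R) by (intros E; inversion E; lra).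
  assert (NW : (p, q) <> (0, 0)) by (intros E; inversion E; lra).
  assert (H2 : forall a b, 0 <= a <= PI -> 0 <= b <= PI -> exists w pw,
    List.Forall (fun f => 0 <= fst f /\ snd f <> (0, 0)) w /\
    wprod w = (Rx a * Ry b)%M /\ cost2 p q w = p * a + q * b /\
    pattern_family kappa 0 (map (facact g) pw) /\ subword w pw).
  { intros a b Ha Hb.
    (* With both times equal to [PI] the relation reads [0 = 0]. The first two letters are the two
       ends of the block, so both may be shortened freely. *)
    exists [(a, (1, 0)); (b, (0, 1))], [(PI, (1, 0)); (PI, (0, 1)); (PI, (-1, 0)); (PI, (0, -1))].
    split; [|split; [|split; [|split]]].
    - repeat (apply List.Forall_cons; [simpl; split; [lra|assumption]|]); apply List.Forall_nil.
    - simpl. rewrite letter_X, letter_Y, mmul_1_r. reflexivity.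
    - simpl. rewrite Rabs_R0, Rabs_R1. ring.
    - apply FI; try lra. rewrite tan_PI2; ring.
    - apply (subword_intro [] [(PI, (1, 0)); (PI, (0, 1))] [(PI, (-1, 0)); (PI, (0, -1))]); subword_tac. }
  assert (HWc : forall th ph, 0 <= th -> 0 <= ph <= PI / 2 -> p * sin ph = q * cos ph ->
    exists t, 0 <= t /\ letter (t, (p, q)) = Exy th ph /\ t * (p * p + q * q) = th * (p * cos ph + q * sin ph)).
  { intros th ph Hth Hph HR. set (n := sqrt (p * p + q * q)).
    assert (Hn : 0 < n) by (apply sqrt_lt_R0; nra).
    assert (Hnn : n * n = p * p + q * q) by (apply sqrt_sqrt; nra).
    set (k := p * cos ph + q * sin ph).
    pose proof (sin2_cos2 ph) as Hs. unfold Rsqr in Hs.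
    assert (Ep : p = k * cos ph).
    { unfold k. transitivity (p * (sin ph * sin ph + cos ph * cos ph)); [rewrite Hs; ring|].
      transitivity ((p * sin ph) * sin ph + p * cos ph * cos ph); [ring|]. rewrite HR. ring. }
    assert (Eq : q = k * sin ph).
    { unfold k. transitivity (q * (sin ph * sin ph + cos ph * cos ph)); [rewrite Hs; ring|].
      transitivity (q * sin ph * sin ph + (q * cos ph) * cos ph); [ring|]. rewrite <- HR. ring. }
    assert (Hk2 : k * k = n * n).
    { rewrite Hnn. rewrite Ep at 1 2. rewrite Eq.
      transitivity (k * k * (sin ph * sin ph + cos ph * cos ph)); [rewrite Hs|]; ring. }
    assert (Hk0 : 0 <= k).
    { unfold k. assert (0 <= cos ph) by (apply cos_ge_0; lra). assert (0 <= sin ph) by (apply sin_ge_0; lra). nra. }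
    assert (Hkn : k = n) by (apply Rsqr_inj; unfold Rsqr; lra).
    (* The label vector has length [n], so turning by the angle [th] takes the time [th / n]. *)
    exists (th / n). split; [|split].
    - apply Rmult_le_pos; [lra|left; now apply Rinv_0_lt_compat].
    - rewrite (letter_Exy (th / n) p q n ph Hn); [f_equal; field; lra|congruence|congruence].
    - fold k. rewrite <- Hnn, Hkn. field; lra. }
  destruct HB as [a b Ha Hb|a b c t Ha Hc Ht Hb HR|a b c d Ha Hd Hc Hb HR|a th ph b Ha Hth Hph Hb HR|a th ph b Ha Hth Hph Hb HR].
  - now apply H2.
  - destruct (patI_relation p q t b Hp Hq ltac:(lra) Hb HR) as [[Et Eb]|(Ht0 & Hb0 & HT)].
    (* The first pattern requires positive times, so the trivial word is cut from its instance with
       both times [PI]. *)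
    + assert (Ea : a = 0) by lra. assert (Ec : c = 0) by lra. rewrite Ea, Eb, Ec.
      destruct (H2 0 0 ltac:(lra) ltac:(lra)) as (w & pw & W1 & W2 & W3 & W4 & W5).
      exists w, pw. repeat split; trivial; [rewrite W2, Ropp_0, Rx_0, mmul_1_r; reflexivity|rewrite W3; ring].
    + exists [(a, (1, 0)); (b, (0, 1)); (c, (-1, 0))], [(t, (1, 0)); (b, (0, 1)); (t, (-1, 0)); (b, (0, -1))].
      split; [|split; [|split; [|split]]].
      * repeat (apply List.Forall_cons; [simpl; split; [lra|assumption]|]); apply List.Forall_nil.
      * simpl. rewrite letter_X, letter_Y, letter_mX, mmul_1_r. reflexivity.
      * simpl. rewrite Rabs_R0, Rabs_R1, E1. ring.
      * apply FI; lra.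
      * apply (subword_intro [] [(t, (1, 0)); (b, (0, 1)); (t, (-1, 0))] [(b, (0, -1))]); subword_tac.
  - destruct (patI_relation p q c b Hp Hq ltac:(lra) ltac:(lra) HR) as [[Ec Eb]|(Ht0 & Hb0 & HT)].
    + assert (Ea : a = 0) by lra. assert (Ed : d = 0) by lra. rewrite Ea, Eb, Ec, Ed.
      destruct (H2 0 0 ltac:(lra) ltac:(lra)) as (w & pw & W1 & W2 & W3 & W4 & W5).
      exists w, pw. repeat split; trivial; [rewrite W2, Ropp_0, Rx_0, Ry_0, !mmul_1_r; reflexivity|rewrite W3; ring].
    + exists [(a, (1, 0)); (b, (0, 1)); (c, (-1, 0)); (d, (0, -1))], [(c, (1, 0)); (b, (0, 1)); (c, (-1, 0)); (b, (0, -1))].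
      split; [|split; [|split; [|split]]].
      * repeat (apply List.Forall_cons; [simpl; split; [lra|assumption]|]); apply List.Forall_nil.
      * simpl. rewrite letter_X, letter_Y, letter_mX, letter_mY, mmul_1_r. reflexivity.
      * simpl. rewrite Rabs_R0, Rabs_R1, E1. ring.
      * apply FI; lra.
      * apply (subword_intro [] [(c, (1, 0)); (b, (0, 1)); (c, (-1, 0)); (b, (0, -1))] []); subword_tac.
  - destruct (HWc th ph (proj1 Hth) Hph HR) as (t & Ht & Hl & Hcost).
    exists [(a, (1, 0)); (t, (p, q)); (b, (1, 0))], [(PI, (1, 0)); (t, (p, q)); (PI, (1, 0))].
    split; [|split; [|split; [|split]]].
    + repeat (apply List.Forall_cons; [simpl; split; [lra|assumption]|]); apply List.Forall_nil.
    + simpl wprod. rewrite !letter_X, Hl, mmul_1_r. reflexivity.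
    + simpl. rewrite Rabs_R0, Rabs_R1, (Rabs_pos_eq p), (Rabs_pos_eq q) by lra. lra.
    + exists (symgens g ++ [Grho]). right. left. exists t. split; [exact Ht|].
      now rewrite instantiate_patII.
    + apply (subword_intro [] [(PI, (1, 0)); (t, (p, q)); (PI, (1, 0))] []); subword_tac.
  - destruct (HWc th ph (proj1 Hth) Hph HR) as (t & Ht & Hl & Hcost).
    exists [(a, (1, 0)); (t, (p, q)); (b, (0, 1))], [(PI, (1, 0)); (t, (p, q)); (PI, (0, 1))].
    split; [|split; [|split; [|split]]].
    + repeat (apply List.Forall_cons; [simpl; split; [lra|assumption]|]); apply List.Forall_nil.
    + simpl wprod. rewrite letter_X, letter_Y, Hl, mmul_1_r. reflexivity.
    + simpl. rewrite Rabs_R0, Rabs_R1, (Rabs_pos_eq p), (Rabs_pos_eq q) by lra. lra.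
    + exists (symgens g ++ [Grho]). right. right. exists t. split; [exact Ht|].
      now rewrite instantiate_patIII.
    + apply (subword_intro [] [(PI, (1, 0)); (t, (p, q)); (PI, (0, 1))] []); subword_tac.
Qed.

Theorem theorem2p1 (X Y : vec) (kappa : R) :
  dot X X = 1 -> dot Y Y = 1 ->
  dot X Y = 0 ->                     (* c = cos alpha = 0, i.e. alpha = pi/2 *)
  0 < kappa <= 1 ->
  forall g : mat, inSO3 g ->
  exists w : word,
    optimal kappa X Y g w /\
    exists pw : word, pattern_family kappa (dot X Y) pw /\ subword w pw.
Proof.
  intros HX HY HXY Hk g Hg.
  set (Q := frame X Y).
  assert (HQ : (mtrans Q * Q)%M = mid3) by exact (frame_orth X Y HX HY HXY).
  assert (HQ' : (Q * mtrans Q)%M = mid3) by exact (frame_orth_r X Y HX HY HXY).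
  assert (Hdet : mdet Q = 1) by exact (frame_det X Y HX HY HXY).
  (* The target expressed in the frame of [X] and [Y], where factors become values of [letter]. *)
  set (g' := (mtrans Q * (g * Q))%M).
  assert (HgQ : g = (Q * (g' * mtrans Q))%M).
  { unfold g'. rewrite !mmul_assoc, HQ', mmul_1_r, <- mmul_assoc, HQ', mmul_1_l. reflexivity. }
  assert (Ho : orth g').
  { apply orth_mul; [unfold orth; rewrite mtransK; exact HQ'|]. apply orth_mul; [exact (proj1 Hg)|exact HQ]. }
  assert (HSO : inSO3 g').
  { split; [exact Ho|]. unfold g'. rewrite !mdet_mul, Hdet, (proj2 Hg).
    replace (mdet (mtrans Q)) with (mdet Q) by (unfold mdet; simpl; ring). rewrite Hdet. ring. }
  destruct (optimum_exists 1 kappa g') as (c & (s & M0 & HB & HM) & Hopt); [lra|lra|exact Ho| |].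
  { destruct (euler_XYX g' HSO) as (a & b & d & E). rewrite E. eexists.
    apply reach_app; [apply reach_Rx|]. apply reach_app; [apply reach_Ry|apply reach_Rx]. }
  destruct (word_of_baseq kappa s M0 c (proj1 Hk) HB) as (w & pw & W1 & W2 & W3 & W4 & W5).
  exists w. split.
  - split; [split|].
    + eapply List.Forall_impl; [|exact W1]. intros f [Hf1 Hf2]. split; [exact Hf1|].
      now apply fvec_neq0.
    + rewrite (word_prod_frame X Y HX HY HXY), W2, <- HM. symmetry. exact HgQ.
    + intros w' [Hw1 Hw2]. rewrite W3. apply Hopt.
      replace g' with (wprod w').
      * apply reach_wprod. eapply List.Forall_impl; [|exact Hw1]. intros [t [a b]] [Ht Hne]. simpl in *.
        split; [exact Ht|]. intros Eab. apply Hne. injection Eab as Ea Eb. rewrite Ea, Eb.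
        unfold fvec, vadd, vscale, vzero; simpl. f_equal; ring.
      * unfold g'. rewrite <- Hw2, (word_prod_frame X Y HX HY HXY). fold Q.
        rewrite !mmul_assoc, HQ, mmul_1_r, <- mmul_assoc, HQ, mmul_1_l. reflexivity.
  - exists pw. rewrite HXY. split; assumption.
Qed.
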